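(* Let $n\ge1$. Let $\psi\colon\mathrm{Sym}(n)\to\mathrm{SO}(n)$ be the unique continuous map with $\psi(0)=I$ such that $A\mapsto\exp(\psi(A)A\psi(A)^{-1})$ intertwines the Gelfand-Zeitlin maps $\lambda$ and $\mu$ on $\mathrm{Sym}(n)$ and $\mathrm{Sym}^+(n)$, and let $\gamma\colon\mathrm{Herm}(n)\to\mathrm{Herm}^+(n)$ be the unique continuous map such that $\mu\circ\gamma=\lambda$, $\gamma(t\bullet A)=t\bullet\gamma(A)$ for all $A\in\mathrm{Herm}_0(n)$ and $t\in T(n-1)\times\cdots\times T(1)$, and $\gamma(S)\subset S$ for every connected component $S$ of $\mathrm{Sym}_0(n)$. Then $\psi$ extends uniquely to a continuous (in fact, smooth) map $\psi\colon\mathrm{Herm}(n)\to\mathrm{SU}(n)$ with the equivariance property $$\psi(t\bullet A)=\tilde\chi(t,A)\,\psi(A)\,\chi(t,A)^{-1}$$ for all $A\in\mathrm{Herm}_0(n)$, $t\in T(n-1)\times\cdots\times T(1)$. The map $\gamma$ is expressed in terms of $\psi$ as $\gamma(A)=\exp(\psi(A)A\psi(A)^{-1})$ for all $A\in\mathrm{Herm}(n)$. Furthermore, (a) $\psi$ is equivariant for the conjugation action of $T(n)\subset\mathrm{U}(n)$ (on source and target); (b) $\overline{\psi(A)}=\psi(\overline{A})$; (c) for all $k\le n$, the map $\psi$ for $n$, composed with the inclusion $\mathrm{Herm}(k)\to\mathrm{Herm}(n)$ as the upper left corner (extended by zeros), equals the map $\psi$ for $k$ composed with the inclusion $\mathrm{SU}(k)\to\mathrm{SU}(n)$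 as the upper left corner (extended by $1$'s along the diagonal).
   Context: $\mathrm{Herm}(n)$ is the space of complex Hermitian $n\times n$ matrices, $\mathrm{Herm}^+(n)$ the positive definite ones, $\mathrm{Sym}(n)$, $\mathrm{Sym}^+(n)$ the real symmetric matrices in these. For $k\le n$, $A^{(k)}$ is the upper left $k\times k$ corner of $A$, with ordered eigenvalues $\lambda^{(k)}_1(A)\le\cdots\le\lambda^{(k)}_k(A)$. The Gelfand-Zeitlin map is $\lambda(A)=(\lambda^{(k)}_i(A))_{1\le i\le k\le n}$, and on positive definite matrices the logarithmic one is $\mu(A)=(\log\lambda^{(k)}_i(A))_{1\le i\le k\le n}$. $\mathrm{Herm}_0(n)$ is the set of $A\in\mathrm{Herm}(n)$ for which all inequalities $\lambda_i^{(k+1)}\le\lambda_i^{(k)}\le\lambda_{i+1}^{(k+1)}$, $1\le i\le k\le n-1$, are strict; $\mathrm{Sym}_0(n)=\mathrm{Herm}_0(n)\cap\mathrm{Sym}(n)$, $\mathrm{Herm}_0^+(n)=\mathrm{Herm}_0(n)\cap\mathrm{Herm}^+(n)$. $T(k)\subset\mathrm{U}(k)$ is the torus of diagonal unitary matrices, and $\mathrm{U}(k)\subset\mathrm{U}(n)$ is embedded as the upper left corner (extended by $1$'s on the diagonal). $T(k)$ acts on $\mathrm{Herm}_0(n)$ by $t\bullet A=(U^{-1}tU)A(U^{-1}tU)^{-1}$, where $U\in\mathrm{U}(k)$ is any matrix such that $UA^{(k)}U^{-1}$ is diagonal with entries $\lambda_1^{(k)}(A),\ldots,\lambda_k^{(k)}(A)$.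 These actions commute and preserve $\mathrm{Herm}^+_0(n)$; together they define the action of $T(n-1)\times\cdots\times T(1)$. For $A\in\mathrm{Herm}_0(n)$, let $U_k\in\mathrm{U}(k)$ be such that $U_kA^{(k)}U_k^{-1}$ is diagonal with entries the eigenvalues of $A^{(k)}$ in increasing order, and $V_k\in\mathrm{U}(k)$ such that $V_k\gamma(A)^{(k)}V_k^{-1}$ is diagonal with entries the eigenvalues of $\gamma(A)^{(k)}$ in increasing order. For $t=(t_{n-1},\ldots,t_1)\in T(n-1)\times\cdots\times T(1)$ put $$\chi(t,A)=U_1^{-1}t_1U_1\cdots U_{n-1}^{-1}t_{n-1}U_{n-1},\qquad \tilde\chi(t,A)=V_1^{-1}t_1V_1\cdots V_{n-1}^{-1}t_{n-1}V_{n-1}.$$ These do not depend on the choices of $U_k,V_k$, and $t\bullet A=\chi(t,A)A\chi(t,A)^{-1}$, $t\bullet\gamma(A)=\tilde\chi(t,A)\gamma(A)\tilde\chi(t,A)^{-1}$. The existence and uniqueness of the map $\psi$ on $\mathrm{Sym}(n)$ and of $\gamma$, as described in the claim, may be taken as given. *)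

(* Defs.v *)
Set Warnings "-notation-overridden,-ambiguous-paths,-notation-incompatible-prefix".
Set Warnings "-redundant-canonical-projection,-using-fallback-loc".
From HB Require Import structures.
From mathcomp Require Import all_boot all_order all_algebra.
From mathcomp Require Import spectral sesquilinear.
From mathcomp Require Import all_classical all_reals all_analysis.
From mathcomp.real_closed Require Import complex.

Set Implicit Arguments.
Unset Strict Implicit.
Unset Printing Implicit Defensive.

Import Order.TTheory GRing.Theory Num.Theory numFieldNormedType.Exports.

Local Open Scope ring_scope.
Local Open Scope complex_scope.
Local Open Scope classical_set_scope.
Local Open Scope sesquilinear_scope.

(* The library puts the norm topology on K^o for an abstract numFieldType K;
   this transfers it to the concrete type R[i], hence to 'M[R[i]]_n. *)
HB.instance Definition _ (R : rcfType) := GRing.ComAlgebra.copy R[i] R[i]^o.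
HB.instance Definition _ (R : rcfType) := Vector.copy R[i] R[i]^o.
HB.instance Definition _ (R : rcfType) := NormedModule.copy R[i] R[i]^o.

Definition Herm (R : realType) (n : nat) : set 'M[R[i]]_n :=
  [set A | A \is hermsymmx].

Definition Sym (R : realType) (n : nat) : set 'M[R[i]]_n :=
  [set A | A \is symmetricmx /\ A \is a realmx].

Definition Herm_pos (R : realType) (n : nat) : set 'M[R[i]]_n :=
  [set A | Herm A /\
     forall x : 'cV[R[i]]_n, x != 0 -> 0 < (x ^t* *m A *m x) ord0 ord0].

Definition SUn (R : realType) (n : nat) : set 'M[R[i]]_n :=
  [set U | U \is unitarymx /\ \det U = 1].

Definition SOn (R : realType) (n : nat) : set 'M[R[i]]_n :=
  [set U | [/\ U \is a realmx, U *m U^T = 1%:M & \det U = 1]].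

Definition torus (R : realType) (n : nat) : set 'M[R[i]]_n :=
  [set t | is_diag_mx t /\ t \is unitarymx].

Definition corner (T : Type) (n k : nat) (hk : (k <= n)%N) (A : 'M[T]_n) :
    'M[T]_k :=
  mxsub (widen_ord hk) (widen_ord hk) A.

(* B as upper left corner, c on the rest of the diagonal: c = 1 for the
   inclusions U(k) -> U(n) and SU(k) -> SU(n), c = 0 for Herm(k) -> Herm(n). *)
Definition extend (T : pzRingType) (c : T) (n k : nat) (hk : (k <= n)%N)
    (B : 'M[T]_k) : 'M[T]_n :=
  castmx (subnKC hk, subnKC hk) (block_mx B 0 0 c%:M).

(* Eigenvalues with algebraic multiplicity, in increasing order. Taking real
   parts loses nothing for Hermitian matrices, the only ones it is used for.
   Indices start from 0. *)
Definition eigval (R : realType) (n : nat) (A : 'M[R[i]]_n) (i : 'I_n) : R :=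
  nth 0 (sort <=%R [seq complex.Re z |
                      z <- sval (closed_field_poly_normal (char_poly A))]) i.

(* The Gelfand-Zeitlin map and its logarithmic version. *)
Definition lambda (R : realType) (n k : nat) (hk : (k <= n)%N)
    (A : 'M[R[i]]_n) (i : 'I_k) : R :=
  eigval (corner hk A) i.

Definition mu (R : realType) (n k : nat) (hk : (k <= n)%N)
    (A : 'M[R[i]]_n) (i : 'I_k) : R :=
  ln (lambda hk A i).

Definition Herm0 (R : realType) (n : nat) : set 'M[R[i]]_n :=
  [set A | Herm A /\
     forall (k : nat) (hk : (k < n)%N) (i : 'I_k),
       lambda hk A (widen_ord (leqnSn k) i) < lambda (ltnW hk) A i
         < lambda hk A (lift ord0 i)].

Definition Sym0 (R : realType) (n : nat) : set 'M[R[i]]_n :=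
  @Herm0 R n `&` @Sym R n.

Definition diagonalizes (R : realType) (n : nat) (A U : 'M[R[i]]_n) : Prop :=
  U \is unitarymx /\
  U *m A *m invmx U = diag_mx (\row_i (eigval A i)%:C).

(* An arbitrary choice of U; it exists for Hermitian A. For distinct
   eigenvalues U is unique up to left multiplication by a diagonal unitary
   matrix, so U^-1 t U below does not depend on the choice. *)
Definition diagonalizer (R : realType) (n : nat) (A : 'M[R[i]]_n) :
    'M[R[i]]_n :=
  xget 1%:M (diagonalizes A).

Definition torus_elt (R : realType) (n k : nat) (hk : (k <= n)%N)
    (t : 'M[R[i]]_k) (A : 'M[R[i]]_n) : 'M[R[i]]_n :=
  let U := diagonalizer (corner hk A) in
  extend 1 hk (invmx U *m t *m U).

Definition torus_act (R : realType) (n k : nat) (hk : (k <= n)%N)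
    (t : 'M[R[i]]_k) (A : 'M[R[i]]_n) : 'M[R[i]]_n :=
  torus_elt hk t A *m A *m invmx (torus_elt hk t A).

(* An element of T(n-1) x ... x T(1) is a family indexed by k : 'I_n, the
   component k = 0 being the only 0 x 0 matrix. *)
Definition tori (R : realType) (n : nat) (t : forall k : 'I_n, 'M[R[i]]_k) :
    Prop :=
  forall k : 'I_n, torus (t k).

(* The actions of the T(k) commute; T(1) is applied first. *)
Definition tori_act (R : realType) (n : nat) (t : forall k : 'I_n, 'M[R[i]]_k)
    (A : 'M[R[i]]_n) : 'M[R[i]]_n :=
  foldl (fun B (k : 'I_n) => torus_act (ltnW (ltn_ord k)) (t k) B)
    A (enum 'I_n).

(* The product is ordered by increasing k. *)
Definition chi (R : realType) (n : nat) (t : forall k : 'I_n, 'M[R[i]]_k)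
    (A : 'M[R[i]]_n) : 'M[R[i]]_n :=
  \prod_(k < n) torus_elt (ltnW (ltn_ord k)) (t k) A.

Definition expmx (R : realType) (n : nat) (A : 'M[R[i]]_n) : 'M[R[i]]_n :=
  lim (series (fun m : nat => (m`!%:R : R[i])^-1 *: A ^+ m) @ \oo).

Definition exp_conj (R : realType) (n : nat) (U A : 'M[R[i]]_n) :
    'M[R[i]]_n :=
  expmx (U *m A *m invmx U).

(* F is of class C^m on the real vector space Herm(n): it is continuous and
   its derivative along every Hermitian direction is of class C^(m-1). *)
Fixpoint Cm_on_Herm (R : realType) (n m : nat) (F : 'M[R[i]]_n -> R) : Prop :=
  {within @Herm R n, continuous F} /\
  if m is m'.+1 then
    forall H : 'M[R[i]]_n, Herm H ->
    exists G : 'M[R[i]]_n -> R,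
      Cm_on_Herm m' G /\
      forall A : 'M[R[i]]_n, Herm A ->
        is_derive (0 : R) (1 : R) (fun s : R => F (A + s%:C *: H)) (G A)
  else True.

Definition smooth_on_Herm (R : realType) (n : nat)
    (f : 'M[R[i]]_n -> 'M[R[i]]_n) : Prop :=
  forall (m : nat) (i j : 'I_n),
    Cm_on_Herm m (fun A => complex.Re (f A i j)) /\
    Cm_on_Herm m (fun A => complex.Im (f A i j)).

(* Maps with domain S are represented by total functions considered on S. *)
Definition unique_on (T U : Type) (S : set T) (P : (T -> U) -> Prop)
    (f : T -> U) : Prop :=
  P f /\ forall g : T -> U, P g -> forall x : T, S x -> g x = f x.

Definition is_psi_sym (R : realType) (n : nat)
    (psi : 'M[R[i]]_n -> 'M[R[i]]_n) : Prop :=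
  [/\ {within @Sym R n, continuous psi},
      forall A, Sym A -> SOn (psi A),
      psi 0 = 1%:M
    & forall A, Sym A -> forall (k : nat) (hk : (k <= n)%N),
        mu hk (exp_conj (psi A) A) =1 lambda hk A].

Definition is_gamma (R : realType) (n : nat)
    (gamma : 'M[R[i]]_n -> 'M[R[i]]_n) : Prop :=
  [/\ {within @Herm R n, continuous gamma},
      forall A, Herm A -> Herm_pos (gamma A),
      forall A, Herm A -> forall (k : nat) (hk : (k <= n)%N),
        mu hk (gamma A) =1 lambda hk A,
      forall A t, Herm0 A -> tori t -> gamma (tori_act t A) = tori_act t (gamma A)
    & forall A, Sym0 A ->
        gamma @` connected_component (@Sym0 R n) A
          `<=` connected_component (@Sym0 R n) A].

Definition is_psi_ext (R : realType) (n : nat)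
    (psi0 gamma psi : 'M[R[i]]_n -> 'M[R[i]]_n) : Prop :=
  [/\ {within @Herm R n, continuous psi},
      forall A, Herm A -> SUn (psi A),
      forall A, Sym A -> psi A = psi0 A
    & forall A t, Herm0 A -> tori t ->
        psi (tori_act t A) = chi t (gamma A) *m psi A *m invmx (chi t A)].

(* Main.v *)
From mathcomp Require Import fingroup perm.
Require Import Defs.
Set Warnings "-notation-overridden,-ambiguous-paths,-notation-incompatible-prefix".
From HB Require Import structures.
From mathcomp Require Import all_boot all_order all_algebra.
From mathcomp Require Import spectral sesquilinear.
From mathcomp Require Import all_classical all_reals all_analysis.
From mathcomp.real_closed Require Import complex.
From mathcomp Require Import ring lra.
Import Order.TTheory GRing.Theory Num.Theory numFieldNormedType.Exports.
Local Open Scope ring_scope.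
Local Open Scope complex_scope.
Local Open Scope classical_set_scope.
Local Open Scope sesquilinear_scope.

Set Implicit Arguments.
Unset Strict Implicit.
Unset Printing Implicit Defensive.

(** The idea is to conjugate one corner at a time. Suppose that for every Hermitian
    matrix [A] of size [n + 1] there is a unitary matrix [phi A] such that
    [phi(A) exp(A) phi(A)^-1] has the upper left corner [exp(A')], where [A'] is the
    upper left corner of [A] of size [n]. Put [psi(A) = psi(A') phi(A)], with [psi(A')]
    extended by 1. Then the corner of [gamma(A) = psi(A) exp(A) psi(A)^-1] is
    [gamma(A')], hence by induction all eigenvalues of corners of [gamma(A)] are the
    exponentials of those of [A].

    Construction of [phi]. Let [x] and [y] be the eigenvalues of [A] and [A'], strictly
    interlacing. In an eigenbasis of [A'] the eigenvectors of [A] form a Cauchy matrix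
    with entries [b_i v_j / (x_j - y_i)] and last row [v_j]. By Lagrange interpolation
    the moduli of [v_j] and [b_i] are determined by [x] and [y], and conversely every
    such Cauchy matrix is unitary and reproduces the spectrum [y] in the corner
    ([cauchy_unitary], [cauchy_corner]). Keeping the phases and replacing [x], [y] by
    their exponentials multiplies the entries by explicit factors, which involve only
    square roots of difference quotients [(exp s - exp t) / (s - t)]. These are
    positive and smooth in [s] and [t], also for [s = t]. Therefore [phi] can be defined
    for all [A] by functional calculus in the two variables [A] and [A'], and the
    identities extend from the dense set of strictly interlacing matrices
    ([phi_unitary], [phi_corner], by [generic_dense] and [generic_closure]).

    Smoothness ([psi_smooth]). Eigenvectors are not continuous, so derivatives are
    computed on sums over spectral projections: moving one projection from [A] to [B]
    brings in the divided difference of the function and one more projection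
    ([Phi_diff]). Functions whose iterated divided differences are bounded on boxes are
    closed under products, inverses and square roots, and contain the divided
    differences of the exponential.

    Symmetries. Functional calculus gives the equivariance of [phi] under conjugation
    by [U(n) x U(1)] and under complex conjugation, and [phi = 1] if [A] is the extension
    of [A'] by zero. This yields (a), (b), (c) and the torus equivariance ([psi_rots]).
    The determinant of [phi] is real of modulus 1, hence constantly 1 along segments
    from zero ([det_phi]).

    Identification. On real symmetric matrices [psi] satisfies the conditions that
    characterize [psi0] ([psi_sym]), and [gam] those that characterize [gamma]
    ([gam_gamma]); for the condition on connected components, [scaling_path] joins a
    matrix with its image. Finally [psi] is unique, since every matrix with strict
    inequalities lies in the torus orbit of a real one ([generic_orbit]) and such
    matrices are dense. *)

(** * Adjoints, unitary matrices and functional calculus *)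

Section Adjoint.
Variable C : numClosedFieldType.

Lemma adjE m n (A : 'M[C]_(m, n)) i j : (A^t* ) i j = Num.conj (A j i).
Proof. by rewrite !mxE. Qed.

Lemma adjM m n p (A : 'M[C]_(m, n)) (B : 'M[C]_(n, p)) :
  (A *m B)^t* = B^t* *m A^t*.
Proof. by rewrite trmx_mul map_mxM. Qed.

Lemma adj1 n : (1%:M : 'M[C]_n)^t* = 1%:M.
Proof. by rewrite trmx1 map_mx1. Qed.

Lemma adjD m n (A B : 'M[C]_(m, n)) : (A + B)^t* = A^t* + B^t*.
Proof. by rewrite linearD /= map_mxD. Qed.

Lemma adj_conj m n (A : 'M[C]_(m, n)) :
  (map_mx Num.conj A)^t* = map_mx Num.conj (A^t* ).
Proof. by apply/matrixP => i j; rewrite !mxE. Qed.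

Lemma hermitianP n (A : 'M[C]_n) : A \is hermsymmx <-> A^t* = A.
Proof.
split; first by move/is_hermitianmxP; rewrite expr0 scale1r.
by move=> h; apply/is_hermitianmxP; rewrite expr0 scale1r.
Qed.

Lemma unitary_mulVl n (U : 'M[C]_n) : U \is unitarymx -> U^t* *m U = 1%:M.
Proof. by move/unitarymxP/mulmx1C. Qed.

Lemma unitary_mulV n (U : 'M[C]_n) : U \is unitarymx -> U *m U^t* = 1%:M.
Proof. by move/unitarymxP. Qed.

Lemma unitaryM n (U V : 'M[C]_n) :
  U \is unitarymx -> V \is unitarymx -> U *m V \is unitarymx.
Proof. exact: mul_unitarymx. Qed.

Lemma unitaryV n (U : 'M[C]_n) : U \is unitarymx -> U^t* \is unitarymx.
Proof. by rewrite trmxC_unitary. Qed.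

Lemma unitary1 n : (1%:M : 'M[C]_n) \is unitarymx.
Proof. by apply/unitarymxP; rewrite adj1 mulmx1. Qed.

Lemma unitary_norm n (U : 'M[C]_n) i j : U \is unitarymx -> `|U i j| <= 1.
Proof.
move=> /unitarymxP /matrixP /(_ i i); rewrite !mxE eqxx => h.
have hs : \sum_k `|U i k| ^+ 2 = 1.
  by rewrite -[RHS]h; apply: eq_bigr => k _; rewrite normCK !mxE.
rewrite -(@ler_pXn2r _ 2) ?nnegrE // expr1n -hs (bigD1 j) //= lerDl.
by apply: sumr_ge0 => k _; exact: exprn_ge0.
Qed.

(** Functional calculus: if [U] diagonalizes [A] with eigenvalues [x], then
    [spm U (g \o x)] is [g] applied to [A]. *)
Definition spm n (U : 'M[C]_n) (f : 'I_n -> C) : 'M[C]_n :=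
  U^t* *m diag_mx (\row_i f i) *m U.

Lemma diag_rowM n (f g : 'I_n -> C) :
  diag_mx (\row_i f i) *m diag_mx (\row_i g i) = diag_mx (\row_i (f i * g i)).
Proof. by rewrite mulmx_diag; congr diag_mx; apply/rowP => i; rewrite !mxE. Qed.

Lemma spmE n (U : 'M[C]_n) f a b :
  spm U f a b = \sum_j Num.conj (U j a) * U j b * f j.
Proof.
rewrite /spm -mulmxA mxE; apply: eq_bigr => j _.
rewrite mul_diag_mx !mxE; ring.
Qed.

Lemma eq_spm n (U : 'M[C]_n) f g : f =1 g -> spm U f = spm U g.
Proof.
by move=> /funext ->.
Qed.

Lemma spm1 n (U : 'M[C]_n) : U \is unitarymx -> spm U (fun=> 1) = 1%:M.
Proof.
move=> hU; rewrite /spm (_ : \row_i 1 = const_mx 1); last by apply/rowP=> i; rewrite !mxE.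
by rewrite diag_const_mx mulmx1 unitary_mulVl.
Qed.

Lemma spmM n (U : 'M[C]_n) f g : U \is unitarymx ->
  spm U f *m spm U g = spm U (fun i => f i * g i).
Proof.
move=> hU; rewrite /spm !mulmxA -(mulmxA _ U (U^t* )) unitary_mulV // mulmx1.
by rewrite -(mulmxA (U^t* )) diag_rowM.
Qed.

Lemma spm_adj n (U : 'M[C]_n) f : (spm U f)^t* = spm U (fun i => Num.conj (f i)).
Proof.
apply/matrixP => i j; rewrite adjE !spmE rmorph_sum /=.
by apply: eq_bigr => k _; rewrite !rmorphM /= conjCK; ring.
Qed.

Lemma spm_conj n (U : 'M[C]_n) f :
  map_mx Num.conj (spm U f) = spm (map_mx Num.conj U) (fun i => Num.conj (f i)).
Proof.
apply/matrixP => i j; rewrite [LHS]mxE !spmE rmorph_sum /=.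
by apply: eq_bigr => k _; rewrite !rmorphM /= !mxE.
Qed.

Lemma spm_mulr n (U W : 'M[C]_n) f : spm (U *m W) f = W^t* *m spm U f *m W.
Proof. by rewrite /spm adjM !mulmxA. Qed.

Lemma spm_scale n (U : 'M[C]_n) f c : spm U (fun i => c * f i) = c *: spm U f.
Proof.
apply/matrixP => a b; rewrite [RHS]mxE !spmE mulr_sumr.
by apply: eq_bigr => j _; ring.
Qed.

Lemma mul_spm_diag n (U : 'M[C]_n) f : U \is unitarymx ->
  U *m spm U f *m U^t* = diag_mx (\row_i f i).
Proof.
by move=> hU; rewrite /spm !mulmxA unitary_mulV // mul1mx -mulmxA
  unitary_mulV // mulmx1.
Qed.

(** The change of basis between two diagonalizations commutes with the diagonal
    matrices, so it only connects indices with equal eigenvalues. *)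
Lemma spm_intertwine n (U V : 'M[C]_n) f g i j :
  U \is unitarymx -> V \is unitarymx -> spm U f = spm V g ->
  (V *m U^t* ) i j * f j = g i * (V *m U^t* ) i j.
Proof.
move=> hU hV h.
have : V *m spm U f *m U^t* = V *m spm V g *m U^t* by rewrite h.
rewrite /spm !mulmxA unitary_mulV // mul1mx -(mulmxA _ U) unitary_mulV // mulmx1.
rewrite -(mulmxA (diag_mx _) V) => /matrixP /(_ i j).
by rewrite mul_mx_diag mul_diag_mx !mxE.
Qed.

(** By [spm_intertwine], functional calculus does not depend on the choice of a
    diagonalization. *)
Lemma spm_calc n (U V : 'M[C]_n) (x y f g : 'I_n -> C) :
  U \is unitarymx -> V \is unitarymx -> spm U x = spm V y ->
  (forall i j, x j = y i -> f j = g i) -> spm U f = spm V g.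
Proof.
move=> hU hV h fg.
have E : (V *m U^t* ) *m diag_mx (\row_i f i) = diag_mx (\row_i g i) *m (V *m U^t* ).
  apply/matrixP => i j; rewrite mul_mx_diag mul_diag_mx.
  rewrite [in LHS]mxE [in RHS]mxE [(\row_i f i) _ _]mxE [(\row_i g i) _ _]mxE.
  case: (eqVneq ((V *m U^t* ) i j) 0) => [->|h0]; first by rewrite mul0r mulr0.
  have xy : x j = y i.
    apply: (mulIf h0); rewrite mulrC.
    exact: (spm_intertwine i j hU hV h).
  by rewrite (fg i j xy) mulrC.
have : V^t* *m (V *m U^t* *m diag_mx (\row_i f i)) *m U =
       V^t* *m (diag_mx (\row_i g i) *m (V *m U^t* )) *m U by rewrite E.
rewrite /spm !mulmxA unitary_mulVl // mul1mx => ->.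
by rewrite -(mulmxA _ (U^t* ) U) unitary_mulVl // mulmx1.
Qed.

Lemma spm_eigen_mul n (U A W : 'M[C]_n) f : U \is unitarymx -> W \is unitarymx ->
  A = spm U f -> W *m A *m W^t* = spm (U *m W^t* ) f.
Proof. by move=> hU hW ->; rewrite spm_mulr trmxCK. Qed.



Lemma char_poly_conj n (U D : 'M[C]_n) : U \is unitarymx ->
  char_poly (U^t* *m D *m U) = char_poly D.
Proof.
move=> hU; rewrite /char_poly /char_poly_mx.
have E : 'X%:M - map_mx polyC (U^t* *m D *m U) =
   map_mx polyC (U^t* ) *m ('X%:M - map_mx polyC D) *m map_mx polyC U.
  rewrite mulmxBr mulmxBl !map_mxM; congr (_ - _).
  rewrite -mulmxA -scalar_mxC mulmxA -map_mxM unitary_mulVl // map_mx1.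
  by rewrite mul1mx.
rewrite E !det_mulmx mulrAC -det_mulmx -map_mxM unitary_mulVl // map_mx1 det1.
by rewrite mul1r.
Qed.

Lemma perm_mx_unitary n (s : {perm 'I_n}) : (perm_mx s : 'M[C]_n) \is unitarymx.
Proof.
apply/unitarymxP; rewrite tr_perm_mx map_perm_mx -perm_mxM.
by rewrite mulgV perm_mx1.
Qed.

(** Used to sort the eigenvalues. *)
Lemma spm_perm n (U : 'M[C]_n) (s : {perm 'I_n}) f :
  spm (perm_mx s *m U) f = spm U (fun i => f ((s^-1)%g i)).
Proof.
apply/matrixP => a b; rewrite !spmE (reindex_perm s^-1%g) /=.
apply: eq_bigr => j _; rewrite -row_permE !mxE.
by rewrite permKV.
Qed.

Lemma hermitian_spm n (A : 'M[C]_n) : A^t* = A ->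
  exists U d, [/\ U \is unitarymx, A = spm U d & forall i, d i \is Num.real].
Proof.
move=> /hermitianP hA; have /orthomx_spectralP hd := hermitian_normalmx hA.
exists (spectralmx A), (fun i => spectral_diag A 0 i); split.
- exact: spectral_unitarymx.
- rewrite {1}hd invmx_unitary ?spectral_unitarymx // /spm.
  by congr (_ *m diag_mx _ *m _); apply/rowP => i; rewrite mxE.
- by move=> i; have /mxOverP := hermitian_spectral_diag_real hA; exact.
Qed.

End Adjoint.

(** * Ordered eigenvalues of Hermitian matrices *)

Section ComplexModulus.
Variable R : realType.
Local Notation C := R[i].
Implicit Types z w : C.

Definition cmod z : R := complex.Re `|z|.

Lemma cmodE z : (cmod z)%:C = `|z|.
Proof. by rewrite /cmod RRe_real // normr_real. Qed.

Lemma Re_cmod z : `|complex.Re z| <= cmod z.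
Proof. by rewrite -lecR cmodE normc_ge_Re. Qed.

Lemma cmod_def z : cmod z = Num.sqrt (complex.Re z ^+ 2 + complex.Im z ^+ 2).
Proof. by apply: complexI; rewrite cmodE normc_def. Qed.

Lemma Im_cmod z : `|complex.Im z| <= cmod z.
Proof. by rewrite cmod_def -sqrtr_sqr ler_wsqrtr // lerDr sqr_ge0. Qed.

Lemma conj_real (x : R) : Num.conj x%:C = x%:C.
Proof. exact: conjc_real. Qed.

Lemma real_fixed z : Num.conj z = z -> z = (complex.Re z)%:C.
Proof.
case: z => a b /= h; move: (congr1 (@complex.Im R) h) => /= hb.
have -> // : b = 0.
by lra.
Qed.

End ComplexModulus.


Section RealSpectrum.
Variable R : realType.
Local Notation C := R[i].

Definition spmr n (U : 'M[C]_n) (f : 'I_n -> R) : 'M[C]_n :=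
  spm U (fun i => (f i)%:C).

Lemma hermP n (A : 'M[C]_n) : Herm A <-> A^t* = A.
Proof. exact: hermitianP. Qed.

Lemma spmr_herm n (U : 'M[C]_n) f : Herm (spmr U f).
Proof.
by apply/hermP; rewrite /spmr spm_adj; apply: eq_spm => i; rewrite conj_real.
Qed.

End RealSpectrum.

Section Eigenvalues.
Variable R : realType.
Local Notation C := R[i].

Definition eigvals n (A : 'M[C]_n) : seq R :=
  [seq complex.Re z | z <- sval (closed_field_poly_normal (char_poly A))].

Lemma eigvals_perm n (U : 'M[C]_n) (x : 'I_n -> R) : U \is unitarymx ->
  perm_eq (eigvals (spmr U x)) [seq x i | i <- enum 'I_n].
Proof.
move=> hU; rewrite /eigvals; case: closed_field_poly_normal => r /= hr.
have -> : [seq x i | i <- enum 'I_n] =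
          [seq complex.Re z | z <- [seq (x i)%:C | i <- enum 'I_n]].
  by rewrite -map_comp; apply: eq_map.
apply: perm_map; move: hr.
rewrite /spmr /spm char_poly_conj // (monicP (char_poly_monic _)) scale1r => hr.
have : \prod_(z <- r) ('X - z%:P) =
       \prod_(z <- [seq (x i)%:C | i <- enum 'I_n]) ('X - z%:P).
  rewrite -hr char_poly_trig ?diag_mx_is_trig // big_map big_enum /=.
  by apply: eq_bigr => i _; rewrite !mxE eqxx mulr1n.
by move/eqP; rewrite -(inj_eq val_inj) /= => /eqP/val_inj;
   exact: prod_XsubC_eq.
Qed.

Lemma eigval_eq n (U : 'M[C]_n) (x : 'I_n -> R) : U \is unitarymx ->
  {homo x : i j / (i <= j)%N >-> i <= j} -> eigval (spmr U x) =1 x.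
Proof.
move=> hU hx i; rewrite /eigval -/(eigvals _).
have -> : sort <=%R (eigvals (spmr U x)) = [seq x i | i <- enum 'I_n].
  apply: (@sorted_eq _ <=%R); [exact: le_trans|exact: le_anti| | |].
  - by apply: sort_sorted; exact: le_total.
  - rewrite sorted_map; apply: (@sub_sorted _ (fun i j : 'I_n => (i <= j)%N)).
      by move=> a b /hx.
    rewrite -(@sorted_map _ _ val leq) val_enum_ord.
    exact: iota_sorted.
  - by rewrite perm_sort eigvals_perm.
rewrite (nth_map i) ?size_enum_ord //.
by rewrite nth_ord_enum.
Qed.

Lemma eigval_sorted n (A : 'M[C]_n) :
  (n <= size (eigvals A))%N -> {homo @eigval R n A : i j / (i <= j)%N >-> i <= j}.
Proof.
move=> hs i j ij; rewrite /eigval -/(eigvals A).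
have hso : sorted <=%R (sort <=%R (eigvals A)).
  by apply: sort_sorted; exact: le_total.
apply: (sorted_leq_nth le_trans lexx) => //; rewrite inE size_sort.
- exact: leq_trans (ltn_ord i) hs.
- exact: leq_trans (ltn_ord j) hs.
Qed.

Lemma herm_spmr n (A : 'M[C]_n) : Herm A ->
  exists U x, U \is unitarymx /\ A = spmr U x.
Proof.
move=> /hermP /hermitian_spm [U [d [hU hA hd]]].
exists U, (fun i => complex.Re (d i)); split; first exact: hU.
rewrite [LHS]hA; apply: eq_spm => i.
by rewrite (RRe_real (hd i)).
Qed.

Lemma diagonalizes_spmr n (A U : 'M[C]_n) :
  diagonalizes A U <-> U \is unitarymx /\ A = spmr U (@eigval R n A).
Proof.
rewrite /diagonalizes; split=> [[hU h]|[hU h]]; split => //.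
  rewrite /spmr /spm -h invmx_unitary // !mulmxA unitary_mulVl // mul1mx.
  by rewrite -mulmxA unitary_mulVl // mulmx1.
by rewrite {1}h invmx_unitary // mul_spm_diag.
Qed.

Lemma exists_diagonalizes n (A : 'M[C]_n) : Herm A ->
  exists U, diagonalizes A U.
Proof.
move=> hA; have [U [x [hU hAx]]] := herm_spmr hA.
have hp : perm_eq (sort <=%R (eigvals A)) [seq x i | i <- enum 'I_n].
  by rewrite perm_sort hAx eigvals_perm.
have sz : size (sort <=%R (eigvals A)) == n.
  by rewrite (perm_size hp) size_map size_enum_ord.
have /tuple_permP [s hs] : perm_eq (Tuple sz) [tuple x i | i < n] by [].
exists (perm_mx s *m U); apply/diagonalizes_spmr; split.
  exact: (unitaryM (perm_mx_unitary _ s) hU).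
rewrite /spmr spm_perm; rewrite [LHS]hAx /spmr; apply: eq_spm => k.
congr (_%:C); have := congr1 (fun t : seq R => nth 0 t ((s^-1)%g k)) hs.
rewrite /= -/(eigvals A) -/(eigval A _) => ->.
rewrite (nth_map ((s^-1)%g k)) ?size_enum_ord // nth_ord_enum.
by rewrite tnth_mktuple permKV.
Qed.

Lemma diagonalizerP n (A : 'M[C]_n) : Herm A -> diagonalizes A (diagonalizer A).
Proof.
move=> /exists_diagonalizes [U hU]; rewrite /diagonalizer.
by apply: xgetPex; exists U.
Qed.

Lemma diagonalizer_unitary n (A : 'M[C]_n) : Herm A ->
  diagonalizer A \is unitarymx.
Proof. by move/diagonalizerP => []. Qed.

Lemma diagonalizer_eq n (A : 'M[C]_n) : Herm A ->
  A = spmr (diagonalizer A) (@eigval R n A).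
Proof. by move/diagonalizerP/diagonalizes_spmr => []. Qed.

Lemma size_eigvals n (A : 'M[C]_n) : Herm A -> size (eigvals A) = n.
Proof.
move=> /herm_spmr [U [x [hU ->]]].
by rewrite (perm_size (eigvals_perm x hU)) size_map size_enum_ord.
Qed.

Lemma eigval_homo n (A : 'M[C]_n) : Herm A ->
  {homo @eigval R n A : i j / (i <= j)%N >-> i <= j}.
Proof. by move=> hA; apply: eigval_sorted; rewrite size_eigvals. Qed.

Lemma eigval_perm n (U : 'M[C]_n) (x : 'I_n -> R) : U \is unitarymx ->
  perm_eq [seq eigval (spmr U x) i | i <- enum 'I_n] [seq x i | i <- enum 'I_n].
Proof.
move=> hU; apply: perm_trans (eigvals_perm x hU).
have hs := size_eigvals (spmr_herm U x).
apply: (@perm_trans _ (sort <=%R (eigvals (spmr U x)))); last first.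
  by rewrite perm_sort.
suff -> : [seq eigval (spmr U x) i | i <- enum 'I_n] =
  sort <=%R (eigvals (spmr U x)) by [].
apply: (@eq_from_nth _ 0); first by rewrite size_map size_sort hs size_enum_ord.
move=> i; rewrite size_map size_enum_ord => hi.
by rewrite (nth_map (Ordinal hi)) ?size_enum_ord // /eigval nth_enum_ord.
Qed.

End Eigenvalues.

(** * Locally Lipschitz and smooth functions of Hermitian matrices *)

(** What the argument uses of the complex numbers: the embedding of the real
    numbers, the absolute value and, for Hermitian matrices, the ordered
    eigenvalues [eig] with a chosen diagonalization [dia]. The instance for
    [R[i]] is [cx] below. *)
Record complexes (R : realType) := Complexes {
  cxfield :> numClosedFieldType;
  ofR : {rmorphism R -> cxfield};
  cxmod : cxfield -> R;
  eig : forall n, 'M[cxfield]_n -> 'I_n -> R;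
  dia : forall n, 'M[cxfield]_n -> 'M[cxfield]_n;
  _ : forall x, Num.conj (ofR x) = ofR x;
  _ : forall x y, (ofR x <= ofR y) = (x <= y);
  _ : forall z, ofR (cxmod z) = `|z|;
  _ : forall n (A : 'M[cxfield]_n), A^t* = A -> dia A \is unitarymx;
  _ : forall n (A : 'M[cxfield]_n), A^t* = A ->
        A = spm (dia A) (fun i => ofR (eig A i));
  _ : forall n (A : 'M[cxfield]_n), A^t* = A ->
        {homo @eig n A : i j / (i <= j)%N >-> i <= j};
  _ : forall n (U : 'M[cxfield]_n) (x : 'I_n -> R), U \is unitarymx ->
        {homo x : i j / (i <= j)%N >-> i <= j} ->
        eig (spm U (fun i => ofR (x i))) =1 x;
  _ : forall n (U : 'M[cxfield]_n) (x : 'I_n -> R), U \is unitarymx ->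
        perm_eq [seq eig (spm U (fun i => ofR (x i))) i | i <- enum 'I_n]
                [seq x i | i <- enum 'I_n]
}.

Section ComplexBasics.
Variables (R : realType) (K : complexes R).
Implicit Types z w : K.
Notation "x %:K" := (ofR K x) (at level 2, format "x %:K").

Lemma conjK x : Num.conj x%:K = x%:K. Proof. by case: K. Qed.
Lemma leK x y : (x%:K <= y%:K) = (x <= y). Proof. by case: K. Qed.
Lemma cxmodE z : (cxmod z)%:K = `|z|. Proof. by case: K z. Qed.
Lemma dia_unitary n (A : 'M[K]_n) : A^t* = A -> dia A \is unitarymx.
Proof. by case: K n A. Qed.
Lemma dia_eq n (A : 'M[K]_n) : A^t* = A ->
  spm (dia A) (fun i => (eig A i)%:K) = A.
Proof. by case: K n A => C ? ? ? ? ? ? ? ? h ? ? ? n A hA; rewrite -h. Qed.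
Lemma eig_homo n (A : 'M[K]_n) : A^t* = A ->
  {homo @eig R K n A : i j / (i <= j)%N >-> i <= j}.
Proof. by case: K n A. Qed.
Lemma eig_spm n (U : 'M[K]_n) (x : 'I_n -> R) : U \is unitarymx ->
  {homo x : i j / (i <= j)%N >-> i <= j} ->
  eig (spm U (fun i => (x i)%:K)) =1 x.
Proof. by case: K U => C ? ? ? ? ? ? ? ? ? ? h ? U; exact: h. Qed.
Lemma eig_perm n (U : 'M[K]_n) (x : 'I_n -> R) : U \is unitarymx ->
  perm_eq [seq eig (spm U (fun i => (x i)%:K)) i | i <- enum 'I_n]
          [seq x i | i <- enum 'I_n].
Proof. by case: K U => C ? ? ? ? ? ? ? ? ? ? ? h U; exact: h. Qed.

Lemma inj_ofR : injective (ofR K).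
Proof. by move=> x y h; apply: le_anti; rewrite -!leK h lexx. Qed.

Lemma cxmod_ge0 z : 0 <= cxmod z.
Proof. by rewrite -leK cxmodE rmorph0. Qed.

Lemma cxmod0 : cxmod (0 : K) = 0.
Proof. by apply: inj_ofR; rewrite cxmodE normr0 rmorph0. Qed.

Lemma cxmodM z w : cxmod (z * w) = cxmod z * cxmod w.
Proof. by apply: inj_ofR; rewrite rmorphM /= !cxmodE normrM. Qed.

Lemma cxmodN z : cxmod (- z) = cxmod z.
Proof. by apply: inj_ofR; rewrite !cxmodE normrN. Qed.

Lemma cxmodB z w : cxmod (z - w) = cxmod (w - z).
Proof. by rewrite -opprB cxmodN. Qed.

Lemma cxmodD z w : cxmod (z + w) <= cxmod z + cxmod w.
Proof. by rewrite -leK rmorphD /= !cxmodE ler_normD. Qed.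

Lemma cxmod_ofR (x : R) : cxmod x%:K = `|x|.
Proof.
apply: inj_ofR; rewrite cxmodE; have [x0|x0] := leP 0 x.
  by rewrite (ger0_norm x0) ger0_norm // -(rmorph0 (ofR K)) leK.
rewrite (ltr0_norm x0) ler0_norm ?rmorphN // -(rmorph0 (ofR K)) leK.
exact: ltW.
Qed.

Lemma cxmod_conj z : cxmod (Num.conj z) = cxmod z.
Proof. by apply: inj_ofR; rewrite !cxmodE norm_conjC. Qed.

Lemma cxmod_sum (I : Type) (r : seq I) (P : pred I) (F : I -> K) :
  cxmod (\sum_(i <- r | P i) F i) <= \sum_(i <- r | P i) cxmod (F i).
Proof.
elim/big_ind2 : _ => [|u x v y ux vy|i _]; rewrite ?cxmod0 //.
exact: le_trans (cxmodD _ _) (lerD ux vy).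
Qed.

Lemma cxmod_sqr z : ((cxmod z) ^+ 2)%:K = z * Num.conj z.
Proof. by rewrite rmorphXn /= cxmodE normCK. Qed.

Lemma cxmod_eq0 z : cxmod z = 0 -> z = 0.
Proof. by move=> z0; apply/eqP; rewrite -normr_eq0 -cxmodE z0 rmorph0. Qed.

Lemma unitary_cxmod n (U : 'M[K]_n) i j : U \is unitarymx -> cxmod (U i j) <= 1.
Proof. by move=> hU; rewrite -leK cxmodE rmorph1; exact: unitary_norm. Qed.

Definition bounded_by n m M (A : 'M[K]_(n, m)) := forall i j, cxmod (A i j) <= M.

Definition close_by n m d (A B : 'M[K]_(n, m)) :=
  0 <= d /\ forall i j, cxmod (A i j - B i j) <= d.

Lemma eig_bound n (A : 'M[K]_n) M i : A^t* = A -> bounded_by M A ->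
  `|eig A i| <= (n * n)%:R * M.
Proof.
move=> hA hM; have hU := dia_unitary hA; set U := dia A in hU.
have hE : (eig A i)%:K = \sum_a \sum_b U i a * A a b * Num.conj (U i b).
  have := mul_spm_diag (fun i => (eig A i)%:K) hU.
  rewrite dia_eq // => /matrixP /(_ i i).
  rewrite !mxE eqxx mulr1n => <-; rewrite exchange_big /=.
  apply: eq_bigr => b _; rewrite !mxE mulr_suml.
  by apply: eq_bigr => a _.
rewrite -cxmod_ofR hE.
apply: le_trans (cxmod_sum _ _ _) _.
have -> : (n * n)%:R * M = \sum_(a < n) \sum_(b < n) M :> R.
  by rewrite !sumr_const !card_ord -mulrnA mulr_natl.
apply: ler_sum => a _; apply: le_trans (cxmod_sum _ _ _) _.
apply: ler_sum => b _; rewrite !cxmodM cxmod_conj.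
have h1 := unitary_cxmod i a hU; have h2 := unitary_cxmod i b hU.
apply: le_trans (hM a b).
rewrite -[leRHS]mul1r -[leRHS]mulr1.
by rewrite ler_pM ?mulr_ge0 ?cxmod_ge0 // ler_pM ?cxmod_ge0.
Qed.

End ComplexBasics.

Notation "x %:K" := (ofR _ x) (at level 2, format "x %:K").

Section Lipschitz.
Variables (R : realType) (K : complexes R) (T : Type).
Variables (D : T -> Prop) (near : R -> T -> T -> Prop).
Implicit Types F G : T -> K.

(** The relation [near d x y] stands for: [x] and [y] are at distance at most [d].
    It is used for matrices and for points of the unit interval. *)
Definition lip F := exists C, [/\ 0 <= C, forall x, D x -> cxmod (F x) <= C
  & forall d x y, D x -> D y -> near d x y -> cxmod (F x - F y) <= C * d].

Hypothesis near_ge0 : forall d x y, near d x y -> 0 <= d.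

Lemma lip_ext F G : (forall x, D x -> F x = G x) -> lip F -> lip G.
Proof.
move=> FG [C [C0 h1 h2]]; exists C; split=> // [x hx|d x y hx hy].
  by rewrite -FG //; exact: h1.
by rewrite -!FG //; exact: h2.
Qed.

Lemma lip_cst c : lip (fun=> c).
Proof.
exists (cxmod c); split=> // [|d x y _ _ /near_ge0 d0]; rewrite ?cxmod_ge0 //.
by rewrite subrr cxmod0 mulr_ge0 // cxmod_ge0.
Qed.

Lemma lip_add F G : lip F -> lip G -> lip (fun x => F x + G x).
Proof.
move=> [C [C0 h1 h2]] [E [E0 k1 k2]]; exists (C + E).
split=> [|x hx|d x y hx hy hxy]; first exact: addr_ge0.
  by apply: le_trans (cxmodD _ _) _; rewrite lerD ?h1 ?k1.
rewrite opprD addrACA mulrDl; apply: le_trans (cxmodD _ _) _.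
by rewrite lerD ?h2 ?k2.
Qed.

Lemma lip_mul F G : lip F -> lip G -> lip (fun x => F x * G x).
Proof.
move=> [C [C0 h1 h2]] [E [E0 k1 k2]]; exists (C * E + C * E).
split=> [|x hx|d x y hx hy hxy]; first by rewrite addr_ge0 ?mulr_ge0.
  rewrite cxmodM; apply: (@le_trans _ _ (C * E)); last by rewrite lerDl mulr_ge0.
  by rewrite ler_pM ?cxmod_ge0 ?h1 ?k1.
have -> : F x * G x - F y * G y = (F x - F y) * G x + F y * (G x - G y) by ring.
apply: le_trans (cxmodD _ _) _; rewrite !cxmodM mulrDl.
have -> : C * E * d = C * d * E by ring.
apply: lerD; first by rewrite ler_pM ?cxmod_ge0 ?h2 ?k1.
by rewrite [leRHS]mulrAC -[leRHS]mulrA ler_pM ?cxmod_ge0 ?h1 ?k2.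
Qed.

Lemma lip_sum (I : Type) (r : seq I) (P : pred I) (F : I -> T -> K) :
  (forall i, P i -> lip (F i)) -> lip (fun x => \sum_(i <- r | P i) F i x).
Proof.
move=> h; elim: r => [|i r IH].
  apply: lip_ext (lip_cst 0) => x _; by rewrite big_nil.
case Pi : (P i); last by apply: lip_ext IH => x _; rewrite big_cons Pi.
by apply: lip_ext (lip_add (h i Pi) IH) => x _; rewrite big_cons Pi.
Qed.

Lemma lip_prod (I : Type) (r : seq I) (P : pred I) (F : I -> T -> K) :
  (forall i, P i -> lip (F i)) -> lip (fun x => \prod_(i <- r | P i) F i x).
Proof.
move=> h; elim: r => [|i r IH].
  apply: lip_ext (lip_cst 1) => x _; by rewrite big_nil.
case Pi : (P i); last by apply: lip_ext IH => x _; rewrite big_cons Pi.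
by apply: lip_ext (lip_mul (h i Pi) IH) => x _; rewrite big_cons Pi.
Qed.

Lemma lip_conj F : lip F -> lip (fun x => Num.conj (F x)).
Proof.
move=> [C [C0 h1 h2]]; exists C; split=> // [x hx|d x y hx hy hxy].
  by rewrite cxmod_conj h1.
by rewrite -rmorphB cxmod_conj h2.
Qed.

End Lipschitz.

Section Smooth.
Variables (R : realType) (K : complexes R).

Definition herm_ball n M (A : 'M[K]_n) := A^t* = A /\ bounded_by M A.

Definition loc_lip n (F : 'M[K]_n -> K) :=
  forall M, lip (@herm_ball n M) (@close_by R K n n) F.

(** A quadratic bound on the error: it makes the product rule elementary, and it
    is what divided differences give. *)
Definition derivative_at n (F : 'M[K]_n -> K) (H A : 'M[K]_n) (g : K) :=
  exists C, forall t : R, `|t| <= 1 ->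
    cxmod (F (A + t%:K *: H) - F A - t%:K * g) <= C * t ^+ 2.

Fixpoint smoothM n m (F : 'M[K]_n -> K) : Prop :=
  loc_lip F /\
  if m is m'.+1 then forall H : 'M[K]_n, H^t* = H ->
    exists G, smoothM m' G /\ forall A, A^t* = A -> derivative_at F H A (G A)
  else True.

Lemma close_ge0 n p d (A B : 'M[K]_(n, p)) : close_by d A B -> 0 <= d.
Proof. by case. Qed.
Hint Resolve close_ge0 : core.

Lemma herm_line n (A H : 'M[K]_n) (t : R) : A^t* = A -> H^t* = H ->
  (A + t%:K *: H)^t* = A + t%:K *: H.
Proof.
by move=> hA hH; rewrite linearD linearZ /= map_mxD map_mxZ /= conjK hA hH.
Qed.

Lemma smoothM_lip n m (F : 'M[K]_n -> K) : smoothM m F -> loc_lip F.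
Proof. by case: m => [|m] []. Qed.

Lemma smoothMW n m (F : 'M[K]_n -> K) : smoothM m.+1 F -> smoothM m F.
Proof.
elim: m F => [|m IH] F [hL hF]; split => // H hH.
by have [G [hG hd]] := hF H hH; exists G; split => //; exact: IH.
Qed.

Lemma smoothM_ext n m (F G : 'M[K]_n -> K) :
  (forall A, A^t* = A -> F A = G A) -> smoothM m F -> smoothM m G.
Proof.
move=> FG; case: m => [|m] [hL hF]; split => //.
- by move=> M; apply: lip_ext (hL M) => A [hA _]; exact: FG.
- by move=> M; apply: lip_ext (hL M) => A [hA _]; exact: FG.
move=> H hH; have [F' [hF' hd]] := hF H hH; exists F'; split => // A hA.
have [C hC] := hd A hA; exists C => t ht.
by rewrite -!FG ?herm_line //; exact: hC.
Qed.

Lemma smoothM_cst n m c : smoothM m (fun _ : 'M[K]_n => c).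
Proof.
elim: m c => [|m IH] c; split=> //; try by move=> M; apply: lip_cst; exact: close_ge0.
move=> H hH; exists (fun=> 0); split=> // A _; exists 0 => t _.
by rewrite subrr mulr0 subr0 cxmod0 mul0r.
Qed.

Lemma smoothM_add n m (F G : 'M[K]_n -> K) :
  smoothM m F -> smoothM m G -> smoothM m (fun A => F A + G A).
Proof.
elim: m F G => [|m IH] F G [hF1 hF2] [hG1 hG2]; split=> //.
- by move=> M; apply: lip_add.
- by move=> M; apply: lip_add.
move=> H hH; have [F' [sF dF]] := hF2 H hH; have [G' [sG dG]] := hG2 H hH.
exists (fun A => F' A + G' A); split; first exact: IH.
move=> A hA; have [C1 h1] := dF A hA; have [C2 h2] := dG A hA.
exists (C1 + C2) => t ht; rewrite mulrDl.
apply: le_trans (lerD (h1 t ht) (h2 t ht)); apply: le_trans (cxmodD _ _).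
by rewrite le_eqVlt; apply/orP; left; apply/eqP; congr cxmod; ring.
Qed.

Lemma smoothM_mul n m (F G : 'M[K]_n -> K) :
  smoothM m F -> smoothM m G -> smoothM m (fun A => F A * G A).
Proof.
elim: m F G => [|m IH] F G sF sG.
  have [hF1 hF2] := sF; have [hG1 hG2] := sG.
  by split=> // M; apply: lip_mul.
have [hF1 hF2] := sF; have [hG1 hG2] := sG.
split=> [M|H hH]; first by apply: lip_mul.
have [F' [sF' dF]] := hF2 H hH; have [G' [sG' dG]] := hG2 H hH.
exists (fun A => F' A * G A + F A * G' A); split.
  by apply: smoothM_add; apply: IH => //; exact: smoothMW.
move=> A hA; have [C1 h1] := dF A hA; have [C2 h2] := dG A hA.
have C1_ge0 : 0 <= C1.
  by have := h1 1; rewrite normr1 lexx expr1n mulr1 => /(_ isT); apply: le_trans; rewrite cxmod_ge0.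
have C2_ge0 : 0 <= C2.
  by have := h2 1; rewrite normr1 lexx expr1n mulr1 => /(_ isT); apply: le_trans; rewrite cxmod_ge0.
set a := F A; set b := G A; set g := F' A; set h := G' A.
exists (C1 * (C2 + cxmod b + cxmod h) + (cxmod a + cxmod g) * C2 + cxmod g * cxmod h).
move=> t ht; have := h1 t ht; have := h2 t ht.
rewrite -/a -/b -/g -/h.
set at_ := F _; set bt := G _ => k2 k1.
have -> : at_ * bt - a * b - t%:K * (g * b + a * h) =
  (at_ - a - t%:K * g) * ((bt - b - t%:K * h) + (b + t%:K * h)) +
  (a + t%:K * g) * (bt - b - t%:K * h) + (t%:K * t%:K) * (g * h) by ring.
have t2 : t ^+ 2 <= 1.
  by rewrite -(real_normK (num_real t)) -(expr1n _ 2) ler_pXn2r ?nnegrE.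
have lin u v : cxmod (u + t%:K * v) <= cxmod u + cxmod v.
  apply: le_trans (cxmodD _ _) _; rewrite lerD2l cxmodM cxmod_ofR.
  by rewrite -[leRHS]mul1r ler_wpM2r ?cxmod_ge0.
apply: le_trans (cxmodD _ _) _; rewrite [leRHS]mulrDl.
apply: lerD; last first.
  by rewrite !cxmodM cxmod_ofR -expr2 real_normK ?num_real // mulrC.
apply: le_trans (cxmodD _ _) _; rewrite [leRHS]mulrDl; apply: lerD.
  rewrite cxmodM [leRHS]mulrAC ler_pM ?cxmod_ge0 //.
  apply: le_trans (cxmodD _ _) _; rewrite -[leRHS]addrA lerD ?lin //.
  by apply: le_trans k2 _; rewrite -[leRHS]mulr1 ler_wpM2l.
by rewrite cxmodM -[leRHS]mulrA ler_pM ?cxmod_ge0 ?lin.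
Qed.

Lemma smoothM_sum n m (I : Type) (r : seq I) (P : pred I) (F : I -> 'M[K]_n -> K) :
  (forall i, P i -> smoothM m (F i)) -> smoothM m (fun A => \sum_(i <- r | P i) F i A).
Proof.
move=> h; elim: r => [|i r IH].
  by apply: smoothM_ext (smoothM_cst n m 0) => A _; rewrite big_nil.
case Pi : (P i); last by apply: smoothM_ext IH => A _; rewrite big_cons Pi.
by apply: smoothM_ext (smoothM_add (h i Pi) IH) => A _; rewrite big_cons Pi.
Qed.

Lemma smoothM_scale n m c (F : 'M[K]_n -> K) :
  smoothM m F -> smoothM m (fun A => c * F A).
Proof. by move=> hF; apply: smoothM_mul => //; exact: smoothM_cst. Qed.

(** Contractions for the entrywise distance; the cases of interest are the
    identity, the corner, and the corner extended by zero. *)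
Definition herm_linear n k (L : 'M[K]_n -> 'M[K]_k) :=
  [/\ forall A, A^t* = A -> (L A)^t* = L A,
      forall M A, 0 <= M -> bounded_by M A -> bounded_by M (L A),
      forall d A B, close_by d A B -> close_by d (L A) (L B)
    & forall A H (t : R), L (A + t%:K *: H) = L A + t%:K *: L H].

Lemma smoothM_comp n k m (L : 'M[K]_n -> 'M[K]_k) (F : 'M[K]_k -> K) :
  herm_linear L -> smoothM m F -> smoothM m (fun A => F (L A)).
Proof.
move=> [L1 L2 L3 L4].
have hlip G : loc_lip G -> loc_lip (fun A => G (L A)).
  move=> hG M; have [C [C0 h1 h2]] := hG `|M|; exists C.
  have hM A : herm_ball M A -> herm_ball `|M| (L A).
    move=> [hA bA]; split; first exact: L1.
    by apply: L2 => // i j; apply: le_trans (bA i j) (ler_norm M).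
  split=> // [A hA|d A B hA hB hAB]; first by apply: h1; exact: hM.
  by apply: h2; [exact: hM|exact: hM|exact: L3].
elim: m F => [|m IH] F [hF1 hF2]; split; [exact: hlip|by []|exact: hlip|].
move=> H hH; have [G [sG dG]] := hF2 _ (L1 H hH).
exists (fun A => G (L A)); split; first exact: IH.
move=> A hA; have [C hC] := dG _ (L1 A hA); exists C => t ht.
by rewrite L4; exact: hC.
Qed.

End Smooth.

(** * Divided differences of the exponential *)

Section CompleteHomogeneous.
Variable R : realType.
Implicit Types (x y : R) (s : seq R).

(** Complete homogeneous symmetric polynomials. *)
Fixpoint hom s k : R :=
  if s is x :: s' then \sum_(i < k.+1) x ^+ i * hom s' (k - i)%N else (k == 0%N)%:R.

Lemma homS x s k : hom (x :: s) k.+1 = x * hom (x :: s) k + hom s k.+1.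
Proof.
rewrite -[hom (x :: s) k.+1]/(\sum_(i < k.+2) x ^+ i * hom s (k.+1 - i)%N).
rewrite -[hom (x :: s) k]/(\sum_(i < k.+1) x ^+ i * hom s (k - i)%N).
rewrite big_ord_recl [X in X + _ = _]/= expr0 mul1r subn0 addrC mulr_sumr; congr (_ + _).
by apply: eq_bigr => i _; rewrite lift0 subSS exprS mulrA.
Qed.

Lemma hom0 s : hom s 0 = 1.
Proof. by elim: s => [|x s IH] //=; rewrite big_ord1 expr0 mul1r IH. Qed.

Lemma hom1 x k : hom [:: x] k = x ^+ k.
Proof. by elim: k => [|k IH]; rewrite ?hom0 // homS IH /= addr0 exprS. Qed.

Lemma homC_aux x y s k :
  (x - y) * hom [:: x, y & s] k = x * hom (x :: s) k - y * hom (y :: s) k.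
Proof.
elim: k => [|k IH]; first by rewrite !hom0; ring.
rewrite (homS x (y :: s)) mulrDr mulrCA IH.
have hx := homS x s k; have hy := homS y s k.
have -> : x * (x * hom (x :: s) k - y * hom (y :: s) k) =
  x * (hom (x :: s) k.+1 - hom (y :: s) k.+1) by rewrite hx hy; ring.
ring.
Qed.

Lemma homC x y s : hom [:: x, y & s] =1 hom [:: y, x & s].
Proof.
elim=> [|k IH]; first by rewrite !hom0.
rewrite homS (homS y (x :: s)) (homS y s) (homS x s) -IH.
have h := homC_aux x y s k.
have -> : x * hom [:: x, y & s] k =
  (x - y) * hom [:: x, y & s] k + y * hom [:: x, y & s] k by ring.
rewrite h; ring.
Qed.

Lemma eq_hom x s s' : hom s =1 hom s' -> hom (x :: s) =1 hom (x :: s').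
Proof. by move=> h k /=; apply: eq_bigr => i _; rewrite h. Qed.

Lemma hom_front s1 x s2 : hom (s1 ++ x :: s2) =1 hom (x :: s1 ++ s2).
Proof.
elim: s1 => [|y s1 IH] //= k.
by rewrite -/(hom (y :: s1 ++ x :: s2) k) (eq_hom y IH) homC.
Qed.

Lemma hom_diff x y s k :
  hom (x :: s) k.+1 - hom (y :: s) k.+1 = (x - y) * hom [:: x, y & s] k.
Proof.
have h1 := homS x (y :: s) k; have h2 := homS y (x :: s) k.
rewrite -homC in h2; have h3 := homC x y s k; rewrite -h3 in h2.
have -> : hom (y :: s) k.+1 = hom [:: x, y & s] k.+1 - x * hom [:: x, y & s] k.
  by rewrite h1; ring.
have -> : hom (x :: s) k.+1 = hom [:: x, y & s] k.+1 - y * hom [:: x, y & s] k.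
  by rewrite h2; ring.
ring.
Qed.

Lemma hom_bound (M : R) s k : 0 <= M -> (forall x, x \in s -> `|x| <= M) ->
  `|hom s k| <= M ^+ k * k.+1%:R ^+ (size s).-1.
Proof.
move=> M0; elim: s k => [|x s IH] k hs /=.
  rewrite expr0 mulr1; case: k => [|k] /=; first by rewrite expr0 normr1.
  by rewrite normr0 exprn_ge0.
rewrite -/(hom (x :: s) k).
have hx : `|x| <= M by apply: hs; rewrite mem_head.
case: s IH hs => [|y s] IH hs.
  by rewrite hom1 expr0 mulr1 normrX; apply: lerXn2r; rewrite ?nnegrE.
have {}IH j := IH j (fun z hz => hs z (mem_behead (s := _ :: _) hz)).
move: IH; set t := y :: s; rewrite [(size t).-1]/= => IH.
elim: k => [|k IHk].
  by rewrite hom0 expr0 mul1r expr1n normr1.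
rewrite homS; apply: le_trans (ler_normD _ _) _.
have h1 : `|x * hom (x :: t) k| <= M ^+ k.+1 * (k.+1%:R * k.+2%:R ^+ size s).
  rewrite normrM exprS -mulrA ler_pM //.
  apply: le_trans IHk _; apply: ler_wpM2l; first exact: exprn_ge0.
  rewrite exprS; apply: ler_wpM2l => //.
  by apply: lerXn2r; rewrite ?nnegrE // ler_nat.
apply: le_trans (lerD h1 (IH k.+1)) _.
rewrite -mulrDr; apply: ler_wpM2l; first exact: exprn_ge0.
rewrite exprS -[X in _ * _ + X]mul1r -mulrDl.
by rewrite -[X in _ + X]/(1%:R) -natrD addn1.
Qed.

End CompleteHomogeneous.

Section ExpDividedDifferences.
Variable R : realType.
Implicit Types (x y : R) (s : seq R).

(** The divided difference of the monomial of degree [k + m] at [m + 1] points,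
    confluent or not, is their complete homogeneous polynomial of degree [k].
    Summing over the exponential series gives the divided difference [expdd] of
    the exponential. *)
Definition ecoef s : R ^nat :=
  fun k => hom s k / ((k + (size s).-1)`!)%:R.

Definition expdd s : R := limn (series (ecoef s)).

Lemma fact_ge k m : (k.+1 ^ m * k`! <= (k + m)`!)%N.
Proof.
elim: m => [|m IH]; first by rewrite addn0 mul1n.
rewrite addnS factS expnS -mulnA leq_mul //.
by rewrite ltnS leq_addr.
Qed.

Lemma ecoef_bound (M : R) s k : 0 <= M -> (forall x, x \in s -> `|x| <= M) ->
  `|ecoef s k| <= exp_coeff M k.
Proof.
move=> M0 hs; rewrite /ecoef normrM normfV (ger0_norm (ler0n _ _)).
rewrite ler_pdivrMr ?ltr0n ?fact_gt0 //.
apply: le_trans (hom_bound k M0 hs) _.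
rewrite /exp_coeff /= -mulrA; apply: ler_wpM2l; first exact: exprn_ge0.
rewrite ler_pdivlMl ?ltr0n ?fact_gt0 // -natrX -natrM ler_nat mulnC.
exact: fact_ge.
Qed.

Lemma seq_bound s : exists M : R, 0 <= M /\ forall x, x \in s -> `|x| <= M.
Proof.
exists (\sum_(x <- s) `|x|); split; first exact: sumr_ge0.
elim: s => [|y s IH] x //; rewrite in_cons big_cons => /orP[/eqP->|/IH h].
  by rewrite lerDl sumr_ge0.
by apply: le_trans h _; rewrite lerDr.
Qed.

Lemma is_cvg_norm_ecoef s : cvgn [normed series (ecoef s)].
Proof.
have [M [M0 hM]] := seq_bound s.
apply: (@series_le_cvg _ _ (exp_coeff M)) => [k|k|k|].
- by rewrite normr_ge0.
- exact: exp_coeff_ge0.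
- exact: ecoef_bound.
- exact: is_cvg_series_exp_coeff.
Qed.

Lemma is_cvg_ecoef s : cvgn (series (ecoef s)).
Proof. by apply: normed_cvg; exact: is_cvg_norm_ecoef. Qed.

Lemma expdd_bound (M : R) s : 0 <= M -> (forall x, x \in s -> `|x| <= M) ->
  `|expdd s| <= expR M.
Proof.
move=> M0 hs; apply: le_trans (lim_series_norm _) _; first exact: is_cvg_norm_ecoef.
apply: lim_series_le; first exact: is_cvg_norm_ecoef.
  exact: is_cvg_series_exp_coeff.
by move=> k; exact: ecoef_bound.
Qed.

Lemma expdd_front s1 x s2 : expdd (s1 ++ x :: s2) = expdd (x :: s1 ++ s2).
Proof.
rewrite /expdd (_ : ecoef _ = ecoef (x :: s1 ++ s2)) //.
by apply/funext => k; rewrite /ecoef hom_front /= !size_cat /= addnS.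
Qed.

(** The recursion of divided differences, inherited from [hom_diff]. *)
Lemma expdd_diff x y s :
  expdd (x :: s) - expdd (y :: s) = (x - y) * expdd [:: x, y & s].
Proof.
have h n : series (ecoef (x :: s)) n.+1 - series (ecoef (y :: s)) n.+1 =
  (x - y) * series (ecoef [:: x, y & s]) n.
  rewrite !seriesEord /= !big_ord_recl /ecoef !hom0 /=.
  rewrite opprD addrACA subrr add0r -sumrB mulr_sumr; apply: eq_bigr => i _.
  rewrite -mulrBl hom_diff mulrA; congr (_ / (_ `!)%:R).
  by rewrite addSn addnS.
have c1 : (fun n => series (ecoef (x :: s)) n.+1 - series (ecoef (y :: s)) n.+1)
   @ \oo --> expdd (x :: s) - expdd (y :: s).
  by apply: cvgB; [rewrite (cvg_shiftS (series (ecoef (x :: s))))|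
     rewrite (cvg_shiftS (series (ecoef (y :: s))))]; exact: is_cvg_ecoef.
have c2 : (fun n => (x - y) * series (ecoef [:: x, y & s]) n) @ \oo -->
   (x - y) * expdd [:: x, y & s].
  by apply: cvgM; [exact: cvg_cst|exact: is_cvg_ecoef].
rewrite (funext h) in c1; exact: cvg_unique c1 c2.
Qed.

Lemma expdd1 x : expdd [:: x] = expR x.
Proof.
rewrite /expdd /expR (_ : ecoef _ = exp_coeff x) //.
by apply/funext => k; rewrite /ecoef /exp_coeff hom1 addn0.
Qed.

Lemma expddxx x : expdd [:: x; x] = expR x.
Proof.
have h n : series (ecoef [:: x; x]) n = series (exp_coeff x) n.
  rewrite !seriesEord /=; apply: eq_bigr => i _; rewrite /ecoef /exp_coeff /=.
  rewrite -/(hom [:: x] _) (eq_bigr (fun=> x ^+ i)); last first.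
    by move=> j _; rewrite -/(hom [:: x] (i - j)%N) hom1 -exprD subnKC // -ltnS.
  rewrite sumr_const card_ord addn1 factS natrM -[x ^+ i *+ _]mulr_natl.
  have : (i.+1)%:R != 0 :> R by rewrite pnatr_eq0.
  have : (i`!)%:R != 0 :> R by rewrite pnatr_eq0 -lt0n fact_gt0.
  move: (i.+1)%:R (i`!)%:R => a b b0 a0; field.
  by rewrite a0 b0.
by rewrite /expdd /expR (funext h).
Qed.

Lemma expdd2_diff x y : (x - y) * expdd [:: x; y] = expR x - expR y.
Proof. by rewrite -expdd_diff !expdd1. Qed.

Lemma expdd2C x y : expdd [:: x; y] = expdd [:: y; x].
Proof. by rewrite -(expdd_front [:: y] x [::]). Qed.

(** The difference quotient of a convex function is at least the derivative at the
    left end. *)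
Lemma expdd2_lower x y : x <= y -> expR x <= expdd [:: x; y].
Proof.
rewrite le_eqVlt => /orP[/eqP ->|xy]; first by rewrite expddxx.
rewrite -(ler_pM2l (x := y - x)) ?subr_gt0 // expdd2C expdd2_diff.
have -> : expR y = expR x * expR (y - x) by rewrite -expRD addrC subrK.
have := expR_ge1Dx (y - x); have := expR_gt0 x; nra.
Qed.

Lemma expdd2_gt M x y : `|x| <= M -> `|y| <= M -> expR (- M) <= expdd [:: x; y].
Proof.
wlog xy : x y / x <= y => [hw hx hy|hx hy].
  by case/orP: (le_total x y) => h; [|rewrite expdd2C]; exact: hw.
apply: le_trans (expdd2_lower xy); rewrite ler_expR.
by move: hx; rewrite ler_norml => /andP[].
Qed.

Lemma expdd2_gt0 x y : 0 < expdd [:: x; y].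
Proof.
by apply: lt_le_trans (expR_gt0 (- (`|x| + `|y|))) _; apply: expdd2_gt;
   rewrite ?lerDl ?lerDr.
Qed.

End ExpDividedDifferences.

Section DividedDifferences.
Variable R : realType.

Definition fresh (I : eqType) (r i : I) : option I :=
  if i == r then None else Some i.

(** Boundedness on boxes of [F] and of its iterated divided differences up to
    order [m]. Each difference adds one variable, [None], next to the variable
    [r] that it splits; hence the polymorphism in the type of variables. The
    identity is free of divisions, so it also covers equal variables. *)
Fixpoint dd m (I : eqType) (F : (I -> R) -> R) : Prop :=
  (forall M, exists C, forall x, (forall i, `|x i| <= M) -> `|F x| <= C) /\
  if m is m'.+1 then forall r : I, exists G : (option I -> R) -> R,
    dd m' G /\ forall x, F (x \o some) - F (x \o fresh r) =
                         (x (Some r) - x None) * G x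
  else True.

Lemma dd_cst m (I : eqType) c : dd m (fun _ : I -> R => c).
Proof.
elim: m I c => [|m IH] I c; split => //; try by move=> M; exists `|c|.
by move=> r; exists (fun=> 0); split => // x; rewrite subrr mulr0.
Qed.

(** A divided difference in a variable outside of the image of [f] is zero. *)
Lemma dd_pullback m (I J : eqType) (f : I -> J) (F : (I -> R) -> R) :
  injective f -> dd m F -> dd m (fun x => F (x \o f)).
Proof.
elim: m I J f F => [|m IH] I J f F inj_f [hF1 hF2]; split => //.
- by move=> M; have [C hC] := hF1 M; exists C => x hx; apply: hC => i; exact: hx.
- by move=> M; have [C hC] := hF1 M; exists C => x hx; apply: hC => i; exact: hx.
move=> r; have [[i fi]|nr] := pselect (exists i, f i = r).
  have [G [dG hG]] := hF2 i; exists (fun x => G (x \o omap f)); split.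
    by apply: IH => //; exact: inj_omap.
  move=> x; have := hG (x \o omap f); rewrite /= fi => <-; congr (_ - F _).
  by apply/funext => j /=; rewrite /fresh -fi (inj_eq inj_f); case: eqP.
exists (fun=> 0); split; first exact: dd_cst.
move=> x; rewrite mulr0; apply/eqP; rewrite subr_eq0; apply/eqP; congr F.
by apply/funext => i /=; rewrite /fresh; case: eqP => // fi; case: nr; exists i.
Qed.

Lemma inj_fresh (I : eqType) (r : I) : injective (fresh r).
Proof.
by move=> i j; rewrite /fresh; case: eqP => [->|_]; case: eqP => [->|_] // [].
Qed.

Lemma inj_some (I : Type) : injective (@Some I). Proof. by move=> i j []. Qed.

Lemma ddW m (I : eqType) (F : (I -> R) -> R) : dd m.+1 F -> dd m F.
Proof.
elim: m I F => [|m IH] I F [h1 h2]; split => // r.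
by have [G [dG hG]] := h2 r; exists G; split => //; exact: IH.
Qed.

Lemma dd_add m (I : eqType) (F G : (I -> R) -> R) :
  dd m F -> dd m G -> dd m (fun x => F x + G x).
Proof.
elim: m I F G => [|m IH] I F G [hF1 hF2] [hG1 hG2].
  split=> // M; have [C hC] := hF1 M; have [E hE] := hG1 M.
  by exists (C + E) => x hx; apply: le_trans (ler_normD _ _) (lerD (hC x hx) (hE x hx)).
split=> [M|r].
  have [C hC] := hF1 M; have [E hE] := hG1 M.
  by exists (C + E) => x hx; apply: le_trans (ler_normD _ _) (lerD (hC x hx) (hE x hx)).
have [F' [dF hF]] := hF2 r; have [G' [dG hG]] := hG2 r.
exists (fun x => F' x + G' x); split; first exact: IH.
by move=> x; rewrite mulrDr -hF -hG; ring.
Qed.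

(** The Leibniz rule for divided differences. *)
Lemma dd_mul m (I : eqType) (F G : (I -> R) -> R) :
  dd m F -> dd m G -> dd m (fun x => F x * G x).
Proof.
have hb (J : eqType) (A B : (J -> R) -> R) :
    (forall M, exists C, forall x, (forall i, `|x i| <= M) -> `|A x| <= C) ->
    (forall M, exists C, forall x, (forall i, `|x i| <= M) -> `|B x| <= C) ->
    (forall M, exists C, forall x, (forall i, `|x i| <= M) -> `|A x * B x| <= C).
  move=> hA hB M; have [C hC] := hA M; have [E hE] := hB M.
  by exists (C * E) => x hx; rewrite normrM ler_pM ?hC ?hE.
elim: m I F G => [|m IH] I F G dF dG; have [hF1 hF2] := dF; have [hG1 hG2] := dG.
  by split=> //; exact: hb.
split=> [|r]; first exact: hb.
have [F' [dF' hF]] := hF2 r; have [G' [dG' hG]] := hG2 r.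
exists (fun x => F' x * G (x \o some) + F (x \o fresh r) * G' x); split.
  apply: dd_add; apply: IH => //; apply: dd_pullback; try exact: ddW.
    exact: inj_some.
  exact: inj_fresh.
by move=> x; rewrite mulrDr mulrA -hF mulrCA -hG; ring.
Qed.

Lemma dd_prod m (I : eqType) (T : Type) (r : seq T) (F : T -> (I -> R) -> R) :
  (forall t, dd m (F t)) -> dd m (fun x => \prod_(t <- r) F t x).
Proof.
move=> h; elim: r => [|t r IH].
  by rewrite (_ : (fun x => _) = fun=> 1); [exact: dd_cst|
     apply/funext => x; rewrite big_nil].
rewrite (_ : (fun x => _) = fun x => F t x * \prod_(t <- r) F t x).
  exact: dd_mul.
by apply/funext => x; rewrite big_cons.
Qed.

(** What inverses and square roots within [dd] require. *)
Definition box_pos (I : eqType) (F : (I -> R) -> R) :=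
  forall M, exists2 c, 0 < c & forall x, (forall i, `|x i| <= M) -> c <= F x.

Lemma box_pos_pullback (I J : eqType) (f : I -> J) (F : (I -> R) -> R) :
  box_pos F -> box_pos (fun x => F (x \o f)).
Proof.
move=> h M; have [c c0 hc] := h M; exists c => // x hx; apply: hc => i.
exact: hx.
Qed.

(** Positivity everywhere is assumed beside the bounds since the variables may
    range over an infinite type. *)
Lemma dd_inv m (I : eqType) (F : (I -> R) -> R) : (forall x, 0 < F x) ->
  box_pos F -> dd m F -> dd m (fun x => (F x)^-1).
Proof.
have hb (J : eqType) (A : (J -> R) -> R) : (forall x, 0 < A x) -> box_pos A ->
    (forall M, exists C, forall x, (forall i, `|x i| <= M) -> `|(A x)^-1| <= C).
  move=> A0 hA M; have [c c0 hc] := hA M; exists c^-1 => x hx.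
  by rewrite normfV gtr0_norm // lef_pV2 ?posrE // hc.
elim: m I F => [|m IH] I F F0 pF dF; first by split=> //; exact: hb.
have [_ hF2] := dF.
split=> [|r]; first exact: hb.
have [G [dG hG]] := hF2 r.
exists (fun x => - (1) * (G x * ((F (x \o some))^-1 * (F (x \o fresh r))^-1))); split.
  apply: dd_mul; first exact: dd_cst.
  apply: dd_mul => //; apply: dd_mul.
    by apply: IH => //; [exact: box_pos_pullback|apply: dd_pullback (ddW dF); exact: inj_some].
  by apply: IH => //; [exact: box_pos_pullback|apply: dd_pullback (ddW dF); exact: inj_fresh].
move=> x; have := hG x.
have := F0 (x \o some); have := F0 (x \o fresh r).
set a := F _; set b := F _ => a0 b0 h.
rewrite mulN1r mulrN mulrA -h; field.
by rewrite !gt_eqF.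
Qed.

Lemma box_pos_mul (I : eqType) (F G : (I -> R) -> R) :
  box_pos F -> box_pos G -> box_pos (fun x => F x * G x).
Proof.
move=> hF hG M; have [c c0 hc] := hF M; have [e e0 he] := hG M.
exists (c * e); first exact: mulr_gt0.
by move=> x hx; rewrite ler_pM ?hc ?he // ltW.
Qed.

Lemma box_pos_add (I : eqType) (F G : (I -> R) -> R) :
  box_pos F -> box_pos G -> box_pos (fun x => F x + G x).
Proof.
move=> hF hG M; have [c c0 hc] := hF M; have [e e0 he] := hG M.
exists (c + e); first exact: addr_gt0.
by move=> x hx; rewrite lerD ?hc ?he.
Qed.

Lemma box_pos_sqrt (I : eqType) (F : (I -> R) -> R) :
  box_pos F -> box_pos (fun x => Num.sqrt (F x)).
Proof.
move=> hF M; have [c c0 hc] := hF M; exists (Num.sqrt c); first by rewrite sqrtr_gt0.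
by move=> x hx; rewrite ler_wsqrtr // hc.
Qed.

Lemma dd_sqrt m (I : eqType) (F : (I -> R) -> R) : (forall x, 0 < F x) ->
  box_pos F -> dd m F -> dd m (fun x => Num.sqrt (F x)).
Proof.
have hb (J : eqType) (A : (J -> R) -> R) :
    (forall M, exists C, forall x, (forall i, `|x i| <= M) -> `|A x| <= C) ->
    (forall M, exists C, forall x, (forall i, `|x i| <= M) -> `|Num.sqrt (A x)| <= C).
  move=> hA M; have [C hC] := hA M; exists (Num.sqrt C) => x hx.
  rewrite ger0_norm ?sqrtr_ge0 // ler_wsqrtr //.
  by apply: le_trans (ler_norm _) (hC x hx).
elim: m I F => [|m IH] I F F0 pF dF; have [hF1 hF2] := dF.
  by split=> //; exact: hb.
split=> [|r]; first exact: hb.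
have [G [dG hG]] := hF2 r.
exists (fun x => G x * (Num.sqrt (F (x \o some)) + Num.sqrt (F (x \o fresh r)))^-1).
have s1 : dd m (fun x => Num.sqrt (F (x \o some))).
  by apply: IH => //; [exact: box_pos_pullback|apply: dd_pullback (ddW dF); exact: inj_some].
have s2 : dd m (fun x => Num.sqrt (F (x \o fresh r))).
  by apply: IH => //; [exact: box_pos_pullback|apply: dd_pullback (ddW dF); exact: inj_fresh].
split.
  apply: dd_mul => //; apply: dd_inv.
  - by move=> x; rewrite addr_gt0 ?sqrtr_gt0.
  - by apply: box_pos_add; apply: box_pos_sqrt; exact: box_pos_pullback.
  - exact: dd_add.
move=> x; have := hG x.
have := F0 (x \o some); have := F0 (x \o fresh r).
set a := F _; set b := F _ => a0 b0 h.
have e : b - a = Num.sqrt b ^+ 2 - Num.sqrt a ^+ 2 by rewrite !sqr_sqrtr // ltW.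
rewrite mulrA -h e.
have : 0 < Num.sqrt b + Num.sqrt a by rewrite addr_gt0 ?sqrtr_gt0.
set u := Num.sqrt b; set v := Num.sqrt a => uv; field.
by rewrite gt_eqF.
Qed.

(** The difference in the variable [r] puts the fresh variable next to [r] in the
    list of nodes, by symmetry of [expdd] and [expdd_diff]. The constant nodes [c]
    account for the zero eigenvalue of a corner extended by zero. *)
Lemma dd_expdd m (I : eqType) (c : seq R) (s : seq I) : uniq s ->
  dd m (fun x => expdd (c ++ map x s)).
Proof.
have hb (J : eqType) (t : seq J) M : exists C, forall x : J -> R,
    (forall i, `|x i| <= M) -> `|expdd (c ++ map x t)| <= C.
  have [N [N0 hN]] := seq_bound c; exists (expR (N + `|M|)) => x hx.
  apply: expdd_bound; first by rewrite addr_ge0.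
  move=> z; rewrite mem_cat => /orP[/hN h|/mapP[i _ ->]].
    by apply: le_trans h _; rewrite lerDl.
  by apply: le_trans (hx i) _; apply: le_trans (ler_norm _) _; rewrite lerDr.
elim: m I s => [|m IH] I s us; first by split => // M; exact: hb.
split => [M|r]; first exact: hb.
have [rs|rs] := boolP (r \in s); last first.
  exists (fun=> 0); split; first exact: dd_cst.
  move=> x; rewrite mulr0; apply/eqP; rewrite subr_eq0; apply/eqP.
  congr (expdd (c ++ _)).
  apply/eq_in_map => i hi /=; rewrite /fresh; case: eqP => // ir.
  by rewrite -ir hi in rs.
case/splitPr: rs us => s1 s2; rewrite -cat1s uniq_catCA cat1s cons_uniq mem_cat.
move=> /andP[hr us].
exists (fun x => expdd (c ++ map x (Some r :: None :: map some (s1 ++ s2)))); split.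
  apply: IH; rewrite /= in_cons /= mem_map ?mem_cat; last exact: inj_some.
  rewrite hr map_inj_uniq ?us ?andbT /=; last exact: inj_some.
  by apply/negP => /mapP[].
move=> x.
have e1 : map (x \o some) (s1 ++ s2) = map x (map some (s1 ++ s2)) by rewrite map_comp.
have e2 : map (x \o fresh r) (s1 ++ s2) = map x (map some (s1 ++ s2)).
  rewrite -map_comp; apply/eq_in_map => i hi /=; rewrite /fresh; case: eqP => // ir.
  by move: hr; rewrite -ir -mem_cat hi.
have e3 f : expdd (c ++ map f (s1 ++ r :: s2)) = expdd (f r :: c ++ map f (s1 ++ s2)) :> R.
  by rewrite map_cat /= catA expdd_front -catA -map_cat.
rewrite !e3 e1 e2 /= /fresh eqxx expdd_diff; congr (_ * _).
have e4 a b W : expdd (c ++ [:: a, b & W]) = expdd [:: a, b & c ++ W] :> R.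
  rewrite expdd_front -[a :: _]/([:: a] ++ _) catA expdd_front -catA.
  by rewrite -(expdd_front [:: a]).
by rewrite e4.
Qed.

(** The same notion for functions of lists of length [N], in the form needed
    for iterated spectral sums. *)
Fixpoint ddl m N (F : seq R -> R) : Prop :=
  (forall M, exists C, forall z, size z = N -> all (fun t => `|t| <= M) z ->
     `|F z| <= C) /\
  if m is m'.+1 then forall p q, (p + q.+1)%N = N -> exists G, ddl m' N.+1 G /\
    forall z1 x y z2, size z1 = p -> size z2 = q ->
      F (z1 ++ x :: z2) - F (z1 ++ y :: z2) = (x - y) * G (z1 ++ [:: x, y & z2])
  else True.

Lemma dd_ddl m N (F : ('I_N -> R) -> R) : dd m F ->
  ddl m N (fun z => F (fun i => nth 0 z i)).
Proof.
have hb n (A : ('I_n -> R) -> R) :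
    (forall M, exists C, forall x, (forall i, `|x i| <= M) -> `|A x| <= C) ->
    (forall M, exists C, forall z, size z = n -> all (fun t => `|t| <= M) z ->
     `|A (fun i => nth 0 z i)| <= C).
  move=> hA M; have [C hC] := hA M; exists C => z sz hz; apply: hC => i.
  by have /all_nthP := hz; apply; rewrite sz.
elim: m N F => [|m IH] N F [hF1 hF2]; first by split=> //; exact: hb.
split=> [|p q pqN]; first exact: hb.
have hp : (p < N)%N by rewrite -pqN addnS ltnS leq_addr.
have hp1 : (p.+1 < N.+1)%N by [].
have [G [dG hG]] := hF2 (Ordinal hp).
pose h := Ordinal hp1.
(* The fresh variable sits at position p + 1, just after the one it splits. *)
pose sg (o : option 'I_N) : 'I_N.+1 := if o is Some i then lift h i else h.
exists (fun z => G (fun o => nth 0 z (sg o))); split.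
  apply: (IH _ (fun x => G (x \o sg))); apply: dd_pullback dG.
  move=> [i|] [j|] //=; [by move=> /lift_inj -> | |].
    by move/eqP; rewrite eq_sym (negbTE (neq_lift _ _)).
  by move/eqP; rewrite (negbTE (neq_lift _ _)).
move=> z1 x y z2 s1 s2.
have := hG (fun o => nth 0 (z1 ++ [:: x, y & z2]) (sg o)).
have -> : nth 0 (z1 ++ [:: x, y & z2]) (sg (Some (Ordinal hp))) = x.
  by rewrite /= /bump /= ltnn add0n nth_cat s1 ltnn subnn.
have -> : nth 0 (z1 ++ [:: x, y & z2]) (sg None) = y.
  by rewrite /= nth_cat s1 ltnNge leqnSn /= subSnn.
move=> <-; congr (F _ - F _); apply/funext => i.
  case: (ltngtP i p) => ip.
  - have e : (p < i)%N = false by rewrite ltnNge (ltnW ip).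
    by rewrite /= /bump e add0n !nth_cat s1 ip.
  - have e : (i < p)%N = false by rewrite ltnNge (ltnW ip).
    have e' : (i.+1 < p)%N = false by rewrite ltnNge (leqW (ltnW ip)).
    rewrite /= /bump ip add1n !nth_cat s1 e e' subSn ?(ltnW ip) //.
    by case: (i - p)%N (subn_gt0 p i) => [|k]; rewrite ?ip.
  - by rewrite /= /bump -ip ltnn add0n !nth_cat s1 ip ltnn subnn.
rewrite /= /fresh -val_eqE /=.
case: (ltngtP i p) => ip.
- have e : (p < i)%N = false by rewrite ltnNge (ltnW ip).
  by rewrite /= /bump e add0n !nth_cat s1 ip.
- have e : (i < p)%N = false by rewrite ltnNge (ltnW ip).
  have e' : (i.+1 < p)%N = false by rewrite ltnNge (leqW (ltnW ip)).
  by rewrite /= /bump ip add1n !nth_cat s1 e e' subSn ?(ltnW ip).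
- have e : (p.+1 < p)%N = false by rewrite ltnNge leqnSn.
  by rewrite /= !nth_cat s1 ip ltnn e subnn subSnn.
Qed.

End DividedDifferences.

(** * Perturbation of spectral sums *)

Section SpectralSums.
Variables (R : realType) (K : complexes R) (n : nat).
Local Notation slot := ('M[K]_n * 'I_n * 'I_n)%type.
Implicit Types (s : seq slot) (F G : seq R -> R) (A B : 'M[K]_n).

(** Products of entries of spectral projections, integrated against [F]: for slots
    [(A_1, a_1, b_1), ..., (A_N, a_N, b_N)] this is an entry of the value of
    [F] at the commuting operators that [A_1, ..., A_N] induce on the [N]-th
    tensor power. *)
Fixpoint Phi s F : K :=
  if s is (A, a, b) :: s' then
    \sum_j Num.conj (dia A j a) * dia A j b * Phi s' (fun z => F (eig A j :: z))
  else (F [::])%:K.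

Lemma Phi_ext s F G : (forall z, size z = size s -> F z = G z) -> Phi s F = Phi s G.
Proof.
elim: s F G => [|[[A a] b] s IH] F G FG /=; first by rewrite FG.
by apply: eq_bigr => j _; congr (_ * _); apply: IH => z hz; apply: FG; rewrite /= hz.
Qed.

Lemma PhiB s F G : Phi s (fun z => F z - G z) = Phi s F - Phi s G.
Proof.
elim: s F G => [|[[A a] b] s IH] F G /=; first by rewrite rmorphB.
by rewrite -sumrB; apply: eq_bigr => j _; rewrite IH mulrBr.
Qed.

Lemma PhiZ s c F : Phi s (fun z => c * F z) = c%:K * Phi s F.
Proof.
elim: s F => [|[[A a] b] s IH] F /=; first by rewrite rmorphM.
by rewrite mulr_sumr; apply: eq_bigr => j _; rewrite IH mulrCA.
Qed.

Lemma mul_dia A : A^t* = A ->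
  dia A *m A = diag_mx (\row_i (eig A i)%:K) *m dia A.
Proof.
move=> hA; rewrite -{2}(dia_eq hA) /spm !mulmxA unitary_mulV ?mul1mx //.
exact: dia_unitary.
Qed.

Lemma mul_dia_adj A : A^t* = A ->
  A *m (dia A)^t* = (dia A)^t* *m diag_mx (\row_i (eig A i)%:K).
Proof.
move=> hA; rewrite -{1}(dia_eq hA) /spm -!mulmxA unitary_mulV ?mulmx1 //.
exact: dia_unitary.
Qed.

Lemma diag_commutator (x y : 'rV[K]_n) (X : 'M[K]_n) j k :
  (diag_mx x *m X - X *m diag_mx y) j k = (x 0 j - y 0 k) * X j k.
Proof.
by rewrite mul_diag_mx mul_mx_diag !mxE mulrBl [X in _ - X = _]mulrC.
Qed.

(** Insert the resolution of the identity by the projections of [A] next to a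
    projection of [B]; on the joint spectrum [B - A] acts as the difference of
    the eigenvalues. *)
Lemma spectral_diff A B a b (g : R -> K) (c : R -> R -> K) :
  A^t* = A -> B^t* = B ->
  (forall x y, g x - g y = (x - y)%:K * c x y) ->
  \sum_j Num.conj (dia B j a) * dia B j b * g (eig B j) -
  \sum_j Num.conj (dia A j a) * dia A j b * g (eig A j) =
  \sum_p \sum_q (B - A) p q * (\sum_j Num.conj (dia B j a) * dia B j p *
     (\sum_k Num.conj (dia A k q) * dia A k b * c (eig B j) (eig A k))).
Proof.
move=> hA hB hc; set U := dia B; set V := dia A.
have hU : U \is unitarymx by exact: dia_unitary.
have hV : V \is unitarymx by exact: dia_unitary.
pose w := U *m V^t*.
have f1 j k : \sum_p \sum_q U j p * (B - A) p q * Num.conj (V k q) =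
   (eig B j - eig A k)%:K * w j k.
  have : U *m (B - A) *m V^t* =
     diag_mx (\row_i (eig B i)%:K) *m w - w *m diag_mx (\row_i (eig A i)%:K).
    rewrite mulmxBr mulmxBl (mul_dia hB) -(mulmxA U A) (mul_dia_adj hA).
    by rewrite /w !mulmxA.
  move/matrixP => /(_ j k); rewrite diag_commutator => h.
  rewrite rmorphB; transitivity ((U *m (B - A) *m V^t* ) j k); last first.
    by rewrite h !mxE.
  rewrite mxE exchange_big /=.
  apply: eq_bigr => q _; rewrite !mxE mulr_suml; apply: eq_bigr => p _.
  by rewrite !mxE.
have f2 j : \sum_k w j k * V k b = U j b.
  have : w *m V = U by rewrite /w -mulmxA unitary_mulVl // mulmx1.
  by move/matrixP => /(_ j b); rewrite mxE.
have f3 k : \sum_j Num.conj (U j a) * w j k = Num.conj (V k a).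
  have : U^t* *m w = V^t* by rewrite /w mulmxA unitary_mulVl // mul1mx.
  move/matrixP => /(_ a k); rewrite mxE [RHS]adjE => <-.
  by apply: eq_bigr => j _; rewrite adjE.
transitivity (\sum_j \sum_k Num.conj (U j a) * V k b * w j k *
   (g (eig B j) - g (eig A k))).
  have -> : \sum_j \sum_k Num.conj (U j a) * V k b * w j k *
     (g (eig B j) - g (eig A k)) =
     \sum_j \sum_k Num.conj (U j a) * V k b * w j k * g (eig B j) -
     \sum_j \sum_k Num.conj (U j a) * V k b * w j k * g (eig A k).
    rewrite -sumrB; apply: eq_bigr => j _; rewrite -sumrB.
    by apply: eq_bigr => k _; rewrite mulrBr.
  congr (_ - _).
    apply: eq_bigr => j _; rewrite -(f2 j) mulr_sumr mulr_suml.
    by apply: eq_bigr => k _; ring.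
  rewrite exchange_big /=; apply: eq_bigr => k _.
  by rewrite -(f3 k) !mulr_suml; apply: eq_bigr => j _; ring.
transitivity (\sum_j \sum_k Num.conj (U j a) * V k b * c (eig B j) (eig A k) *
   (\sum_p \sum_q U j p * (B - A) p q * Num.conj (V k q))).
  by apply: eq_bigr => j _; apply: eq_bigr => k _; rewrite hc f1; ring.
transitivity (\sum_j \sum_k \sum_p \sum_q
   Num.conj (U j a) * V k b * c (eig B j) (eig A k) *
   (U j p * (B - A) p q * Num.conj (V k q))).
  apply: eq_bigr => j _; apply: eq_bigr => k _; rewrite mulr_sumr.
  by apply: eq_bigr => p _; rewrite mulr_sumr.
transitivity (\sum_p \sum_q \sum_j \sum_k
   Num.conj (U j a) * V k b * c (eig B j) (eig A k) *
   (U j p * (B - A) p q * Num.conj (V k q))).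
  transitivity (\sum_j \sum_p \sum_k \sum_q
     Num.conj (U j a) * V k b * c (eig B j) (eig A k) *
     (U j p * (B - A) p q * Num.conj (V k q))).
    by apply: eq_bigr => j _; rewrite exchange_big.
  rewrite exchange_big /=; apply: eq_bigr => p _.
  transitivity (\sum_j \sum_q \sum_k
     Num.conj (U j a) * V k b * c (eig B j) (eig A k) *
     (U j p * (B - A) p q * Num.conj (V k q))).
    by apply: eq_bigr => j _; rewrite exchange_big.
  by rewrite exchange_big.
apply: eq_bigr => p _; apply: eq_bigr => q _; rewrite mulr_sumr.
apply: eq_bigr => j _; rewrite [RHS]mulrA [RHS]mulr_sumr.
by apply: eq_bigr => k _; ring.
Qed.

(** Changing one slot from [A] to [B] replaces [F] by its divided difference [G],
    with one slot more; so perturbation theory stays within these sums, and no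
    derivative of an eigenvector occurs. *)
Lemma Phi_diff p q F G s1 s2 A B a b : size s1 = p -> size s2 = q ->
  A^t* = A -> B^t* = B ->
  (forall z1 x y z2, size z1 = p -> size z2 = q ->
      F (z1 ++ x :: z2) - F (z1 ++ y :: z2) = (x - y) * G (z1 ++ [:: x, y & z2])) ->
  Phi (s1 ++ (B, a, b) :: s2) F - Phi (s1 ++ (A, a, b) :: s2) F =
  \sum_c \sum_d (B - A) c d * Phi (s1 ++ [:: (B, a, c), (A, d, b) & s2]) G.
Proof.
move=> hp hq hA hB; elim: s1 p hp F G => [|[[X e] f] s1 IH] p /= <- F G hG.
  apply: (@spectral_diff A B a b (fun x => Phi s2 (fun z => F (x :: z)))
    (fun x y => Phi s2 (fun z => G [:: x, y & z]))) => // x y.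
  rewrite -PhiB -PhiZ; apply: Phi_ext => z hz.
  by apply: (hG [::]) => //; rewrite hz.
rewrite -sumrB.
transitivity (\sum_j Num.conj (dia X j e) * dia X j f *
  \sum_c \sum_d (B - A) c d * Phi (s1 ++ [:: (B, a, c), (A, d, b) & s2])
     (fun z => G (eig X j :: z))).
  apply: eq_bigr => j _; rewrite -mulrBr; congr (_ * _).
  apply: (IH (size s1)) => // z1 x y z2 h1 h2.
  by apply: (hG (eig X j :: z1)) => //=; rewrite h1.
rewrite (eq_bigr (fun j => \sum_c \sum_d (B - A) c d *
  (Num.conj (dia X j e) * dia X j f * Phi (s1 ++ [:: (B, a, c), (A, d, b) & s2])
     (fun z => G (eig X j :: z))))); last first.
  move=> j _; rewrite mulr_sumr; apply: eq_bigr => c _; rewrite mulr_sumr.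
  by apply: eq_bigr => d _; rewrite mulrCA.
rewrite exchange_big /=; apply: eq_bigr => c _; rewrite exchange_big /=.
by apply: eq_bigr => d _; rewrite mulr_sumr.
Qed.

Definition slots_in M s := forall t, t \in s -> herm_ball M t.1.1.

Lemma Phi_bound M C s F : 0 <= C -> slots_in M s ->
  (forall z, size z = size s -> all (fun t => `|t| <= (n * n)%:R * M) z ->
     `|F z| <= C) ->
  cxmod (Phi s F) <= n%:R ^+ size s * C.
Proof.
move=> C0; elim: s F => [|[[A a] b] s IH] F hs hF /=.
  by rewrite expr0 mul1r cxmod_ofR hF.
have [hA bA] := hs (A, a, b) (mem_head _ _).
apply: le_trans (cxmod_sum _ _ _) _.
have -> : n%:R ^+ (size s).+1 * C = \sum_(j < n) n%:R ^+ size s * C.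
  by rewrite sumr_const card_ord exprS -mulrA mulr_natl.
apply: ler_sum => j _.
rewrite !cxmodM cxmod_conj -[leRHS]mul1r ler_pM ?mulr_ge0 ?cxmod_ge0 //.
  rewrite -[leRHS]mulr1 ler_pM ?cxmod_ge0 // unitary_cxmod ?dia_unitary //.
apply: IH => [t ht|z hz az]; first by apply: hs; rewrite in_cons ht orbT.
by apply: hF; rewrite /= ?hz // az andbT; apply: eig_bound.
Qed.

Definition slot_close d (t t' : slot) :=
  [/\ close_by d t.1.1 t'.1.1, t.1.2 = t'.1.2 & t.2 = t'.2].

Fixpoint slots_close d s s' : Prop :=
  match s, s' with
  | [::], [::] => True
  | t :: u, t' :: u' => slot_close d t t' /\ slots_close d u u'
  | _, _ => False
  end.

Lemma slots_close_size d s s' : slots_close d s s' -> size s = size s'.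
Proof. by elim: s s' => [|t s IH] [|t' s'] //= [_ /IH ->]. Qed.

Lemma slots_in_cat M s1 s2 :
  slots_in M s1 -> slots_in M s2 -> slots_in M (s1 ++ s2).
Proof. by move=> h1 h2 t; rewrite mem_cat => /orP[/h1|/h2]. Qed.

Lemma slots_in_cons M t s : herm_ball M t.1.1 -> slots_in M s -> slots_in M (t :: s).
Proof. by move=> h1 h2 u; rewrite in_cons => /orP[/eqP->|/h2]. Qed.

Lemma slots_in_consP M t s : slots_in M (t :: s) -> herm_ball M t.1.1 /\ slots_in M s.
Proof.
move=> h; split; first by apply: h; rewrite mem_head.
by move=> u hu; apply: h; rewrite in_cons hu orbT.
Qed.

(** Change the slots one at a time, from left to right. *)
Lemma Phi_lip N M F : ddl 1 N F -> exists2 C, 0 <= C & forall d s s',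
  0 <= d -> size s = N -> slots_in M s -> slots_in M s' -> slots_close d s s' ->
  cxmod (Phi s F - Phi s' F) <= C * d.
Proof.
move=> [_ hF].
suff main k : exists2 C, 0 <= C & forall d s1 s s', 0 <= d -> size s = k ->
  (size s1 + k)%N = N -> slots_in M s1 ->
  slots_in M s -> slots_in M s' -> slots_close d s s' ->
  cxmod (Phi (s1 ++ s) F - Phi (s1 ++ s') F) <= C * d.
  have [C C0 hC] := main N; exists C => // d s s' d0 ss h1 h2 h3.
  by apply: (hC d [::]) => //.
elim: k => [|k [C C0 IH]].
  exists 0 => // d s1 [|//] [|//] d0 _ _ _ _ _ _.
  by rewrite subrr cxmod0 mul0r.
have [hkN|hkN] := leqP k.+1 N; last first.
  exists 0 => // d s1 s s' _ _ h; move: hkN; rewrite -h.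
  by rewrite ltnNge leq_addl.
have [G [[hG _] eG]] := hF (N - k.+1)%N k (subnK hkN).
have [E hE] := hG ((n * n)%:R * M).
pose D := (n * n)%:R * (n%:R ^+ N.+1 * `|E|).
have D0 : 0 <= D by rewrite !mulr_ge0 ?exprn_ge0.
exists (C + D); first exact: addr_ge0.
move=> d s1 [//|t u] [//|t' u'] d0 [su] sN h1 /slots_in_consP[ht hu].
move=> /slots_in_consP[ht' hu'] /= [tt' uu'].
have -> : Phi (s1 ++ t :: u) F - Phi (s1 ++ t' :: u') F =
  (Phi (rcons s1 t ++ u) F - Phi (rcons s1 t ++ u') F) +
  (Phi (s1 ++ t :: u') F - Phi (s1 ++ t' :: u') F).
  by rewrite -!cats1 -!catA /=; ring.
apply: le_trans (cxmodD _ _) _; rewrite mulrDl; apply: lerD.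
  apply: IH => //; first by rewrite size_rcons addSn -addnS.
  by move=> v; rewrite mem_rcons in_cons => /orP[/eqP->|/h1].
case: t t' ht ht' tt' => [[B a] b] [[A a'] b'] [/= hB bB] [hA bA] [[_ cAB] /= <- <-].
have s1p : size s1 = (N - k.+1)%N by rewrite -sN addnK.
have su' : size u' = k by rewrite -(slots_close_size uu').
rewrite (Phi_diff a b s1p su' hA hB eG).
apply: le_trans (cxmod_sum _ _ _) _.
have -> : D * d = \sum_(c < n) \sum_(e < n) (d * (n%:R ^+ N.+1 * `|E|)).
  rewrite !sumr_const !card_ord -mulrnA /D -mulr_natl; ring.
apply: ler_sum => c _; apply: le_trans (cxmod_sum _ _ _) _.
apply: ler_sum => e _; rewrite cxmodM ler_pM ?cxmod_ge0 //.
  by rewrite !mxE; exact: cAB.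
have sz : size (s1 ++ [:: (B, a, c), (A, e, b) & u']) = N.+1.
  by rewrite size_cat /= su' addnS -sN s1p -sN addnK.
rewrite -sz; apply: (Phi_bound (M := M)) => //.
  by apply: slots_in_cat => //; do 2 apply: slots_in_cons => //.
by rewrite sz => z hz az; apply: le_trans (hE z hz az) (ler_norm E).
Qed.

Lemma ddlW m N F : ddl m.+1 N F -> ddl m N F.
Proof.
elim: m N F => [|m IH] N F [h1 h2]; split => // p q pq.
by have [G [dG hG]] := h2 p q pq; exists G; split => //; exact: IH.
Qed.

Lemma ddl1 m N F : ddl m.+1 N F -> ddl 1 N F.
Proof. by elim: m => // m IH /ddlW. Qed.

Variable L : bool -> 'M[K]_n -> 'M[K]_n.
Hypothesis hL : forall l, herm_linear (L l).
Local Notation spec := (seq (bool * 'I_n * 'I_n)).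

Definition slots_at A (w : spec) := [seq (L t.1.1 A, t.1.2, t.2) | t <- w].

Lemma slots_at_in M A w : 0 <= M -> herm_ball M A -> slots_in M (slots_at A w).
Proof.
move=> M0 [hA bA] t /mapP[[[l a] b] _ ->] /=.
have [h1 h2 _ _] := hL l; split; first exact: h1.
exact: h2.
Qed.

Lemma slots_at_close d A B w : close_by d A B ->
  slots_close d (slots_at A w) (slots_at B w).
Proof.
move=> h; elim: w => //= t w IH; split => //; split => //=.
by have [_ _ h3 _] := hL t.1.1; exact: h3.
Qed.

Lemma slots_close_refl d s : 0 <= d -> slots_close d s s.
Proof.
by move=> d0; elim: s => //= t s IH; split => //; split => //; split => // i j;
   rewrite subrr cxmod0.
Qed.

Lemma slots_close_cat d s1 s2 s1' s2' : slots_close d s1 s1' ->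
  slots_close d s2 s2' -> slots_close d (s1 ++ s2) (s1' ++ s2').
Proof. by move=> h h2; elim: s1 s1' h => [|t s1 IH] [|t' s1'] //= [h1 /IH]. Qed.

Lemma bounded_ex m k (A : 'M[K]_(m, k)) : exists2 M, 0 <= M & bounded_by M A.
Proof.
exists (\sum_i \sum_j cxmod (A i j)).
  by apply: sumr_ge0 => i _; apply: sumr_ge0 => j _; exact: cxmod_ge0.
move=> i j; rewrite (bigD1 i) //= (bigD1 j) //= -addrA lerDl addr_ge0 //.
  by apply: sumr_ge0 => ? _; exact: cxmod_ge0.
by apply: sumr_ge0 => ? _; apply: sumr_ge0 => ? _; exact: cxmod_ge0.
Qed.

(** The slots are moved from [A] to [A + t H] one at a time. By [Phi_diff] each move
    contributes [t] times a spectral sum with one slot more, and evaluating this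
    sum at [A] costs [O(t)] by [Phi_lip]. The new sum has one order of
    smoothness less, hence the induction on [m]. *)
Lemma Phi_smooth m w F : ddl m.+1 (size w) F ->
  smoothM m (fun A => Phi (slots_at A w) F).
Proof.
have loc v (G : seq R -> R) : ddl 1 (size v) G ->
    loc_lip (fun A => Phi (slots_at A v) G).
  move=> dG M; have [C C0 hC] := Phi_lip `|M| dG.
  have [[hb _] _] := (dG, tt).
  have [E hE] := hb ((n * n)%:R * `|M|).
  have sv A : size (slots_at A v) = size v by rewrite size_map.
  have inM A : herm_ball M A -> slots_in `|M| (slots_at A v).
    move=> [hA bA]; apply: slots_at_in => //; split => // i j.
    exact: le_trans (bA i j) (ler_norm M).
  exists (C + n%:R ^+ size v * `|E|); split.
  - by rewrite addr_ge0 ?mulr_ge0 ?exprn_ge0.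
  - move=> A hA; apply: (@le_trans _ _ (n%:R ^+ size v * `|E|)); last by rewrite lerDr.
    rewrite -(sv A); apply: (Phi_bound (M := `|M|)) => //; first exact: inM.
    by rewrite sv => z hz az; apply: le_trans (hE z hz az) (ler_norm E).
  - move=> d A B hA hB hAB; have d0 := close_ge0 hAB.
    apply: le_trans (_ : C * d <= _); last by rewrite ler_wpM2r // lerDl mulr_ge0 ?exprn_ge0.
    apply: hC => //; [exact: inM|exact: inM|exact: slots_at_close].
elim: m w F => [|m IHm] w F dF; first by split=> //; exact: loc.
split; first exact: loc (ddl1 dF).
move=> H hH.
suff main (w2 w1 : spec) : (size w1 + size w2)%N = size w -> exists D, smoothM m D /\
  forall A, A^t* = A -> exists2 C, 0 <= C & forall t : R, `|t| <= 1 ->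
   cxmod (Phi (slots_at (A + t%:K *: H) w1 ++ slots_at (A + t%:K *: H) w2) F -
          Phi (slots_at (A + t%:K *: H) w1 ++ slots_at A w2) F - t%:K * D A)
     <= C * t ^+ 2.
  have [G [sG hG]] := main w [::] (erefl _); exists G; split => // A hA.
  by have [C _ hC] := hG A hA; exists C.
elim: w2 w1 => [|[[l a] b] u IH] w1 sw.
  exists (fun=> 0); split; first exact: smoothM_cst.
  move=> A hA; exists 0 => // t _.
  by rewrite subrr mulr0 subr0 cxmod0 mul0r.
have sw1 : (size (rcons w1 (l, a, b)) + size u)%N = size w.
  by rewrite size_rcons addSn -addnS.
have [G1 [sG1 hG1]] := IH _ sw1.
have [_ hF] := dF; have [Gp [dGp eGp]] := hF (size w1) (size u) sw.
pose w' c d := w1 ++ [:: (l, a, c), (l, d, b) & u].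
have sw' c d : size (w' c d) = (size w).+1.
  by rewrite /w' size_cat /= addnS -sw.
exists (fun A => G1 A + \sum_c \sum_d L l H c d * Phi (slots_at A (w' c d)) Gp).
split.
  apply: smoothM_add => //; apply: smoothM_sum => c _; apply: smoothM_sum => d _.
  by apply: smoothM_scale; apply: IHm; rewrite sw'.
move=> A hA; have [C1 C10 hC1] := hG1 A hA.
have [L1 L2 L3 L4] := hL l.
have [MA MA0 bA] := bounded_ex A; have [h h0 bH] := bounded_ex H.
pose M := MA + h.
have M0 : 0 <= M by rewrite addr_ge0.
have [E E0 hE] := Phi_lip M (ddl1 dGp).
have bAM : herm_ball M A.
  by split => // i j; apply: le_trans (bA i j) _; rewrite lerDl.
exists (C1 + (n * n)%:R * (h * (E * h))).
  by rewrite addr_ge0 ?mulr_ge0.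
move=> t ht; set At := A + t%:K *: H.
have bAt : herm_ball M At.
  split; first exact: herm_line.
  move=> i j; rewrite !mxE; apply: le_trans (cxmodD _ _) _; apply: lerD => //.
  by rewrite cxmodM cxmod_ofR -[leRHS]mul1r ler_pM ?cxmod_ge0.
have cAt : close_by (`|t| * h) At A.
  split; first by rewrite mulr_ge0.
  move=> i j; have -> : At i j - A i j = t%:K * H i j by rewrite !mxE; ring.
  by rewrite cxmodM cxmod_ofR ler_wpM2l.
have hAt : At^t* = At by case: bAt.
pose X c d := Phi (slots_at At w1 ++ [:: (L l At, a, c), (L l A, d, b) & slots_at A u]) Gp.
have eD : Phi (slots_at At w1 ++ (L l At, a, b) :: slots_at A u) F -
   Phi (slots_at At w1 ++ (L l A, a, b) :: slots_at A u) F =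
   t%:K * \sum_c \sum_d L l H c d * X c d.
  rewrite (Phi_diff a b (p := size w1) (q := size u) (G := Gp)) ?size_map ?L1 //.
  rewrite mulr_sumr; apply: eq_bigr => c _; rewrite mulr_sumr.
  apply: eq_bigr => d _; rewrite mulrA; congr (_ * _).
  by rewrite /At L4 !mxE; ring.
have -> : Phi (slots_at At w1 ++ slots_at At ((l, a, b) :: u)) F -
   Phi (slots_at At w1 ++ slots_at A ((l, a, b) :: u)) F -
   t%:K * (G1 A + \sum_c \sum_d L l H c d * Phi (slots_at A (w' c d)) Gp) =
  (Phi (slots_at At (rcons w1 (l, a, b)) ++ slots_at At u) F -
   Phi (slots_at At (rcons w1 (l, a, b)) ++ slots_at A u) F - t%:K * G1 A) +
  t%:K * \sum_c \sum_d L l H c d * (X c d - Phi (slots_at A (w' c d)) Gp).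
  have e1 : slots_at At (rcons w1 (l, a, b)) ++ slots_at At u =
    slots_at At w1 ++ slots_at At ((l, a, b) :: u) by rewrite /slots_at map_rcons cat_rcons.
  have e2 : slots_at At (rcons w1 (l, a, b)) ++ slots_at A u =
    slots_at At w1 ++ (L l At, a, b) :: slots_at A u by rewrite /slots_at map_rcons cat_rcons.
  have e3 : slots_at A ((l, a, b) :: u) = (L l A, a, b) :: slots_at A u by [].
  rewrite e1 e2 e3.
  have -> : \sum_c \sum_d L l H c d * (X c d - Phi (slots_at A (w' c d)) Gp) =
    \sum_c \sum_d L l H c d * X c d -
    \sum_c \sum_d L l H c d * Phi (slots_at A (w' c d)) Gp.
    rewrite -sumrB; apply: eq_bigr => c _; rewrite -sumrB.
    by apply: eq_bigr => d _; rewrite mulrBr.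
  rewrite mulrBr -eD; ring.
apply: le_trans (cxmodD _ _) _; rewrite mulrDl; apply: lerD; first exact: hC1.
rewrite cxmodM cxmod_ofR -(real_normK (num_real t)) expr2.
have -> : (n * n)%:R * (h * (E * h)) * (`|t| * `|t|) =
   `|t| * ((n * n)%:R * (h * (E * (`|t| * h)))) by ring.
apply: ler_wpM2l => //; apply: le_trans (cxmod_sum _ _ _) _.
have -> : (n * n)%:R * (h * (E * (`|t| * h))) =
   \sum_(c < n) \sum_(d < n) (h * (E * (`|t| * h))).
  by rewrite !sumr_const !card_ord -mulrnA mulr_natl.
apply: ler_sum => c _; apply: le_trans (cxmod_sum _ _ _) _.
apply: ler_sum => d _; rewrite cxmodM ler_pM ?cxmod_ge0 //; first exact: L2.
have e : slots_at A (w' c d) =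
  slots_at A w1 ++ [:: (L l A, a, c), (L l A, d, b) & slots_at A u].
  by rewrite /slots_at map_cat.
rewrite /X e; apply: hE => //.
- by rewrite mulr_ge0.
- by rewrite size_cat /= !size_map addnS -sw.
- apply: slots_in_cat; first exact: slots_at_in.
  have bL B : herm_ball M B -> herm_ball M (L l B).
    by move=> [hB bB]; split; [exact: L1|exact: L2].
  do 2 (apply: slots_in_cons; first exact: bL).
  exact: slots_at_in.
- by rewrite -e; exact: slots_at_in.
- apply: slots_close_cat; first exact: slots_at_close.
  split; first by split => //; exact: L3.
  apply: slots_close_refl; by rewrite mulr_ge0.
Qed.

End SpectralSums.

(** * Corners and extensions *)

Section CornerExtend.
Variable T : pzRingType.

Definition wid n (i : 'I_n) : 'I_n.+1 := widen_ord (leqnSn n) i.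
Definition cor n (A : 'M[T]_n.+1) : 'M[T]_n := corner (leqnSn n) A.
Definition up (c : T) n (B : 'M[T]_n) : 'M[T]_n.+1 := extend c (leqnSn n) B.

Lemma ord_wid_ind n (P : 'I_n.+1 -> Prop) :
  (forall i : 'I_n, P (wid i)) -> P ord_max -> forall i, P i.
Proof.
move=> h1 h2 i; have [hi|hi] := ltnP i n.
  by rewrite (_ : i = wid (Ordinal hi)) //; apply: val_inj.
rewrite (_ : i = ord_max) //; apply: val_inj; apply/eqP.
by rewrite eqn_leq hi andbT -ltnS ltn_ord.
Qed.

Lemma wid_neq_max n (i : 'I_n) : (wid i == ord_max) = false.
Proof. by apply/eqP => /(congr1 val) /= e; have := ltn_ord i; rewrite e ltnn. Qed.

Lemma max_neq_wid n (i : 'I_n) : (ord_max == wid i) = false.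
Proof. by rewrite eq_sym wid_neq_max. Qed.

Lemma wid_inj n : injective (@wid n).
Proof. by move=> i j /(congr1 val) /= /val_inj. Qed.

Lemma extend_in c n k (hk : (k <= n)%N) (B : 'M[T]_k) i j :
  extend c hk B (widen_ord hk i) (widen_ord hk j) = B i j.
Proof.
rewrite /extend castmxE.
have e (l : 'I_k) : cast_ord (esym (subnKC hk)) (widen_ord hk l) = lshift (n - k) l.
  exact: val_inj.
by rewrite !e block_mxEul.
Qed.

Lemma extend_out c n k (hk : (k <= n)%N) (B : 'M[T]_k) (i j : 'I_n) :
  (k <= i)%N || (k <= j)%N -> extend c hk B i j = if i == j then c else 0.
Proof.
rewrite /extend castmxE.
have -> : (i == j) = (nat_of_ord i == nat_of_ord j) by [].
have -> : nat_of_ord i = nat_of_ord (cast_ord (esym (subnKC hk)) i) by [].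
have -> : nat_of_ord j = nat_of_ord (cast_ord (esym (subnKC hk)) j) by [].
move: (cast_ord _ i) (cast_ord _ j) => {}i {}j.
case: (split_ordP i) => i' ->; case: (split_ordP j) => j' -> /=.
- by rewrite leqNgt ltn_ord leqNgt ltn_ord.
- rewrite block_mxEur mxE; case: eqP => // e.
  by move: (ltn_ord i'); rewrite e ltnNge leq_addr.
- rewrite block_mxEdl mxE; case: eqP => // e.
  by move: (ltn_ord j'); rewrite -e ltnNge leq_addr.
- by rewrite block_mxEdr mxE eqn_add2l val_eqE; case: eqP.
Qed.

Lemma up_ww c n (B : 'M[T]_n) i j : up c B (wid i) (wid j) = B i j.
Proof. exact: extend_in. Qed.

Lemma up_wm c n (B : 'M[T]_n) i : up c B (wid i) ord_max = 0.
Proof. by rewrite /up extend_out ?leqnn ?orbT // wid_neq_max. Qed.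

Lemma up_mw c n (B : 'M[T]_n) i : up c B ord_max (wid i) = 0.
Proof. by rewrite /up extend_out ?leqnn // max_neq_wid. Qed.

Lemma up_mm c n (B : 'M[T]_n) : up c B ord_max ord_max = c.
Proof. by rewrite /up extend_out ?leqnn // eqxx. Qed.

Definition upE := (up_ww, up_wm, up_mw, up_mm).

Lemma corE n (A : 'M[T]_n.+1) i j : cor A i j = A (wid i) (wid j).
Proof. by rewrite mxE. Qed.

Lemma eq_up n (A B : 'M[T]_n.+1) :
  (forall i j : 'I_n, A (wid i) (wid j) = B (wid i) (wid j)) ->
  (forall i : 'I_n, A (wid i) ord_max = B (wid i) ord_max) ->
  (forall i : 'I_n, A ord_max (wid i) = B ord_max (wid i)) ->
  A ord_max ord_max = B ord_max ord_max -> A = B.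
Proof.
move=> h1 h2 h3 h4; apply/matrixP; apply: ord_wid_ind => [i|].
  by apply: ord_wid_ind => [j|].
by apply: ord_wid_ind => [j|].
Qed.

Lemma sum_wid n (F : 'I_n.+1 -> T) :
  \sum_i F i = \sum_(i < n) F (wid i) + F ord_max.
Proof. by rewrite big_ord_recr. Qed.

Lemma upM c d n (B C : 'M[T]_n) : up c B *m up d C = up (c * d) (B *m C).
Proof.
apply: eq_up => [i j|i|i|]; rewrite !mxE sum_wid ?upE.
- by rewrite mul0r addr0 mxE; apply: eq_bigr => k _; rewrite !upE.
- by rewrite mul0r addr0 big1 // => k _; rewrite !upE mulr0.
- by rewrite mulr0 addr0 big1 // => k _; rewrite !upE mul0r.
- by rewrite big1 ?add0r // => k _; rewrite !upE mul0r.
Qed.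

Lemma up_add c d n (B C : 'M[T]_n) : up c B + up d C = up (c + d) (B + C).
Proof. by apply: eq_up => [i j|i|i|]; rewrite !mxE !upE ?mxE ?addr0. Qed.

Lemma up1 n : up 1 (1%:M : 'M[T]_n) = 1%:M.
Proof.
apply: eq_up => [i j|i|i|]; rewrite !mxE upE ?mxE //.
- by rewrite wid_neq_max.
- by rewrite max_neq_wid.
- by rewrite eqxx.
Qed.

Lemma cor_up c n (B : 'M[T]_n) : cor (up c B) = B.
Proof. by apply/matrixP => i j; rewrite corE upE. Qed.

Lemma cor_upl c n (W : 'M[T]_n) (A : 'M[T]_n.+1) : cor (up c W *m A) = W *m cor A.
Proof.
apply/matrixP => i j; rewrite corE !mxE sum_wid upE mul0r addr0.
by apply: eq_bigr => k _; rewrite upE corE.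
Qed.

Lemma cor_upr c n (W : 'M[T]_n) (A : 'M[T]_n.+1) : cor (A *m up c W) = cor A *m W.
Proof.
apply/matrixP => i j; rewrite corE !mxE sum_wid upE mulr0 addr0.
by apply: eq_bigr => k _; rewrite upE corE.
Qed.

Lemma corner_corner n k (hk : (k <= n)%N) (hk' : (k <= n.+1)%N) (A : 'M[T]_n.+1) :
  corner hk' A = corner hk (cor A).
Proof. by apply/matrixP => i j; rewrite !mxE; congr (A _ _); apply: val_inj. Qed.

Lemma corner_full n (hk : (n <= n)%N) (A : 'M[T]_n) : corner hk A = A.
Proof. by apply/matrixP => i j; rewrite !mxE; congr (A _ _); apply: val_inj. Qed.

Lemma extend_up c n k (hk : (k <= n)%N) (hk' : (k <= n.+1)%N) (B : 'M[T]_k) :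
  extend c hk' B = up c (extend c hk B).
Proof.
apply: eq_up => [i j|i|i|]; rewrite upE.
- have [/orP hij|] := boolP ((k <= i)%N || (k <= j)%N).
    by rewrite !extend_out //; exact/orP.
  rewrite negb_or -!ltnNge => /andP[hi hj].
  have e (l : 'I_n) (hl : (l < k)%N) : wid l = widen_ord hk' (Ordinal hl) by exact: val_inj.
  have e' (l : 'I_n) (hl : (l < k)%N) : l = widen_ord hk (Ordinal hl) by exact: val_inj.
  by rewrite (e i hi) (e j hj) [in RHS](e' i hi) [in RHS](e' j hj) !extend_in.
- by rewrite extend_out ?wid_neq_max // /= hk orbT.
- by rewrite extend_out ?max_neq_wid // /= hk.
- by rewrite extend_out ?eqxx // /= hk.
Qed.

Lemma extend_full c n (hk : (n <= n)%N) (B : 'M[T]_n) : extend c hk B = B.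
Proof.
apply/matrixP => i j.
have e (l : 'I_n) : l = widen_ord hk l by exact: val_inj.
by rewrite [in LHS](e i) [in LHS](e j) extend_in.
Qed.

End CornerExtend.

Section CornerDet.
Variable T : comPzRingType.

Lemma det_up c n (B : 'M[T]_n) : \det (up c B) = \det B * c.
Proof.
have det_cast m p (e : m = p) (M : 'M[T]_m) : \det (castmx (e, e) M) = \det M.
  by case: _ / e; rewrite castmx_id.
by rewrite /up /extend det_cast det_ublock det_scalar subSnn expr1.
Qed.

End CornerDet.

Section CornerAdjoint.
Variable C : numClosedFieldType.

Lemma up_adj c n (B : 'M[C]_n) : (up c B)^t* = up (Num.conj c) (B^t* ).
Proof. by apply: eq_up => [i j|i|i|]; rewrite adjE !upE ?adjE ?rmorph0. Qed.

Lemma up_conj c n (B : 'M[C]_n) :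
  map_mx Num.conj (up c B) = up (Num.conj c) (map_mx Num.conj B).
Proof. by apply: eq_up => [i j|i|i|]; rewrite mxE !upE ?mxE ?rmorph0. Qed.

Lemma cor_adj n (A : 'M[C]_n.+1) : (cor A)^t* = cor (A^t* ).
Proof. by apply/matrixP => i j; rewrite adjE !corE adjE. Qed.

Lemma cor_conj n (A : 'M[C]_n.+1) :
  map_mx Num.conj (cor A) = cor (map_mx Num.conj A).
Proof. by apply/matrixP => i j; rewrite mxE !corE mxE. Qed.

Lemma up_unitary c n (W : 'M[C]_n) : W \is unitarymx -> c * Num.conj c = 1 ->
  up c W \is unitarymx.
Proof.
move=> hW hc; apply/unitarymxP.
by rewrite up_adj upM hc unitary_mulV // up1.
Qed.

Lemma up_spm c n (V : 'M[C]_n) (y : 'I_n -> C) :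
  up c (spm V y) = spm (up 1 V) (fun i => oapp y c (insub (val i) : option 'I_n)).
Proof.
rewrite /spm up_adj rmorph1.
have -> : diag_mx (\row_i oapp y c (insub (val i))) = up c (diag_mx (\row_i y i)).
  have hw (i : 'I_n) : insub (val (wid i)) = Some i.
    by rewrite insubT //= => h; congr Some; apply: val_inj.
  have hm : (insub (val (ord_max : 'I_n.+1)) : option 'I_n) = None.
    by rewrite insubF //= ltnn.
  apply: eq_up => [i j|i|i|]; rewrite !mxE upE ?mxE.
  - by rewrite hw /= (inj_eq (@wid_inj n)).
  - by rewrite wid_neq_max.
  - by rewrite max_neq_wid.
  - by rewrite hm eqxx.
by rewrite !upM mul1r mulr1.
Qed.

End CornerAdjoint.

(** * The one-step conjugation *)

Section DoubleCalculus.
Variable C : numClosedFieldType.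

Lemma conjmxM m n p (A : 'M[C]_(m, n)) (B : 'M[C]_(n, p)) :
  map_mx Num.conj (A *m B) = map_mx Num.conj A *m map_mx Num.conj B.
Proof. exact: map_mxM. Qed.

Lemma conjmxD m n (A B : 'M[C]_(m, n)) :
  map_mx Num.conj (A + B) = map_mx Num.conj A + map_mx Num.conj B.
Proof. exact: map_mxD. Qed.

(** Functional calculus in two variables: left multiplication by the matrix
    diagonalized by [V] and right multiplication by the one diagonalized by [U]
    commute, and this is [M] of these two operators, applied to the identity. *)
Definition dbl n (V U : 'M[C]_n) (M : 'I_n -> 'I_n -> C) : 'M[C]_n :=
  V^t* *m (\matrix_(i, j) (M i j * (V *m U^t* ) i j)) *m U.

Lemma dblE n (V U : 'M[C]_n) M a b :
  dbl V U M a b = \sum_c \sum_i Num.conj (V i a) * V i c *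
    (\sum_j Num.conj (U j c) * U j b * M i j).
Proof.
rewrite /dbl -mulmxA mxE exchange_big /=; apply: eq_bigr => i _.
rewrite adjE mxE.
have -> : \sum_j (\matrix_(i, j) (M i j * (V *m U^t* ) i j)) i j * U j b =
  \sum_j \sum_c V i c * (Num.conj (U j c) * U j b * M i j).
  apply: eq_bigr => j _; rewrite !mxE mulr_sumr mulr_suml.
  by apply: eq_bigr => c _; rewrite !mxE; ring.
rewrite exchange_big mulr_sumr /=; apply: eq_bigr => c _.
by rewrite -mulrA [in RHS]mulr_sumr.
Qed.

Lemma dbl_mulr n (V U W : 'M[C]_n) M : W \is unitarymx ->
  dbl (V *m W^t* ) (U *m W^t* ) M = W *m dbl V U M *m W^t*.
Proof.
move=> hW; rewrite /dbl !adjM trmxCK !mulmxA -(mulmxA V (W^t* ) W).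
by rewrite unitary_mulVl // mulmx1.
Qed.

Lemma dbl_conj n (V U : 'M[C]_n) M :
  map_mx Num.conj (dbl V U M) =
  dbl (map_mx Num.conj V) (map_mx Num.conj U) (fun i j => Num.conj (M i j)).
Proof.
apply/matrixP => a b; rewrite [LHS]mxE !dblE rmorph_sum /=.
apply: eq_bigr => c _; rewrite rmorph_sum /=; apply: eq_bigr => i _.
rewrite !rmorphM rmorph_sum /= !mxE; congr (_ * _).
by apply: eq_bigr => j _; rewrite !rmorphM /= !mxE.
Qed.

(** As for [spm_calc], the entries of the two changes of basis vanish unless the
    eigenvalues agree. *)
Lemma dbl_calc n (U V U2 V2 : 'M[C]_n) (x y x2 y2 : 'I_n -> C) M M2 :
  U \is unitarymx -> V \is unitarymx -> U2 \is unitarymx -> V2 \is unitarymx ->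
  spm U x = spm U2 x2 -> spm V y = spm V2 y2 ->
  (forall i j i2 j2, y i = y2 i2 -> x j = x2 j2 -> M i j = M2 i2 j2) ->
  dbl V U M = dbl V2 U2 M2.
Proof.
move=> hU hV hU2 hV2 eU eV hM.
pose Q := V2 *m V^t*; pose S := U2 *m U^t*; pose w := V *m U^t*.
pose N : 'M[C]_n := \matrix_(i, j) (M i j * w i j).
have e : (\matrix_(i, j) (M2 i j * (V2 *m U2^t* ) i j) : 'M[C]_n) = Q *m N *m S^t*.
  have e2 : V2 *m U2^t* = Q *m w *m S^t*.
    rewrite /Q /S /w adjM trmxCK !mulmxA -(mulmxA V2) unitary_mulVl // mulmx1.
    by rewrite -(mulmxA V2 (U^t* ) U) unitary_mulVl // mulmx1.
  apply/matrixP => i j; rewrite [LHS]mxE e2 [in LHS]mxE [RHS]mxE mulr_sumr.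
  apply: eq_bigr => m _; rewrite [in LHS]mxE [in RHS]mxE !mulr_suml mulr_sumr.
  apply: eq_bigr => l _; rewrite adjE [N l m]mxE.
  case: (eqVneq (Q i l) 0) => [->|hQ]; first by rewrite !mul0r mulr0.
  case: (eqVneq (S j m) 0) => [->|hS]; first by rewrite rmorph0 !mulr0.
  have hy : y l = y2 i.
    by apply: (mulfI hQ); rewrite [RHS]mulrC; exact: (spm_intertwine i l hV hV2 eV).
  have hx : x m = x2 j.
    by apply: (mulfI hS); rewrite [RHS]mulrC; exact: (spm_intertwine j m hU hU2 eU).
  by rewrite -(hM _ _ _ _ hy hx); ring.
rewrite [RHS]/dbl e /Q /S adjM trmxCK !mulmxA unitary_mulVl // mul1mx.
by rewrite -(mulmxA _ (U2^t* )) unitary_mulVl // mulmx1.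
Qed.

Lemma dbl_diag n (V : 'M[C]_n) M : V \is unitarymx ->
  dbl V V M = spm V (fun i => M i i).
Proof.
move=> hV; rewrite /dbl /spm; congr (_ *m _ *m _).
apply/matrixP => i j; rewrite !mxE.
have := unitary_mulV hV => /matrixP /(_ i j); rewrite !mxE => ->.
by case: eqP => [->|_]; rewrite ?mulr1 ?mulr0.
Qed.

End DoubleCalculus.

Section Phi.
Variables (R : realType) (K : complexes R).
Implicit Types (x y u : R).

(** The square root of the difference quotient of [exp]; as the quotient is positive,
    it is smooth also where [x = y]. *)
Definition sh x y : R := Num.sqrt (expdd [:: x; y]).
Definition se x : R := Num.sqrt (expR x).

Lemma sh_gt0 x y : 0 < sh x y. Proof. by rewrite sqrtr_gt0 expdd2_gt0. Qed.
Lemma se_gt0 x : 0 < se x. Proof. by rewrite sqrtr_gt0 expR_gt0. Qed.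
Lemma sh_sqr x y : sh x y ^+ 2 = expdd [:: x; y].
Proof. by rewrite sqr_sqrtr // ltW // expdd2_gt0. Qed.
Lemma se_sqr x : se x ^+ 2 = expR x.
Proof. by rewrite sqr_sqrtr // expR_ge0. Qed.
Lemma shxx x : sh x x = se x. Proof. by rewrite /sh expddxx. Qed.

(** The common shape of the functions below. The products over the two spectra [X] and
    [Y] do not depend on the order of the eigenvalues. *)
Definition coef n (g : R -> R -> R) (k l : R -> R -> R -> R) (X Y : 'I_n -> R) x y :=
  g x y * \prod_m k (X m) x y * \prod_m l (Y m) x y.

(** The row [i] of the matrix of eigenvectors of [A], in an eigenbasis of its corner, is
    a Cauchy matrix [b_i v_j / (x_j - y_i)]. These functions are the factors by which
    the entries change when the spectra [x] and [y] are replaced by their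
    exponentials; see [core_wid]. The list [Y] is the spectrum of the corner extended
    by zero, and the factors [sh 0] cancel the contribution of this zero. *)
Definition g_up x y := se x * se y * sh 0 y * (sh 0 x * expdd [:: x; y])^-1.
Definition k_up u x y := sh u y * (sh u x)^-1.
Definition l_up u x y := sh u x * (sh u y)^-1.
(** The same factors for the last row [v_j]; see [core_max]. *)
Definition g_low x (y : R) := se x * (sh 0 x)^-1.
Definition k_low u x (y : R) := (sh u x)^-1.
Definition l_low u x (y : R) := sh u x.

Definition term n g k l (U : 'M[K]_n) X (V : 'M[K]_n) Y : 'M[K]_n :=
  dbl V U (fun i j => (coef g k l X Y (X j) (Y i))%:K).

Definition phi_of n (U : 'M[K]_n.+1) X (V : 'M[K]_n.+1) Y : 'M[K]_n.+1 :=
  up 0 1%:M *m term g_up k_up l_up U X V Y +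
  up 1 0 *m term g_low k_low l_low U X V Y.

(** The unitary matrix that conjugates [exp A] to a matrix whose upper left corner
    is [exp] of that of [A]; see [phi_unitary] and [phi_corner]. *)
Definition phi n (A : 'M[K]_n.+1) : 'M[K]_n.+1 :=
  let Z := up 0 (cor A) in phi_of (dia A) (eig A) (dia Z) (eig Z).

Lemma up0_herm n (A : 'M[K]_n.+1) : A^t* = A ->
  (up 0 (cor A) : 'M[K]_n.+1)^t* = up 0 (cor A).
Proof. by move=> hA; rewrite up_adj rmorph0 cor_adj hA. Qed.

Lemma prod_spectrum n (U : 'M[K]_n) (X : 'I_n -> R) (A : 'M[K]_n) (f : R -> R) :
  U \is unitarymx -> A = spm U (fun i => (X i)%:K) ->
  \prod_i f (eig A i) = \prod_i f (X i).
Proof.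
move=> hU ->; have h := eig_perm X hU.
have e (v : 'I_n -> R) : \prod_i f (v i) = \prod_(t <- [seq v i | i <- enum 'I_n]) f t.
  by rewrite big_map big_enum.
by rewrite !e (perm_big _ h).
Qed.

(** Independence of the diagonalizations, from [dbl_calc]. *)
Lemma term_eq n g k l (A Z U V : 'M[K]_n) X Y : A^t* = A -> Z^t* = Z ->
  U \is unitarymx -> V \is unitarymx ->
  A = spm U (fun i => (X i)%:K) -> Z = spm V (fun i => (Y i)%:K) ->
  term g k l (dia A) (eig A) (dia Z) (eig Z) = term g k l U X V Y.
Proof.
move=> hA hZ hU hV eA eZ.
apply: (dbl_calc (x := fun i => (eig A i)%:K) (y := fun i => (eig Z i)%:K)
  (x2 := fun i => (X i)%:K) (y2 := fun i => (Y i)%:K)) => //.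
- exact: dia_unitary.
- exact: dia_unitary.
- by rewrite dia_eq.
- by rewrite dia_eq.
move=> i j i2 j2 /inj_ofR -> /inj_ofR ->; congr (_%:K).
rewrite /coef; congr (_ * _ * _).
  exact: (prod_spectrum (fun u => k u (X j2) (Y i2)) hU eA).
exact: (prod_spectrum (fun u => l u (X j2) (Y i2)) hV eZ).
Qed.

Lemma phi_eq n (A : 'M[K]_n.+1) (U V : 'M[K]_n.+1) X Y : A^t* = A ->
  U \is unitarymx -> V \is unitarymx ->
  A = spm U (fun i => (X i)%:K) -> up 0 (cor A) = spm V (fun i => (Y i)%:K) ->
  phi A = phi_of U X V Y.
Proof.
move=> hA hU hV eA eZ; rewrite /phi /phi_of.
by rewrite !(term_eq _ _ _ hA (up0_herm hA) hU hV eA eZ).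
Qed.

(** Both [A] and its extended corner are transported by [U(n) x U(1)], which commutes
    with the projections [up 0 1%:M] and [up 1 0]. *)
Lemma phi_equiv n (A : 'M[K]_n.+1) (W : 'M[K]_n) c : A^t* = A ->
  W \is unitarymx -> c * Num.conj c = 1 ->
  phi (up c W *m A *m (up c W)^t* ) = up c W *m phi A *m (up c W)^t*.
Proof.
move=> hA hW hc; set T := up c W.
have hT : T \is unitarymx by exact: up_unitary.
have hU := dia_unitary hA; have hZ := up0_herm hA; have hV := dia_unitary hZ.
have hTA : (T *m A *m T^t* )^t* = T *m A *m T^t*.
  by rewrite !adjM trmxCK hA mulmxA.
rewrite (@phi_eq _ _ (dia A *m T^t* ) (dia (up 0 (cor A)) *m T^t* ) (eig A)
  (eig (up 0 (cor A)))) //.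
- rewrite /phi /phi_of /term !dbl_mulr // mulmxDr mulmxDl !mulmxA.
  by rewrite /T !upM !mulr1 !mul1r !mulr0 !mul0r !mulmx1 !mul1mx !mulmx0 !mul0mx.
- by apply: unitaryM => //; exact: unitaryV.
- by apply: unitaryM => //; exact: unitaryV.
- by apply: spm_eigen_mul => //; rewrite dia_eq.
- rewrite -(spm_eigen_mul hV hT (esym (dia_eq hZ))).
  by rewrite /T up_adj cor_upr cor_upl !upM mulr0 mul0r.
Qed.

Lemma phi_conj n (A : 'M[K]_n.+1) : A^t* = A ->
  map_mx Num.conj (phi A) = phi (map_mx Num.conj A).
Proof.
move=> hA; have hZ := up0_herm hA.
have hU := dia_unitary hA; have hV := dia_unitary hZ.
have cu (U : 'M[K]_n.+1) : U \is unitarymx -> map_mx Num.conj U \is unitarymx.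
  by move=> h; rewrite conjC_unitary.
rewrite (@phi_eq _ (map_mx Num.conj A) (map_mx Num.conj (dia A)) (map_mx Num.conj (dia (up 0 (cor A))))
   (eig A) (eig (up 0 (cor A)))) ?cu //.
- rewrite /phi /phi_of /term conjmxD (conjmxM (up 0 1%:M)) (conjmxM (up 1 0)).
  have e0 : map_mx Num.conj (up 0 1%:M : 'M[K]_n.+1) = up 0 1%:M.
    by rewrite up_conj rmorph0 map_mx1.
  have e1 : map_mx Num.conj (up 1 0 : 'M[K]_n.+1) = up 1 0.
    by rewrite up_conj rmorph1 map_mx0.
  rewrite !dbl_conj e0 e1.
  by congr (_ *m dbl _ _ _ + _ *m dbl _ _ _); apply/funext => i; apply/funext => j;
     rewrite conjK.
- by rewrite adj_conj hA.
- rewrite -{1}(dia_eq hA) spm_conj; apply: eq_spm => i; exact: conjK.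
- have -> : up 0 (cor (map_mx Num.conj A)) = map_mx Num.conj (up 0 (cor A)).
    by rewrite up_conj rmorph0 cor_conj.
  rewrite -{1}(dia_eq hZ) spm_conj.
  by apply: eq_spm => i; exact: conjK.
Qed.

Lemma coef_diag_up n (X : 'I_n -> R) x : coef g_up k_up l_up X X x x = 1.
Proof.
rewrite /coef /g_up /k_up /l_up -mulrA -big_split /= big1 ?mulr1.
  have h1 := sh_gt0 0 x; have h2 := sh_gt0 x x; rewrite -sh_sqr -shxx.
  by field; rewrite !gt_eqF.
move=> i _; have h := sh_gt0 (X i) x; by field; rewrite gt_eqF.
Qed.

Lemma coef_diag_low n (X : 'I_n -> R) x y :
  coef g_low k_low l_low X X x y = se x * (sh 0 x)^-1.
Proof.
rewrite /coef /g_low /k_low /l_low -mulrA -big_split /= big1 ?mulr1 //.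
move=> i _; have h := sh_gt0 (X i) x; by rewrite mulVf // gt_eqF.
Qed.

(** Here both diagonalizations coincide, so that only the diagonal values of the two
    functions enter. *)
Lemma phi_up n (B : 'M[K]_n) : B^t* = B -> phi (up 0 B) = 1%:M.
Proof.
move=> hB; have hA : (up 0 B : 'M[K]_n.+1)^t* = up 0 B by rewrite up_adj rmorph0 hB.
have hV := dia_unitary hB.
pose Y (i : 'I_n.+1) := oapp (eig B) 0 (insub (val i) : option 'I_n).
have eA : up 0 B = spm (up 1 (dia B)) (fun i => (Y i)%:K).
  rewrite -{1}(dia_eq hB) up_spm; apply: eq_spm => i.
  by rewrite /Y; case: insub => //=; rewrite rmorph0.
have hU : (up 1 (dia B) : 'M[K]_n.+1) \is unitarymx.
  by apply: up_unitary => //; rewrite rmorph1 mulr1.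
rewrite (phi_eq (Y := Y) hA hU hU eA) ?cor_up // /phi_of /term !dbl_diag //.
rewrite (eq_spm _ (g := fun=> 1)); last by move=> i; rewrite coef_diag_up rmorph1.
rewrite spm1 // mulmx1.
rewrite (eq_spm _ (g := fun i : 'I_n.+1 => oapp (fun j => (se (eig B j) * (sh 0 (eig B j))^-1)%:K) 1
   (insub (val i) : option 'I_n))); last first.
  move=> i; rewrite coef_diag_low /Y; case: insub => //=.
  by rewrite shxx mulfV ?rmorph1 // gt_eqF // se_gt0.
rewrite -up_spm upM mul1r mul0mx.
by rewrite up_add addr0 add0r up1.
Qed.

End Phi.

(** * Smoothness of the one-step conjugation *)

Section TermSmooth.
Variables (R : realType) (K : complexes R) (n : nat).

Lemma exchange_big3 (I J L : finType) (F : I -> J -> L -> K) :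
  \sum_i \sum_j \sum_l F i j l = \sum_l \sum_i \sum_j F i j l.
Proof.
rewrite [RHS]exchange_big /=; apply: eq_bigr => i _.
by rewrite [RHS]exchange_big.
Qed.

Lemma det_mul_sum (M N : 'M[K]_n) c :
  \sum_(s : {perm 'I_n}) \sum_(t : {perm 'I_n}) (-1) ^+ s * (-1) ^+ t *
    (c * \prod_m M m (s m) * \prod_m N m (t m)) = c * \det M * \det N.
Proof.
rewrite -[RHS]mulrA /determinant big_distrlr mulr_sumr /=; apply: eq_bigr => s _.
rewrite mulr_sumr; apply: eq_bigr => t _.
by rewrite -[c * _ * _]mulrA mulrCA; congr (_ * _); rewrite mulrACA.
Qed.

Lemma det_spm (U : 'M[K]_n) f : U \is unitarymx -> \det (spm U f) = \prod_i f i.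
Proof.
move=> hU; rewrite /spm !det_mulmx mulrAC -det_mulmx unitary_mulVl // det1 mul1r.
by rewrite det_diag; apply: eq_bigr => i _; rewrite mxE.
Qed.

Lemma ddl_ext m N (F G : seq R -> R) : (forall z, size z = N -> F z = G z) ->
  ddl m N F -> ddl m N G.
Proof.
case: m => [|m] FG [h1 h2]; split => //.
- by move=> M; have [C hC] := h1 M; exists C => z sz hz; rewrite -FG //; exact: hC.
- by move=> M; have [C hC] := h1 M; exists C => z sz hz; rewrite -FG //; exact: hC.
move=> p q pq; have [D [dD eD]] := h2 p q pq; exists D; split => // z1 x y z2 s1 s2.
by rewrite -!FG ?size_cat /= ?s1 ?s2 //; exact: eD.
Qed.

(** Spectral sums of product functions factor. *)
Lemma Phi_prod (A Z : 'M[K]_n) (s t : {perm 'I_n}) (r1 r2 : seq 'I_n)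
  (k l : R -> R) (c : R) :
  Phi ([seq (A, m, s m) | m <- r1] ++ [seq (Z, m, t m) | m <- r2])
    (fun z => c * \prod_(u <- take (size r1) z) k u * \prod_(u <- drop (size r1) z) l u) =
  c%:K * \prod_(m <- r1) spm (dia A) (fun j => (k (eig A j))%:K) m (s m) *
         \prod_(m <- r2) spm (dia Z) (fun j => (l (eig Z j))%:K) m (t m).
Proof.
elim: r1 c => [|m r1 IH] c /=; last first.
  rewrite big_cons spmE mulrA mulr_sumr !mulr_suml; apply: eq_bigr => j _.
  transitivity (Num.conj (dia A j m) * dia A j (s m) *
    ((c * k (eig A j))%:K * \prod_(m0 <- r1) spm (dia A) (fun j0 => (k (eig A j0))%:K) m0 (s m0) *
     \prod_(m0 <- r2) spm (dia Z) (fun j0 => (l (eig Z j0))%:K) m0 (t m0))).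
    rewrite -IH; congr (_ * _); apply: Phi_ext => z _ /=.
    by rewrite big_cons mulrA.
  by rewrite rmorphM /=; ring.
rewrite big_nil mulr1.
transitivity (Phi [seq (Z, m, t m) | m <- r2] (fun z => c * \prod_(u <- z) l u)).
  by apply: Phi_ext => z _; rewrite take0 drop0 big_nil mulr1.
elim: r2 c => [|m r2 IH] c /=; first by rewrite !big_nil !mulr1.
rewrite big_cons spmE mulrA mulr_sumr !mulr_suml; apply: eq_bigr => j _.
transitivity (Num.conj (dia Z j m) * dia Z j (t m) *
   ((c * l (eig Z j))%:K * \prod_(m0 <- r2) spm (dia Z) (fun j0 => (l (eig Z j0))%:K) m0 (t m0))).
  rewrite -IH; congr (_ * _); apply: Phi_ext => z _ /=.
  by rewrite big_cons mulrA.
by rewrite rmorphM /=; ring.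
Qed.

Variables (g : R -> R -> R) (k l : R -> R -> R -> R).
Hypothesis dd_g : forall m (I : eqType) (i j : I), i != j ->
  dd m (fun x => g (x i) (x j)).
Hypothesis dd_k : forall m (I : eqType) (u i j : I), u != i -> u != j -> i != j ->
  dd m (fun x => k (x u) (x i) (x j)).
Hypothesis dd_l : forall m (I : eqType) (u i j : I), u != i -> u != j -> i != j ->
  dd m (fun x => l (x u) (x i) (x j)).
Variable L : bool -> 'M[K]_n -> 'M[K]_n.
Hypothesis hL : forall b, herm_linear (L b).

(** The function [coef] with its variables in the order of the slots: an eigenvalue [y]
    of the second matrix, one [x] of the first, and then both spectra. *)
Definition coef_list (z : seq R) : R :=
  if z is y :: x :: zs then
    g x y * \prod_(t <- take n zs) k t x y * \prod_(t <- drop n zs) l t x y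
  else 0.

Lemma ddl_coef m : ddl m (n + n).+2 coef_list.
Proof.
pose i0 : 'I_(n + n).+2 := ord0; pose i1 : 'I_(n + n).+2 := lift ord0 ord0.
pose ia (t : 'I_n) : 'I_(n + n).+2 := @rshift 2 (n + n) (lshift n t).
pose ib (t : 'I_n) : 'I_(n + n).+2 := @rshift 2 (n + n) (rshift n t).
apply: (@ddl_ext _ _ (fun z => (fun x : 'I_(n + n).+2 -> R =>
  g (x i1) (x i0) * (\prod_(t <- enum 'I_n) k (x (ia t)) (x i1) (x i0)) *
  (\prod_(t <- enum 'I_n) l (x (ib t)) (x i1) (x i0))) (fun i => nth 0 z i))).
  move=> [|y [|x zs]] //= [szs]; rewrite !big_enum /=.
  have sz1 : size (take n zs) = n by rewrite size_takel // szs leq_addr.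
  have sz2 : size (drop n zs) = n by rewrite size_drop szs addnK.
  congr (_ * _ * _).
    rewrite [RHS](big_nth 0) sz1 big_mkord; apply: eq_bigr => t _.
    by rewrite nth_take.
  rewrite [RHS](big_nth 0) sz2 big_mkord; apply: eq_bigr => t _.
  by rewrite nth_drop.
apply: (dd_ddl (F := fun x : 'I_(n + n).+2 -> R =>
  g (x i1) (x i0) * (\prod_(t <- enum 'I_n) k (x (ia t)) (x i1) (x i0)) *
  (\prod_(t <- enum 'I_n) l (x (ib t)) (x i1) (x i0)))).
by apply: dd_mul; [apply: dd_mul; [exact: dd_g|]|]; apply: dd_prod => t;
  [apply: dd_k|apply: dd_l].
Qed.

(** A product of [k] over the spectrum of [A] is the determinant of [k] applied to [A].
    Expanding the determinants turns an entry of [term] into a finite sum of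
    spectral sums [Phi]. *)
Lemma term_smooth m a b : smoothM m (fun A =>
  term g k l (dia (L true A)) (eig (L true A)) (dia (L false A)) (eig (L false A)) a b).
Proof.
pose w c (s t : {perm 'I_n}) : seq (bool * 'I_n * 'I_n) :=
  [:: (false, a, c), (true, c, b) & [seq (true, i, s i) | i <- enum 'I_n] ++
                                    [seq (false, i, t i) | i <- enum 'I_n]].
apply: (smoothM_ext (F := fun A => \sum_c \sum_(s : {perm 'I_n}) \sum_(t : {perm 'I_n})
   ((-1) ^+ s * (-1) ^+ t) * Phi (slots_at L A (w c s t)) coef_list)); last first.
  apply: smoothM_sum => c _; apply: smoothM_sum => s _; apply: smoothM_sum => t _.
  apply: smoothM_scale; apply: Phi_smooth => //.
  have -> : size (w c s t) = (n + n).+2.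
    have e : size ([seq (true, i, s i) | i <- enum 'I_n] ++
       [seq (false, i, t i) | i <- enum 'I_n]) = (n + n)%N.
      rewrite size_cat !(size_map _ (enum 'I_n)).
      by rewrite -[X in (X + _)%N]cardE -[X in (_ + X)%N]cardE card_ord.
    exact: (congr1 (fun q => q.+2) e).
  exact: ddl_coef.
move=> A hA; rewrite /term dblE; apply: eq_bigr => c _.
have [hAt _ _ _] := hL true; have [hAf _ _ _] := hL false.
set B := L true A; set Z := L false A.
have hB : B^t* = B by exact: hAt.
have hZ : Z^t* = Z by exact: hAf.
transitivity (\sum_(s : {perm 'I_n}) \sum_(t : {perm 'I_n})
  \sum_i \sum_j Num.conj (dia Z i a) * dia Z i c * (Num.conj (dia B j c) * dia B j b *
   (((-1) ^+ s * (-1) ^+ t) * ((g (eig B j) (eig Z i))%:K *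
    \prod_m spm (dia B) (fun q => (k (eig B q) (eig B j) (eig Z i))%:K) m (s m) *
    \prod_m spm (dia Z) (fun q => (l (eig Z q) (eig B j) (eig Z i))%:K) m (t m))))).
  apply: eq_bigr => s _; apply: eq_bigr => t _.
  have -> : slots_at L A (w c s t) = [:: (Z, a, c), (B, c, b) &
    [seq (B, i, s i) | i <- enum 'I_n] ++ [seq (Z, i, t i) | i <- enum 'I_n]].
    by rewrite /slots_at /= map_cat -!map_comp.
  rewrite [Phi _ _]/= mulr_sumr; apply: eq_bigr => i _.
  rewrite mulrCA mulr_sumr mulr_sumr; apply: eq_bigr => j _.
  rewrite [X in _ * X = _]mulrCA; congr (_ * (_ * (_ * _))).
  have e (F : 'I_n -> K) : \prod_(m <- enum 'I_n) F m = \prod_m F m by rewrite big_enum.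
  have := Phi_prod B Z s t (enum 'I_n) (enum 'I_n) (fun u => k u (eig B j) (eig Z i))
    (fun u => l u (eig B j) (eig Z i)) (g (eig B j) (eig Z i)).
  by rewrite size_enum_ord !e.
rewrite exchange_big3; apply: eq_bigr => i _; rewrite exchange_big3.
rewrite mulr_sumr; apply: eq_bigr => j _.
transitivity (Num.conj (dia Z i a) * dia Z i c * (Num.conj (dia B j c) * dia B j b *
   ((g (eig B j) (eig Z i))%:K *
    \det (spm (dia B) (fun q => (k (eig B q) (eig B j) (eig Z i))%:K)) *
    \det (spm (dia Z) (fun q => (l (eig Z q) (eig B j) (eig Z i))%:K))))).
  transitivity (Num.conj (dia Z i a) * dia Z i c * (Num.conj (dia B j c) * dia B j b *
   (\sum_(s : {perm 'I_n}) \sum_(t : {perm 'I_n})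
   ((-1) ^+ s * (-1) ^+ t) * ((g (eig B j) (eig Z i))%:K *
    \prod_m spm (dia B) (fun q => (k (eig B q) (eig B j) (eig Z i))%:K) m (s m) *
    \prod_m spm (dia Z) (fun q => (l (eig Z q) (eig B j) (eig Z i))%:K) m (t m))))).
    rewrite [in RHS]mulrA [RHS]mulr_sumr; apply: eq_bigr => s _.
    by rewrite [RHS]mulr_sumr; apply: eq_bigr => t _; rewrite -!mulrA.
  by rewrite det_mul_sum.
rewrite !det_spm ?dia_unitary // /coef !rmorphM !rmorph_prod /=.
by congr (_ * _).
Qed.

End TermSmooth.

Section PhiSmooth.
Variables (R : realType) (K : complexes R).

Lemma dd_ext m (I : eqType) (F G : (I -> R) -> R) : F =1 G -> dd m F -> dd m G.
Proof. by move=> /funext ->. Qed.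

Lemma dd_expdd2 m (I : eqType) (i j : I) : i != j ->
  dd m (fun x => expdd [:: x i; x j] : R).
Proof.
move=> ij; apply: (dd_expdd m [::] (s := [:: i; j])).
by rewrite /= inE ij.
Qed.

Lemma box_pos_expdd2 (I : eqType) (i j : I) :
  box_pos (fun x : I -> R => expdd [:: x i; x j]).
Proof.
by move=> M; exists (expR (- M)); [exact: expR_gt0|move=> x hx; exact: expdd2_gt].
Qed.

Lemma box_pos_sh (I : eqType) (i j : I) : box_pos (fun x : I -> R => sh (x i) (x j)).
Proof. by apply: box_pos_sqrt; exact: box_pos_expdd2. Qed.

Lemma box_pos_expdd2_0 (I : eqType) (j : I) :
  box_pos (fun x : I -> R => expdd [:: 0; x j]).
Proof.
move=> M; exists (expR (- `|M|)); [exact: expR_gt0|move=> x hx; apply: expdd2_gt].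
  by rewrite normr0.
exact: le_trans (hx j) (ler_norm M).
Qed.

Lemma box_pos_sh0 (I : eqType) (j : I) : box_pos (fun x : I -> R => sh 0 (x j)).
Proof. by apply: box_pos_sqrt; exact: box_pos_expdd2_0. Qed.

Lemma dd_sh m (I : eqType) (i j : I) : i != j -> dd m (fun x : I -> R => sh (x i) (x j)).
Proof.
move=> ij; apply: dd_sqrt; [by move=> x; exact: expdd2_gt0| |exact: dd_expdd2].
exact: box_pos_expdd2.
Qed.

Lemma dd_sh0 m (I : eqType) (j : I) : dd m (fun x : I -> R => sh 0 (x j)).
Proof.
apply: dd_sqrt; [by move=> x; exact: expdd2_gt0|exact: box_pos_expdd2_0|].
exact: (dd_expdd m [:: 0] (s := [:: j])).
Qed.

Lemma dd_expR m (I : eqType) (i : I) : dd m (fun x : I -> R => expR (x i)).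
Proof.
apply: dd_ext (dd_expdd m [::] (s := [:: i]) _) => // x /=.
exact: expdd1.
Qed.

Lemma dd_se m (I : eqType) (i : I) : dd m (fun x : I -> R => se (x i)).
Proof.
apply: dd_sqrt; [by move=> x; exact: expR_gt0| |exact: dd_expR].
move=> M; exists (expR (- M)); [exact: expR_gt0|move=> x hx].
by rewrite ler_expR; have := hx i; rewrite ler_norml => /andP[].
Qed.

Lemma dd_shV m (I : eqType) (i j : I) : i != j ->
  dd m (fun x : I -> R => (sh (x i) (x j))^-1).
Proof.
by move=> ij; apply: dd_inv; [move=> x; exact: sh_gt0|exact: box_pos_sh|exact: dd_sh].
Qed.

Lemma dd_sh0V m (I : eqType) (j : I) : dd m (fun x : I -> R => (sh 0 (x j))^-1).
Proof.
by apply: dd_inv; [move=> x; exact: sh_gt0|exact: box_pos_sh0|exact: dd_sh0].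
Qed.

Lemma dd_g_up m (I : eqType) (i j : I) : i != j ->
  dd m (fun x : I -> R => g_up (x i) (x j)).
Proof.
move=> ij; apply: dd_mul; first by apply: dd_mul; [apply: dd_mul; exact: dd_se|exact: dd_sh0].
apply: dd_inv; first by move=> x; rewrite mulr_gt0 ?sh_gt0 ?expdd2_gt0.
  by apply: box_pos_mul; [exact: box_pos_sh0|exact: box_pos_expdd2].
by apply: dd_mul; [exact: dd_sh0|exact: dd_expdd2].
Qed.

Lemma dd_k_up m (I : eqType) (u i j : I) : u != i -> u != j -> i != j ->
  dd m (fun x : I -> R => k_up (x u) (x i) (x j)).
Proof. by move=> ui uj _; apply: dd_mul; [exact: dd_sh|exact: dd_shV]. Qed.

Lemma dd_l_up m (I : eqType) (u i j : I) : u != i -> u != j -> i != j ->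
  dd m (fun x : I -> R => l_up (x u) (x i) (x j)).
Proof. by move=> ui uj _; apply: dd_mul; [exact: dd_sh|exact: dd_shV]. Qed.

Lemma dd_g_low m (I : eqType) (i j : I) : i != j ->
  dd m (fun x : I -> R => g_low (x i) (x j)).
Proof. by move=> ij; apply: dd_mul; [exact: dd_se|exact: dd_sh0V]. Qed.

Lemma dd_k_low m (I : eqType) (u i j : I) : u != i -> u != j -> i != j ->
  dd m (fun x : I -> R => k_low (x u) (x i) (x j)).
Proof. by move=> ui _ _; exact: dd_shV. Qed.

Lemma dd_l_low m (I : eqType) (u i j : I) : u != i -> u != j -> i != j ->
  dd m (fun x : I -> R => l_low (x u) (x i) (x j)).
Proof. by move=> ui _ _; exact: dd_sh. Qed.

Lemma herm_linear_id n : herm_linear (fun A : 'M[K]_n => A).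
Proof. by []. Qed.

Lemma addZE n p (X Y : 'M[K]_(n, p)) c i j : (X + c *: Y) i j = X i j + c * Y i j.
Proof. by rewrite !mxE. Qed.

Lemma herm_linear_cor n : herm_linear (fun A : 'M[K]_n.+1 => cor A).
Proof.
split=> [A hA|M A M0 hA i j|d A B [d0 hAB]|A H t].
- by rewrite cor_adj hA.
- by rewrite corE.
- by split => // i j; rewrite !corE.
- by apply/matrixP => i j; rewrite addZE !corE addZE.
Qed.

Lemma herm_linear_up0 n : herm_linear (fun A : 'M[K]_n.+1 => up 0 (cor A)).
Proof.
split=> [A hA|M A M0 hA|d A B [d0 hAB]|A H t].
- exact: up0_herm.
- by apply: ord_wid_ind => [i|]; apply: ord_wid_ind => [j|];
     rewrite upE ?corE ?cxmod0.
- split => //; apply: ord_wid_ind => [i|]; apply: ord_wid_ind => [j|];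
     by rewrite !upE ?corE ?subrr ?cxmod0.
- by apply: eq_up => [i j|i|i|]; rewrite addZE !upE ?corE ?addZE ?mulr0 ?addr0.
Qed.

Lemma smoothM_mulmx n m p (F G : 'M[K]_n -> 'M[K]_p) a b :
  (forall a b, smoothM m (fun A => F A a b)) ->
  (forall a b, smoothM m (fun A => G A a b)) ->
  smoothM m (fun A => (F A *m G A) a b).
Proof.
move=> hF hG; apply: (smoothM_ext (F := fun A => \sum_c F A a c * G A c b)).
  by move=> A _; rewrite mxE.
by apply: smoothM_sum => c _; apply: smoothM_mul.
Qed.

Lemma phi_smooth n m a b : smoothM m (fun A : 'M[K]_n.+1 => phi A a b).
Proof.
pose L (b : bool) (A : 'M[K]_n.+1) := if b then A else up 0 (cor A).
have hL c : herm_linear (L c).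
  by case: c; [exact: herm_linear_id|exact: herm_linear_up0].
have h : smoothM m (fun A : 'M[K]_n.+1 =>
   (\sum_c (up 0 1%:M : 'M[K]_n.+1) a c * term (@g_up R) (@k_up R) (@l_up R) (dia (L true A))
      (eig (L true A)) (dia (L false A)) (eig (L false A)) c b) +
   (\sum_c (up 1 0 : 'M[K]_n.+1) a c * term (@g_low R) (@k_low R) (@l_low R) (dia (L true A))
      (eig (L true A)) (dia (L false A)) (eig (L false A)) c b)).
  apply: smoothM_add; apply: smoothM_sum => c _; apply: smoothM_scale.
    apply: term_smooth => //; [exact: dd_g_up|exact: dd_k_up|exact: dd_l_up].
  apply: term_smooth => //; [exact: dd_g_low|exact: dd_k_low|exact: dd_l_low].
apply: smoothM_ext h => A _; rewrite /phi /phi_of.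
by rewrite [RHS]mxE [X in _ = X + _]mxE [X in _ = _ + X]mxE.
Qed.

(** The exponential by functional calculus; [expmx_spmr] compares it with the power
    series. *)
Definition expH n (A : 'M[K]_n) : 'M[K]_n := spm (dia A) (fun i => (expR (eig A i))%:K).

Lemma expH_smooth n m a b : smoothM m (fun A : 'M[K]_n => expH A a b).
Proof.
apply: (smoothM_ext (F := fun A => Phi (slots_at (fun _ A => A) A [:: (true, a, b)])
   (fun z => expR (nth 0 z 0)))).
  by move=> A _; rewrite /expH spmE.
apply: Phi_smooth; first by move=> _; exact: herm_linear_id.
exact: (dd_ddl (dd_expR m.+1 (ord0 : 'I_1))).
Qed.

End PhiSmooth.

(** * Lagrange interpolation and Cauchy matrices *)

Section Lagrange.
Variables (F : fieldType) (n : nat) (x : 'I_n.+1 -> F) (y : 'I_n -> F).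
Hypothesis inj_x : injective x.

Definition lag j : {poly F} := \prod_(k | k != j) ('X - (x k)%:P).

Lemma size_lag j : size (lag j) = n.+1.
Proof.
have -> : lag j = \prod_(k <- enum (predC1 j)) ('X - (x k)%:P) by rewrite big_enum.
by rewrite size_prod_XsubC -cardE cardC1 card_ord.
Qed.

Lemma lag_monic j : lag j \is monic.
Proof. exact: monic_prod_XsubC. Qed.

Lemma lagE j t : (lag j).[t] = \prod_(k | k != j) (t - x k).
Proof. by rewrite horner_prod; apply: eq_bigr => k _; rewrite hornerXsubC. Qed.

Lemma lag_root j k : k != j -> (lag j).[x k] = 0.
Proof. by move=> kj; rewrite lagE (bigD1 k) //= subrr mul0r. Qed.

Lemma lag_neq0 j : (lag j).[x j] != 0.
Proof.
rewrite lagE; apply/prodf_neq0 => k kj; rewrite subr_eq0.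
by apply: contra kj => /eqP /inj_x ->.
Qed.

Lemma lag_coef j : (lag j)`_n = 1.
Proof. by have /monicP := lag_monic j; rewrite lead_coefE size_lag. Qed.

Lemma poly_eq_on m (z : 'I_m -> F) (p q : {poly F}) : injective z ->
  (size (p - q)%R <= m)%N -> (forall i, p.[z i] = q.[z i]) -> p = q.
Proof.
move=> inj_z sz h; apply/eqP; rewrite -subr_eq0; apply/eqP.
apply: (@roots_geq_poly_eq0 _ _ [seq z i | i <- enum 'I_m]).
- apply/allP => t /mapP[i _ ->]; rewrite rootE hornerD hornerN h subrr eqxx //.
- by rewrite map_inj_uniq // enum_uniq.
- by rewrite size_map size_enum_ord.
Qed.

Lemma lagrange_sum (p : {poly F}) : (size p <= n.+1)%N ->
  p = \sum_j (p.[x j] / (lag j).[x j]) *: lag j.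
Proof.
move=> sp; apply: (poly_eq_on inj_x) => [|i].
  apply: (leq_trans (size_polyD _ _)); rewrite size_polyN geq_max sp /=.
  apply: (leq_trans (size_sum _ _ _)); apply/bigmax_leqP => j _.
  by apply: (leq_trans (size_scale_leq _ _)); rewrite size_lag.
rewrite horner_sum (bigD1 i) //= big1 ?addr0 => [|j ji].
  by rewrite hornerZ mulfVK // lag_neq0.
have ij : i != j by rewrite eq_sym.
by rewrite hornerZ (lag_root ij) mulr0.
Qed.

(** The residues of the rational function with zeros [y] and poles [x], that is, of the
    quotient of [yprod] by the product of all [t - x j]. *)
Definition weight j := (\prod_i (x j - y i)) / \prod_(k | k != j) (x j - x k).

Definition yprod : {poly F} := \prod_i ('X - (y i)%:P).

Lemma yprodE t : yprod.[t] = \prod_i (t - y i).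
Proof. by rewrite horner_prod; apply: eq_bigr => k _; rewrite hornerXsubC. Qed.

Lemma size_yprod : size yprod = n.+1.
Proof.
have -> : yprod = \prod_(k <- enum 'I_n) ('X - (y k)%:P) by rewrite big_enum.
by rewrite size_prod_XsubC -cardE card_ord.
Qed.

Lemma yprod_coef : yprod`_n = 1.
Proof.
have /monicP : yprod \is monic by exact: monic_prod_XsubC.
by rewrite lead_coefE size_yprod.
Qed.

(** Lagrange interpolation of [yprod] at the points [x]; evaluating this identity at
    points [y i] and comparing leading coefficients gives the sums below. *)
Lemma yprod_weight : yprod = \sum_j weight j *: lag j.
Proof.
rewrite [LHS]lagrange_sum ?size_yprod //.
by apply: eq_bigr => j _; rewrite /weight yprodE lagE.
Qed.

Lemma weight_sum : \sum_j weight j = 1.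
Proof.
rewrite -yprod_coef [in RHS]yprod_weight coef_sum; apply: eq_bigr => j _.
by rewrite coefZ lag_coef mulr1.
Qed.

Hypothesis xy : forall j i, x j != y i.

Lemma lag_split j t : (forall k, t != x k) ->
  (lag j).[t] = (\prod_k (t - x k)) / (t - x j).
Proof.
move=> ht; rewrite lagE [in RHS](bigD1 j) //= mulrAC mulfV ?mul1r //.
by rewrite subr_eq0 ht.
Qed.

Lemma prod_yx_neq0 i : \prod_k (y i - x k) != 0.
Proof. by apply/prodf_neq0 => k _; rewrite subr_eq0 eq_sym xy. Qed.

Lemma weight_pole i : \sum_j weight j / (x j - y i) = 0.
Proof.
have : yprod.[y i] = 0 by rewrite yprodE (bigD1 i) //= subrr mul0r.
rewrite yprod_weight horner_sum => h.
apply: (mulIf (prod_yx_neq0 i)); rewrite mul0r.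
transitivity (- \sum_j (weight j *: lag j).[y i]); last by rewrite h oppr0.
rewrite mulr_suml -sumrN; apply: eq_bigr => j _; rewrite hornerZ lag_split; last by move=> k; rewrite eq_sym.
by rewrite -(opprB (x j)) invrN; ring.
Qed.

Definition yrest i : {poly F} := \prod_(m | m != i) ('X - (y m)%:P).

Lemma yrestE i t : (yrest i).[t] = \prod_(m | m != i) (t - y m).
Proof. by rewrite horner_prod; apply: eq_bigr => k _; rewrite hornerXsubC. Qed.

Lemma yrest_weight i t : (forall k, t != x k) ->
  \prod_(m | m != i) (t - y m) =
  - (\prod_k (t - x k)) * \sum_j weight j / ((x j - y i) * (x j - t)).
Proof.
move=> ht; rewrite -yrestE [yrest i]lagrange_sum; last first.
  have -> : yrest i = \prod_(k <- enum (predC1 i)) ('X - (y k)%:P) by rewrite big_enum.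
  rewrite size_prod_XsubC ltnS -cardE.
  by apply: leq_trans (max_card _) _; rewrite card_ord.
rewrite horner_sum mulr_sumr; apply: eq_bigr => j _.
rewrite hornerZ (lag_split j ht) yrestE /weight lagE [in RHS](bigD1 i) //=.
have h1 : x j - y i != 0 by rewrite subr_eq0.
have h2 : t - x j != 0 by rewrite subr_eq0.
rewrite -(opprB t) invfM invrN.
have -> : (x j - y i) * \prod_(i0 | i0 != i) (x j - y i0) / \prod_(k | k != j) (x j - x k) *
   ((x j - y i)^-1 * - (t - x j)^-1) =
   ((x j - y i) * (x j - y i)^-1) * (\prod_(i0 | i0 != i) (x j - y i0) / \prod_(k | k != j) (x j - x k)) *
   (- (t - x j)^-1) by ring.
by rewrite mulfV // mul1r; ring.
Qed.

Lemma weight_pole2 i k : i != k ->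
  \sum_j weight j / ((x j - y i) * (x j - y k)) = 0.
Proof.
move=> ik; have := yrest_weight i (t := y k) (fun j => _).
have hy j : y k != x j by rewrite eq_sym.
move=> /(_ hy); rewrite (bigD1 k) /=; last by rewrite eq_sym.
rewrite subrr mul0r mulNr => /eqP; rewrite eq_sym oppr_eq0 mulf_eq0.
by rewrite (negbTE (prod_yx_neq0 k)) /= => /eqP.
Qed.

Lemma weight_pole_sqr i :
  (\prod_k (y i - x k)) * \sum_j weight j / ((x j - y i) * (x j - y i)) =
  - \prod_(m | m != i) (y i - y m).
Proof.
have hy j : y i != x j by rewrite eq_sym.
by rewrite (yrest_weight i hy); ring.
Qed.

Hypothesis inj_y : injective y.

(** Both families interpolate monic polynomials of degree [n] with the roots [y]. *)
Lemma weight_unique (w : 'I_n.+1 -> F) : \sum_j w j = 1 ->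
  (forall i, \sum_j w j / (x j - y i) = 0) -> w =1 weight.
Proof.
move=> w1 wy.
pose N : {poly F} := \sum_j w j *: lag j.
have sN : (size N <= n.+1)%N.
  apply: (leq_trans (size_sum _ _ _)); apply/bigmax_leqP => j _.
  by apply: (leq_trans (size_scale_leq _ _)); rewrite size_lag.
have eN : N = yprod.
  apply: (poly_eq_on inj_y) => [|i].
    have sD : (size (N - yprod)%R <= n.+1)%N.
      by apply: (leq_trans (size_polyD _ _)); rewrite size_polyN geq_max sN size_yprod leqnn.
    apply/leq_sizeP => m; rewrite leq_eqVlt => /orP[/eqP <-|hm]; last first.
      by apply: nth_default; exact: leq_trans sD hm.
    rewrite coefB yprod_coef coef_sum -w1 -sumrB big1 // => j _.
    by rewrite coefZ lag_coef mulr1 subrr.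
  rewrite yprodE (bigD1 i) //= subrr mul0r horner_sum.
  have -> : \sum_j (w j *: lag j).[y i] = - (\prod_k (y i - x k)) * \sum_j w j / (x j - y i).
    rewrite mulr_sumr; apply: eq_bigr => j _.
    rewrite hornerZ lag_split; last by move=> k; rewrite eq_sym.
    by rewrite -(opprB (x j)) invrN; ring.
  by rewrite wy mulr0.
move=> j; have := congr1 (fun p => p.[x j]) eN.
rewrite /N horner_sum (bigD1 j) //= big1 ?addr0 => [|k kj]; last first.
  have jk : j != k by rewrite eq_sym.
  by rewrite hornerZ (lag_root jk) mulr0.
by rewrite hornerZ yprodE => h; rewrite /weight -lagE -h mulfK ?lag_neq0.
Qed.

End Lagrange.

Section CauchyMatrix.
Variables (C : numClosedFieldType) (n : nat).
Variables (x : 'I_n.+1 -> C) (y : 'I_n -> C) (v : 'I_n.+1 -> C) (b : 'I_n -> C).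
Hypothesis real_x : forall j, Num.conj (x j) = x j.
Hypothesis real_y : forall i, Num.conj (y i) = y i.
Hypothesis inj_x : injective x.
Hypothesis xy : forall j i, x j != y i.
Hypothesis hv : forall j, v j * Num.conj (v j) = weight x y j.
Hypothesis hb : forall i, b i * Num.conj (b i) *
  \sum_j weight x y j / ((x j - y i) * (x j - y i)) = 1.
Variable M : 'M[C]_n.+1.
Hypothesis hM1 : forall i j, M (wid i) j = b i * v j / (x j - y i).
Hypothesis hM2 : forall j, M ord_max j = v j.

Lemma cauchy_row_max : \sum_j M ord_max j * Num.conj (M ord_max j) = 1.
Proof.
by rewrite -(weight_sum y inj_x); apply: eq_bigr => j _; rewrite hM2 hv.
Qed.

Lemma conj_M i j : Num.conj (M (wid i) j) = Num.conj (b i) * Num.conj (v j) / (x j - y i).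
Proof. by rewrite hM1 !rmorphM fmorphV rmorphB /= real_x real_y. Qed.

Lemma cauchy_row_mixed i : \sum_j M ord_max j * Num.conj (M (wid i) j) = 0.
Proof.
transitivity (Num.conj (b i) * \sum_j weight x y j / (x j - y i)); last first.
  by rewrite (weight_pole inj_x xy) mulr0.
rewrite mulr_sumr; apply: eq_bigr => j _.
by rewrite hM2 conj_M -hv; ring.
Qed.

Lemma cauchy_row i k :
  \sum_j M (wid i) j * Num.conj (M (wid k) j) = (i == k)%:R.
Proof.
have -> : \sum_j M (wid i) j * Num.conj (M (wid k) j) = b i * Num.conj (b k) *
   \sum_j weight x y j / ((x j - y i) * (x j - y k)).
  rewrite mulr_sumr; apply: eq_bigr => j _; rewrite conj_M hM1 -hv invfM; ring.
by case: (eqVneq i k) => [<-|ik]; [rewrite hb|rewrite weight_pole2 ?mulr0].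
Qed.

(** The sums of [weight] over poles say that the rows are orthonormal. *)
Lemma cauchy_unitary : M \is unitarymx.
Proof.
apply/unitarymxP; apply: eq_up => [i j|i|i|]; rewrite !mxE;
  under eq_bigr => l _ do rewrite adjE.
- by rewrite cauchy_row (inj_eq (@wid_inj n)).
- rewrite wid_neq_max; have := congr1 Num.conj (cauchy_row_mixed i).
  rewrite rmorph0 rmorph_sum /= => h; rewrite -[RHS]h.
  by apply: eq_bigr => j _; rewrite rmorphM /= conjCK mulrC.
- by rewrite cauchy_row_mixed max_neq_wid.
- by rewrite cauchy_row_max eqxx.
Qed.

(** Writing [x j = y i + (x j - y i)] reduces the claim to orthonormality of the rows. *)
Lemma cauchy_corner :
  cor (M *m diag_mx (\row_j x j) *m M^t* ) = diag_mx (\row_i y i).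
Proof.
apply/matrixP => i k; rewrite corE mxE.
have -> : \sum_j (M *m diag_mx (\row_j x j)) (wid i) j * M^t* j (wid k) =
  y i * (\sum_j M (wid i) j * Num.conj (M (wid k) j)) +
  b i * (\sum_j M ord_max j * Num.conj (M (wid k) j)).
  rewrite !mulr_sumr -big_split /=; apply: eq_bigr => j _.
  rewrite mul_mx_diag !mxE hM2 (hM1 i j).
  have h : x j - y i != 0 by rewrite subr_eq0.
  move: (Num.conj _) => z; field.
  by [].
by rewrite cauchy_row cauchy_row_mixed mulr0 addr0 !mxE mulr_natr.
Qed.

End CauchyMatrix.

(** * Bordered Hermitian matrices *)

Section Bordered.
Variables (R : realType) (K : complexes R) (n : nat).
Variable A : 'M[K]_n.+1.
Hypothesis hA : A^t* = A.

Definition interlaced := forall i : 'I_n,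
  eig A (wid i) < eig (cor A) i < eig A (lift ord0 i).

Local Notation x := (eig A).
Local Notation y := (eig (cor A)).
Local Notation U := (dia A).
Local Notation V := (up 1 (dia (cor A))).

Lemma herm_cor : (cor A)^t* = cor A.
Proof. by rewrite cor_adj hA. Qed.

Lemma unitary_border : (V : 'M[K]_n.+1) \is unitarymx.
Proof.
apply: up_unitary; first exact: dia_unitary herm_cor.
by rewrite rmorph1 mulr1.
Qed.

(** [A] in a basis that diagonalizes its corner. *)
Definition arrow : 'M[K]_n.+1 := V *m A *m V^t*.
(** The eigenvectors of [arrow]. *)
Definition link : 'M[K]_n.+1 := V *m U^t*.
Definition border i : K := arrow (wid i) ord_max.

Lemma link_unitary : link \is unitarymx.
Proof.
apply: unitaryM; first exact: unitary_border.
by apply: unitaryV; exact: dia_unitary.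
Qed.

Lemma link_row a c : \sum_j link a j * Num.conj (link c j) = (a == c)%:R.
Proof.
have /matrixP /(_ a c) := unitary_mulV link_unitary; rewrite !mxE => <-.
by apply: eq_bigr => j _; rewrite adjE.
Qed.

Lemma arrow_link : arrow *m link = link *m diag_mx (\row_j (x j)%:K).
Proof.
rewrite /arrow /link !mulmxA -(mulmxA _ (V^t* )) (unitary_mulVl unitary_border).
by rewrite mulmx1 -!mulmxA (mul_dia_adj hA).
Qed.

Lemma arrow_herm : arrow^t* = arrow.
Proof. by rewrite /arrow !adjM trmxCK hA mulmxA. Qed.

Lemma arrow_cor : cor arrow = diag_mx (\row_i (y i)%:K).
Proof.
rewrite /arrow up_adj cor_upr cor_upl -{2}(dia_eq herm_cor).
by rewrite mul_spm_diag // dia_unitary // herm_cor.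
Qed.

Lemma arrow_ww i k : arrow (wid i) (wid k) = if i == k then (y i)%:K else 0.
Proof. by rewrite -corE arrow_cor !mxE; case: eqP => [->|]; rewrite ?mulr1n ?mulr0n. Qed.

(** The eigenvector equation of an arrow matrix, which exhibits [link] as a Cauchy
    matrix; see [link_wid]. *)
Lemma link_eq i j : ((x j)%:K - (y i)%:K) * link (wid i) j = border i * link ord_max j.
Proof.
have /matrixP /(_ (wid i) j) := arrow_link; rewrite mul_mx_diag [RHS]mxE.
rewrite mxE sum_wid (bigD1 i) //= big1 => [|k ki].
  by rewrite arrow_ww eqxx addr0 [(\row_j _) _ _]mxE -/(border i) => h; rewrite mulrBl [X in X - _]mulrC -h; ring.
by rewrite arrow_ww eq_sym (negbTE ki) mul0r.
Qed.

Lemma link_eq_max j : \sum_i Num.conj (border i) * link (wid i) j +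
  arrow ord_max ord_max * link ord_max j = (x j)%:K * link ord_max j.
Proof.
have /matrixP /(_ ord_max j) := arrow_link; rewrite mul_mx_diag [RHS]mxE.
rewrite mxE sum_wid [(\row_j _) _ _]mxE => h; rewrite [RHS]mulrC -h; congr (_ + _).
by apply: eq_bigr => i _; rewrite -[in RHS]arrow_herm adjE.
Qed.

Lemma link_col_neq0 j : exists a, link a j != 0.
Proof.
apply/not_existsP => h.
have := unitary_mulVl link_unitary => /matrixP /(_ j j).
rewrite !mxE eqxx big1 => [/eqP|a _]; first by rewrite eq_sym oner_eq0.
have /negP := h a; rewrite negbK => /eqP ->.
by rewrite mulr0.
Qed.

Lemma eig_neq_border i j : injective y -> border i != 0 -> x j != y i.
Proof.
move=> inj_y hb; apply/eqP => xy.
have wm : link ord_max j = 0.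
  apply: (mulfI hb); rewrite mulr0 -link_eq xy subrr mul0r //.
have wk k : k != i -> link (wid k) j = 0.
  move=> ki; have h := link_eq k j; rewrite wm mulr0 in h.
  have hk : (x j)%:K - (y k)%:K != 0 :> K.
    rewrite subr_eq0; apply: contra ki => /eqP /inj_ofR; rewrite xy => /inj_y ->.
    by rewrite eqxx.
  by apply: (mulfI hk); rewrite h mulr0.
have [a] := link_col_neq0 j; apply/negP; rewrite negbK; apply/eqP.
move: a; apply: ord_wid_ind => [k|//].
have [->|/wk //] := eqVneq k i.
have := link_eq_max j; rewrite wm !mulr0 addr0 (bigD1 i) //= big1 => [|k' /wk ->]; last by rewrite mulr0.
rewrite addr0 => /eqP; rewrite mulf_eq0 conjC_eq0 (negbTE hb) /= => /eqP.
by [].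
Qed.

Lemma border_neq0 i : (forall j, x j != y i) -> border i != 0.
Proof.
move=> xy; apply/eqP => b0; have := link_row (wid i) (wid i); rewrite eqxx big1.
  by move/eqP; rewrite eq_sym oner_eq0.
move=> j _; have h := link_eq i j; rewrite b0 mul0r in h.
have hk : (x j)%:K - (y i)%:K != 0 :> K.
  by rewrite subr_eq0; apply: contra (xy j) => /eqP /inj_ofR ->.
have -> : link (wid i) j = 0 by apply: (mulfI hk); rewrite h mulr0.
by rewrite mul0r.
Qed.

(** The squared moduli of the last coordinates of the eigenvectors; they turn out to be
    the weights of the two spectra, see [om_weight]. *)
Definition om j : R := cxmod (link ord_max j) ^+ 2.

Lemma omE j : (om j)%:K = link ord_max j * Num.conj (link ord_max j).
Proof. exact: cxmod_sqr. Qed.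

Lemma om_ge0 j : 0 <= om j. Proof. exact: sqr_ge0. Qed.

Lemma om_sum : \sum_j om j = 1.
Proof.
apply: (@inj_ofR R K); rewrite rmorph_sum rmorph1 /=.
have := link_row ord_max ord_max; rewrite eqxx => h; rewrite -[RHS]h.
by apply: eq_bigr => j _; rewrite omE.
Qed.

Section Generic.
Hypothesis xy : forall j i, x j != y i.

Lemma xyK j i : (x j)%:K - (y i)%:K != 0 :> K.
Proof. by rewrite subr_eq0; apply: contra (xy j i) => /eqP /inj_ofR ->. Qed.

Lemma link_wid i j : link (wid i) j = border i * link ord_max j / ((x j)%:K - (y i)%:K).
Proof. by rewrite -link_eq mulrC mulKf // xyK. Qed.

Lemma om_pole i : \sum_j om j / (x j - y i) = 0.
Proof.
apply: (@inj_ofR R K); rewrite rmorph_sum rmorph0 /=.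
have := link_row (wid i) ord_max; rewrite wid_neq_max => h.
apply: (mulfI (border_neq0 (fun j => xy j i))); rewrite mulr0 -[RHS]h mulr_sumr.
apply: eq_bigr => j _; rewrite link_wid rmorphM /= omE fmorphV rmorphB /=; ring.
Qed.

Lemma om_pole2 i k : border i * Num.conj (border k) *
  (\sum_j om j / ((x j - y i) * (x j - y k)))%:K = (i == k)%:R.
Proof.
have := link_row (wid i) (wid k); rewrite (inj_eq (@wid_inj n)) => <-.
rewrite rmorph_sum mulr_sumr; apply: eq_bigr => j _.
have -> : (om j / ((x j - y i) * (x j - y k)))%:K =
  link ord_max j * Num.conj (link ord_max j) *
  (((x j)%:K - (y i)%:K)^-1 * ((x j)%:K - (y k)%:K)^-1).
  by rewrite rmorphM /= omE fmorphV rmorphM /= !rmorphB /= invfM.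
have -> : Num.conj (link (wid k) j) = Num.conj (border k) *
  Num.conj (link ord_max j) * ((x j)%:K - (y k)%:K)^-1.
  by rewrite link_wid !rmorphM fmorphV rmorphB /= !conjK.
by rewrite link_wid; ring.
Qed.

Lemma om_sign (c : 'I_n.+1 -> R) : \sum_j om j / c j = 0 -> exists j, c j <= 0.
Proof.
move=> h; apply/not_existsP => hc.
have c0 j : 0 < c j by rewrite ltNge; apply/negP; exact: hc.
have := om_sum; rewrite big1 => [/eqP|j _]; first by rewrite eq_sym oner_eq0.
have /eqP : om j / c j = 0.
  by apply: (psumr_eq0P _ h) => // k _; rewrite divr_ge0 ?om_ge0 // ltW.
by rewrite mulf_eq0 invr_eq0 (gt_eqF (c0 j)) orbF => /eqP.
Qed.

End Generic.

(** Orthogonality of the rows of [link] says that the sums of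
    [om j / (x j - y i)], and of [om j / ((x j - y i) * (x j - y k))] for [i != k],
    vanish. As [om] is nonnegative with sum 1, some summand is not positive: so
    there are eigenvalues [x j] below and above each [y i] and between any two of
    them. Counting then gives the strict inequalities. *)
Lemma interlaced_border : injective y -> (forall i, border i != 0) -> interlaced.
Proof.
move=> inj_y hb; have xy j i : x j != y i by exact: eig_neq_border.
have hx := eig_homo hA; have hy := eig_homo herm_cor.
have lty (i k : 'I_n) : (i < k)%N -> y i < y k.
  move=> ik; rewrite lt_neqAle hy ?(ltnW ik) // andbT.
  by apply/eqP => /inj_y e; rewrite e ltnn in ik.
have low i : exists j, x j < y i.
  have [j hj] := om_sign (c := fun j => x j - y i) (om_pole xy i).
  by exists j; rewrite lt_neqAle xy -subr_le0.
have high i : exists j, y i < x j.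
  have [|j hj] := @om_sign (fun j => y i - x j).
    have := om_pole xy i => /(congr1 -%R); rewrite oppr0 -sumrN => h.
    rewrite -[RHS]h; apply: eq_bigr => j _; rewrite -(opprB (x j)) invrN; ring.
  by exists j; rewrite lt_neqAle eq_sym xy -subr_le0.
have mid (i k : 'I_n) : (i < k)%N -> exists j, y i < x j < y k.
  move=> ik; have [|j hj] := @om_sign (fun j => (x j - y i) * (x j - y k)).
    have E : (i == k) = false by apply/eqP => e; rewrite e ltnn in ik.
    have := om_pole2 xy i k; rewrite E => /eqP.
    rewrite !mulf_eq0 conjC_eq0 (negbTE (hb i)) (negbTE (hb k)) /=.
    by rewrite -(rmorph0 (ofR K)) => /eqP /inj_ofR.
  exists j; have := lty _ _ ik.
  have : x j != y i by []. have : x j != y k by [].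
  rewrite !neq_lt => /orP[] h1 /orP[] h2 h3; rewrite ?h1 ?h2 ?andbT //.
  - by move: hj; rewrite leNgt nmulr_rgt0 subr_lt0 ?h1 ?h2.
  - by have := lt_trans (lt_trans h1 h2); lra.
  - by move: hj; rewrite leNgt mulr_gt0 ?subr_gt0.
move=> i; apply/andP; split.
  suff H m' (k : 'I_n) : k = m' :> nat -> x (wid k) < y k by exact: (H i).
  elim: m' k => [|m' IH] {}i im.
    have [j hj] := low i; apply: le_lt_trans hj; apply: (hx).
    by rewrite /= im.
  have hm : (m' < n)%N by apply: leq_trans (ltn_ord i); rewrite im.
  have h := IH (Ordinal hm) (erefl _).
  have [|j /andP[h1 h2]] := mid (Ordinal hm) i; first by rewrite im.
  apply: le_lt_trans h2; apply: (hx); rewrite /= im ltnNge; apply/negP => jm.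
  have : x j <= x (wid (Ordinal hm)) by apply: (hx).
  by move/(lt_le_trans h1); rewrite ltNge (ltW h).
suff H m (k : 'I_n) : (k + m).+1 = n -> y k < x (lift ord0 k).
  by apply: (H (n - i.+1)%N); rewrite -addSn subnKC.
elim: m k => [|m IH] {}i im.
  have [j hj] := high i; apply: lt_le_trans hj _; apply: (hx).
  have e : i.+1 = n by have := im; rewrite addn0.
  by rewrite lift0 e leq_ord.
have hm : (i.+1 < n)%N.
  by have := leq_addr m i.+1; rewrite -ltnS addSn -addnS im.
have im' : (Ordinal hm + m).+1 = n by rewrite /= addSn -addnS.
have h := IH _ im'.
have [|j /andP[h1 h2]] := mid i (Ordinal hm); first by [].
apply: lt_le_trans h1 _; apply: (hx); rewrite lift0.
rewrite leqNgt; apply/negP => jm.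
have : x (lift ord0 (Ordinal hm)) <= x j by apply: (hx); rewrite lift0.
by move=> /(lt_le_trans h); rewrite ltNge (ltW h2).
Qed.

End Bordered.

(** * The one-step conjugation for strictly interlacing spectra *)

Section PhiInterlaced.
Variables (R : realType) (K : complexes R) (n : nat).
Variable A : 'M[K]_n.+1.
Hypotheses (hA : A^t* = A) (iA : interlaced A).
Local Notation x := (eig A).
Local Notation y := (eig (cor A)).

Lemma eig_incr (i j : 'I_n.+1) : (i < j)%N -> x i < x j.
Proof.
move=> ij; have hi : (i < n)%N by apply: leq_trans ij _; rewrite -ltnS.
have /andP[h1 h2] := iA (Ordinal hi).
have e : i = wid (Ordinal hi) by exact: val_inj.
rewrite e; apply: lt_le_trans (lt_trans h1 h2) _.
by apply: (eig_homo hA); rewrite lift0.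
Qed.

Lemma eig_cor_incr (i j : 'I_n) : (i < j)%N -> y i < y j.
Proof.
move=> ij; have /andP[_ h1] := iA i; have /andP[h2 _] := iA j.
apply: lt_trans h1 _; apply: le_lt_trans h2.
by apply: (eig_homo hA); rewrite lift0.
Qed.

Lemma eig_inj : injective x.
Proof.
move=> i j e; apply: val_inj.
by case: (ltngtP i j) => // /eig_incr; rewrite e ltxx.
Qed.

Lemma eig_cor_inj : injective y.
Proof.
move=> i j e; apply: val_inj.
by case: (ltngtP i j) => // /eig_cor_incr; rewrite e ltxx.
Qed.

Lemma eig_neq j i : x j != y i.
Proof.
have /andP[h1 h2] := iA i; have [ji|ji] := leqP j i.
  by rewrite lt_eqF //; apply: le_lt_trans h1; apply: (eig_homo hA).
by rewrite gt_eqF //; apply: lt_le_trans h2 _; apply: (eig_homo hA); rewrite lift0.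
Qed.

(** The factors that rescale the border and the last coordinates of the eigenvectors
    when the spectra are replaced by their exponentials. *)
Definition alpha i : R :=
  se (y i) * (\prod_k sh (x k) (y i)) * (\prod_m sh (y m) (y i))^-1.
Definition kappa j : R :=
  se (x j) * (\prod_m sh (y m) (x j)) * (\prod_k sh (x k) (x j))^-1.

Lemma prod_sh_sqr (I : finType) (P : pred I) (f : I -> R) t :
  (\prod_(i | P i) sh (f i) t) ^+ 2 = \prod_(i | P i) expdd [:: t; f i].
Proof.
by rewrite -prodrXl; apply: eq_bigr => i _; rewrite sh_sqr expdd2C.
Qed.

Lemma prod_expdd_neq0 (I : finType) (P : pred I) (f : I -> R) t :
  \prod_(i | P i) expdd [:: t; f i] != 0.
Proof. by apply/prodf_neq0 => i _; rewrite gt_eqF // expdd2_gt0. Qed.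

Lemma sqr_quot (a b c : R) : (a * b * c^-1) ^+ 2 = a ^+ 2 * b ^+ 2 * (c ^+ 2)^-1.
Proof. by rewrite !exprMn exprVn. Qed.

Lemma kappa_sqr j : kappa j ^+ 2 * \prod_(k | k != j) expdd [:: x j; x k] =
  \prod_m expdd [:: x j; y m].
Proof.
rewrite /kappa sqr_quot !prod_sh_sqr se_sqr [X in _ * X^-1](bigD1 j) //=.
rewrite expddxx; have h := gt_eqF (expR_gt0 (x j)).
have := prod_expdd_neq0 (fun k => k != j) x (x j).
move: (\prod_(i | i != j) _) => p p0; field.
by rewrite h p0.
Qed.

Lemma alpha_sqr i : alpha i ^+ 2 * \prod_(m | m != i) expdd [:: y i; y m] =
  \prod_k expdd [:: y i; x k].
Proof.
rewrite /alpha sqr_quot !prod_sh_sqr se_sqr [X in _ * X^-1](bigD1 i) //=.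
rewrite expddxx; have h := gt_eqF (expR_gt0 (y i)).
have := prod_expdd_neq0 (fun k => k != i) y (y i).
move: (\prod_(i0 | i0 != i) _) => p p0; field.
by rewrite h p0.
Qed.

Definition yext (i : 'I_n.+1) : R := oapp y 0 (insub (val i) : option 'I_n).

Lemma insub_wid (i : 'I_n) : insub (val (wid i)) = Some i :> option 'I_n.
Proof. by rewrite insubT //= => h; congr Some; apply: val_inj. Qed.

Lemma insub_max : insub (val (ord_max : 'I_n.+1)) = None :> option 'I_n.
Proof. by rewrite insubF //= ltnn. Qed.

Lemma yext_wid i : yext (wid i) = y i.
Proof. by rewrite /yext insub_wid. Qed.

Lemma yext_max : yext ord_max = 0.
Proof. by rewrite /yext insub_max. Qed.

Lemma prod_yext (f : R -> R) : \prod_m f (yext m) = (\prod_m f (y m)) * f 0.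
Proof.
rewrite big_ord_recr /= -/(wid _) yext_max; congr (_ * _).
by apply: eq_bigr => m _; rewrite -/(wid _) yext_wid.
Qed.

Lemma coef_up_eq i j : coef (@g_up R) (@k_up R) (@l_up R) x yext (x j) (y i) =
  alpha i * kappa j * (expdd [:: x j; y i])^-1.
Proof.
rewrite /coef /g_up /k_up /l_up !big_split /= !prodfV.
rewrite (prod_yext (fun u => sh u (x j))) (prod_yext (fun u => sh u (y i))).
rewrite /alpha /kappa.
have h1 := gt_eqF (sh_gt0 0 (x j)); have h2 := gt_eqF (sh_gt0 0 (y i)).
have h3 := gt_eqF (expdd2_gt0 (x j) (y i)).
have ne (m : nat) (f : 'I_m -> R) t : \prod_k sh (f k) t != 0.
  by apply/prodf_neq0 => k _; rewrite gt_eqF // sh_gt0.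
have n1 := ne _ x (x j); have n2 := ne _ y (y i).
move: (\prod_m sh (x m) (y i)) (\prod_i0 sh (x i0) (x j)) (\prod_m sh (y m) (x j)) (\prod_m sh (y m) (y i)) n1 n2 => p1 p2 p3 p4 n1 n2.
by field; rewrite h1 h2 h3 n1 n2.
Qed.

Lemma coef_low_eq j t : coef (@g_low R) (@k_low R) (@l_low R) x yext (x j) t = kappa j.
Proof.
rewrite /coef /g_low /k_low /l_low prodfV (prod_yext (fun u => sh u (x j))) /kappa.
have h1 := gt_eqF (sh_gt0 0 (x j)).
have n1 : \prod_k sh (x k) (x j) != 0.
  by apply/prodf_neq0 => k _; rewrite gt_eqF // sh_gt0.
move: (\prod_k sh (x k) (x j)) n1 => p p0.
by field; rewrite h1 p0.
Qed.

Lemma expR_diff (s t : R) : expR s - expR t = (s - t) * expdd [:: s; t].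
Proof. by rewrite expdd2_diff. Qed.

Lemma om_weight j : om A j = weight x y j.
Proof.
apply: weight_unique; [exact: eig_inj|exact: eig_neq|exact: eig_cor_inj|exact: om_sum|].
by move=> i; apply: (om_pole hA); exact: eig_neq.
Qed.

(** In [weight] each difference of exponentials is the difference of the exponents
    times [expdd]. *)
Lemma weight_exp j : kappa j ^+ 2 * om A j =
  weight (fun j => expR (x j)) (fun i => expR (y i)) j.
Proof.
rewrite om_weight /weight.
under [X in _ = X / _]eq_bigr => i _ do rewrite expR_diff.
under [X in _ = _ / X]eq_bigr => i _ do rewrite expR_diff.
rewrite !big_split /= -kappa_sqr.
have h1 := prod_expdd_neq0 (fun k => k != j) x (x j).
have h2 : \prod_(k | k != j) (x j - x k) != 0.
  apply/prodf_neq0 => k kj; rewrite subr_eq0; apply: contra kj => /eqP /eig_inj ->.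
  exact: eqxx.
move: (\prod_(k | k != j) (x j - x k)) (\prod_(k | k != j) expdd _) h1 h2 => p q q0 p0.
by field; rewrite p0 q0.
Qed.

(** The moduli of the border are determined by the weights, since the rows of [link]
    have length 1; so this compares [weight_pole_sqr] for the two pairs of spectra. *)
Lemma border_exp i : alpha i ^+ 2 * cxmod (border A i) ^+ 2 *
  (\sum_j weight (fun j => expR (x j)) (fun i => expR (y i)) j /
     ((expR (x j) - expR (y i)) * (expR (x j) - expR (y i)))) = 1.
Proof.
have inj_e (m : nat) (f : 'I_m -> R) : injective f -> injective (fun i => expR (f i)).
  by move=> hf a b /expR_inj /hf.
have ne j k : expR (x j) != expR (y k).
  by apply/eqP => /expR_inj /eqP; apply/negP; exact: eig_neq.
have s1 : cxmod (border A i) ^+ 2 *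
    (\sum_j weight x y j / ((x j - y i) * (x j - y i))) = 1.
  rewrite (eq_bigr (fun j => om A j / ((x j - y i) * (x j - y i)))) => [|j _]; last first.
    by rewrite om_weight.
  apply: (@inj_ofR R K); rewrite rmorphM cxmod_sqr rmorph1.
  by rewrite (om_pole2 hA eig_neq) eqxx.
have s2 := weight_pole_sqr eig_inj eig_neq i.
have s3 := weight_pole_sqr (inj_e _ _ eig_inj) ne i.
have e1 : \prod_k (expR (y i) - expR (x k)) =
  (\prod_k (y i - x k)) * \prod_k expdd [:: y i; x k].
  by rewrite -big_split /=; apply: eq_bigr => k _; rewrite expR_diff.
have e2 : \prod_(m | m != i) (expR (y i) - expR (y m)) =
  (\prod_(m | m != i) (y i - y m)) * \prod_(m | m != i) expdd [:: y i; y m].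
  by rewrite -big_split /=; apply: eq_bigr => k _; rewrite expR_diff.
rewrite e1 e2 -alpha_sqr in s3.
set S := \sum_j _ in s1 s2; set T := \sum_j _ in s3 *.
have h1 := prod_expdd_neq0 (fun k => k != i) y (y i).
have h2 : \prod_k (y i - x k) != 0.
  by apply/prodf_neq0 => k _; rewrite subr_eq0 eq_sym eig_neq.
move: s2 s3 h1 h2; move: (\prod_k (y i - x k)) (\prod_(m | m != i) (y i - y m)).
move=> P Q; move: (\prod_(m | m != i) expdd _) => H s2 s3 H0 P0.
have S0 : S != 0.
  by apply/eqP => S0; move: s1; rewrite S0 mulr0 => /eqP; rewrite eq_sym oner_eq0.
have e : alpha i ^+ 2 * T = S.
  apply: (mulfI P0); apply: (mulIf H0); rewrite s2 mulNr -s3; ring.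
by rewrite mulrAC e mulrC.
Qed.

Local Notation V := (up 1 (dia (cor A)) : 'M[K]_n.+1).

(** [phi A] relative to eigenbases of [A] and of its corner. *)
Definition core : 'M[K]_n.+1 := V *m phi A *m (dia A)^t*.

Lemma phi_core : phi A = V^t* *m core *m dia A.
Proof.
rewrite /core !mulmxA (unitary_mulVl (unitary_border hA)) mul1mx.
by rewrite -mulmxA (unitary_mulVl (dia_unitary hA)) mulmx1.
Qed.

Lemma coreE : core =
  up 0 1%:M *m (\matrix_(i, j) ((coef (@g_up R) (@k_up R) (@l_up R) x yext (x j) (yext i))%:K * link A i j)) +
  up 1 0 *m (\matrix_(i, j) ((coef (@g_low R) (@k_low R) (@l_low R) x yext (x j) (yext i))%:K * link A i j)).
Proof.
have hV := unitary_border hA; have hU := dia_unitary hA.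
rewrite /core (@phi_eq _ _ _ A (dia A) V x yext) //.
- rewrite /phi_of /term /dbl -/(link A).
  set N1 := \matrix_(i, j) _; set N2 := \matrix_(i, j) _.
  have c0 : V *m up 0 1%:M = up 0 1%:M *m V by rewrite !upM mulmx1 mul1mx mulr0 mul0r.
  have c1 : V *m up 1 0 = up 1 0 *m V by rewrite !upM mulmx0 mul0mx.
  rewrite mulmxDr mulmxDl !mulmxA c0 c1.
  rewrite -(mulmxA _ V (V^t* )) -[up 1 0 *m V *m _]mulmxA (unitary_mulV hV) !mulmx1.
  by rewrite -!(mulmxA _ (dia A)) (unitary_mulV hU) !mulmx1.
- by rewrite dia_eq.
- rewrite -{1}(dia_eq (herm_cor hA)) up_spm; apply: eq_spm => i.
  by rewrite /yext; case: insub => //=; rewrite rmorph0.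
Qed.

Lemma core_wid i j : core (wid i) j =
  ((alpha i)%:K * border A i) * ((kappa j)%:K * link A ord_max j) /
  ((expR (x j))%:K - (expR (y i))%:K).
Proof.
rewrite coreE.
set N1 := \matrix_(i, j) _; set N2 := \matrix_(i, j) _.
have -> : (up 0 1%:M *m N1 + up 1 0 *m N2) (wid i) j = N1 (wid i) j.
  rewrite mxE [X in X + _]mxE [X in _ + X]mxE !sum_wid !upE !mul0r !addr0.
  rewrite (bigD1 i) //= upE mxE eqxx mul1r big1 => [|k ki]; last first.
    by rewrite upE mxE eq_sym (negbTE ki) mul0r.
  by rewrite big1 ?addr0 // => k _; rewrite upE mxE mul0r.
have -> : (expR (x j))%:K - (expR (y i))%:K =
  ((x j)%:K - (y i)%:K) * (expdd [:: x j; y i])%:K :> K.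
  by rewrite -!rmorphB expR_diff rmorphM.
rewrite mxE yext_wid coef_up_eq (link_wid hA eig_neq).
have ar (a k d b l e : K) : a * k * d^-1 * (b * l / e) = a * b * (k * l) / (e * d).
  by rewrite invfM; ring.
by rewrite (rmorphM _ (alpha i * kappa j)) (rmorphM _ (alpha i)) fmorphV; exact: ar.
Qed.

Lemma core_max j : core ord_max j = (kappa j)%:K * link A ord_max j.
Proof.
rewrite coreE.
set N1 := \matrix_(i, j) _; set N2 := \matrix_(i, j) _.
have -> : (up 0 1%:M *m N1 + up 1 0 *m N2) ord_max j = N2 ord_max j.
  rewrite mxE [X in X + _]mxE [X in _ + X]mxE !sum_wid !upE mul0r mul1r addr0.
  rewrite big1 ?add0r => [|k _]; last by rewrite upE mul0r.
  by rewrite big1 ?add0r // => k _; rewrite upE mul0r.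
by rewrite mxE coef_low_eq.
Qed.

Lemma ofR_weight j : (weight (fun j => expR (x j)) (fun i => expR (y i)) j)%:K =
  weight (fun j => (expR (x j))%:K : K) (fun i => (expR (y i))%:K) j.
Proof.
rewrite /weight rmorphM fmorphV !rmorph_prod /=; congr (_ / _);
  by apply: eq_bigr => i _; rewrite rmorphB.
Qed.

Lemma conj_scale (k : R) (l : K) : Num.conj (k%:K * l) = k%:K * Num.conj l.
Proof. by rewrite rmorphM /= conjK. Qed.

Lemma ofR_sqrM (a b : R) : (a ^+ 2 * b)%:K = a%:K * a%:K * b%:K :> K.
Proof. by rewrite rmorphM rmorphXn. Qed.

Lemma ofR_pole (w a b : R) :
  (w / ((a - b) * (a - b)))%:K = w%:K / ((a%:K - b%:K) * (a%:K - b%:K)) :> K.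
Proof. by rewrite rmorphM fmorphV rmorphM !rmorphB. Qed.

Lemma core_hv j : ((kappa j)%:K * link A ord_max j) *
  Num.conj ((kappa j)%:K * link A ord_max j) =
  weight (fun j => (expR (x j))%:K : K) (fun i => (expR (y i))%:K) j.
Proof.
by rewrite -ofR_weight -weight_exp ofR_sqrM omE conj_scale mulrACA.
Qed.

Lemma core_hb i : ((alpha i)%:K * border A i) * Num.conj ((alpha i)%:K * border A i) *
  \sum_j weight (fun j => (expR (x j))%:K : K) (fun i => (expR (y i))%:K) j /
   (((expR (x j))%:K - (expR (y i))%:K) * ((expR (x j))%:K - (expR (y i))%:K)) = 1.
Proof.
have := congr1 (ofR K) (border_exp i).
rewrite rmorphM ofR_sqrM rmorph1 rmorph_sum /= cxmod_sqr => h.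
rewrite -[RHS]h conj_scale; congr (_ * _); first by rewrite mulrACA.
apply: eq_bigr => j _.
by rewrite ofR_pole ofR_weight.
Qed.

(** By [core_wid] and [core_max] this is the Cauchy matrix of the exponentials. *)
Lemma core_unitary : core \is unitarymx.
Proof.
apply: (cauchy_unitary (x := fun j => (expR (x j))%:K) (y := fun i => (expR (y i))%:K)
  (v := fun j => (kappa j)%:K * link A ord_max j)
  (b := fun i => (alpha i)%:K * border A i)).
- by move=> j; exact: conjK.
- by move=> i; exact: conjK.
- by move=> j k /inj_ofR /expR_inj /eig_inj.
- by move=> j i; apply/eqP => /inj_ofR /expR_inj /eqP; apply/negP; exact: eig_neq.
- exact: core_hv.
- exact: core_hb.
- exact: core_wid.
- exact: core_max.
Qed.

Lemma core_corner : cor (core *m diag_mx (\row_j (expR (x j))%:K) *m core^t* ) =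
  diag_mx (\row_i (expR (y i))%:K).
Proof.
apply: (cauchy_corner (x := fun j => (expR (x j))%:K) (y := fun i => (expR (y i))%:K)
  (v := fun j => (kappa j)%:K * link A ord_max j)
  (b := fun i => (alpha i)%:K * border A i)).
- by move=> j; exact: conjK.
- by move=> i; exact: conjK.
- by move=> j k /inj_ofR /expR_inj /eig_inj.
- by move=> j i; apply/eqP => /inj_ofR /expR_inj /eqP; apply/negP; exact: eig_neq.
- exact: core_hv.
- exact: core_hb.
- exact: core_wid.
- exact: core_max.
Qed.

Lemma phi_unitary_interlaced : phi A \is unitarymx.
Proof.
rewrite phi_core; apply: unitaryM; last exact: dia_unitary.
apply: unitaryM; last exact: core_unitary.
by apply: unitaryV; exact: unitary_border.
Qed.

Lemma phi_corner_interlaced :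
  cor (phi A *m expH A *m (phi A)^t* ) = expH (cor A).
Proof.
have hU := dia_unitary hA.
have e : phi A *m expH A *m (phi A)^t* =
  V^t* *m (core *m diag_mx (\row_j (expR (x j))%:K) *m core^t* ) *m V.
  rewrite phi_core /expH /spm 2!adjM (trmxCK V) !mulmxA.
  rewrite -(mulmxA _ (dia A) ((dia A)^t* )) (unitary_mulV hU) mulmx1.
  by rewrite -(mulmxA _ (dia A) ((dia A)^t* )) (unitary_mulV hU) mulmx1.
by rewrite e up_adj cor_upr cor_upl core_corner.
Qed.

End PhiInterlaced.

(** * Density of strict interlacing *)

Section Density.
Variables (R : realType) (K : complexes R).

(** The recursive form of the condition that defines [Herm0]; see
    [strictly_interlacedP] and [Herm0P]. *)
Fixpoint generic n : 'M[K]_n -> Prop :=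
  match n return 'M[K]_n -> Prop with
  | 0 => fun=> True
  | _.+1 => fun A => interlaced A /\ generic (cor A)
  end.

Lemma generic_eig_inj n (A : 'M[K]_n) : A^t* = A -> generic A -> injective (eig A).
Proof.
case: n A => [|n] A hA; first by move=> _ [].
by move=> [iA _]; exact: eig_inj.
Qed.

Definition join n (B : 'M[K]_n) (c : 'I_n -> K) (d : K) : 'M[K]_n.+1 :=
  \matrix_(i, j) match insub (val i) : option 'I_n, insub (val j) : option 'I_n with
    | Some i', Some j' => B i' j'
    | Some i', None => c i'
    | None, Some j' => Num.conj (c j')
    | None, None => d
    end.

Lemma joinE n (B : 'M[K]_n) c d :
  [/\ forall i j, join B c d (wid i) (wid j) = B i j,
      forall i, join B c d (wid i) ord_max = c i,
      forall j, join B c d ord_max (wid j) = Num.conj (c j)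
    & join B c d ord_max ord_max = d].
Proof. by split=> *; rewrite mxE ?insub_wid ?insub_max. Qed.

Lemma join_herm n (B : 'M[K]_n) c d : B^t* = B -> Num.conj d = d ->
  (join B c d)^t* = join B c d.
Proof.
move=> hB hd; have [j1 j2 j3 j4] := joinE B c d.
apply: eq_up => [i j|i|i|]; rewrite adjE ?j1 ?j2 ?j3 ?j4 ?conjCK //.
by rewrite -{2}hB adjE.
Qed.

Lemma cor_join n (B : 'M[K]_n) c d : cor (join B c d) = B.
Proof. by have [j1 _ _ _] := joinE B c d; apply/matrixP => i j; rewrite corE j1. Qed.

Lemma herm_entry n (A : 'M[K]_n) i j : A^t* = A -> Num.conj (A i j) = A j i.
Proof. by move=> hA; rewrite -{2}hA adjE. Qed.

Lemma up_mul_wid c n (W : 'M[K]_n) (A : 'M[K]_n.+1) i j :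
  (up c W *m A) (wid i) j = \sum_k W i k * A (wid k) j.
Proof.
rewrite mxE sum_wid upE mul0r addr0.
by apply: eq_bigr => k _; rewrite upE.
Qed.

Lemma mul_up_max c n (W : 'M[K]_n) (A : 'M[K]_n.+1) i :
  (A *m up c W) i ord_max = A i ord_max * c.
Proof.
by rewrite mxE sum_wid upE big1 ?add0r // => k _; rewrite upE mulr0.
Qed.

Lemma conj_up_max n (W : 'M[K]_n) (A : 'M[K]_n.+1) i :
  (up 1 W *m A *m (up 1 W)^t* ) (wid i) ord_max = \sum_k W i k * A (wid k) ord_max.
Proof. by rewrite up_adj mul_up_max rmorph1 mulr1 up_mul_wid. Qed.

(** Perturb the corner first; then make all components of the last column
    nonzero in an eigenbasis of the corner. *)
Lemma generic_dense n (A : 'M[K]_n) (e : R) : A^t* = A -> 0 < e ->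
  exists B, [/\ B^t* = B, generic B & close_by e A B].
Proof.
elim: n A => [|n IH] A hA e0.
  by exists A; split => //; split => [|[]]; [exact: ltW|].
have [B [hB gB [_ cB]]] := IH (cor A) (herm_cor hA) e0.
have hV := dia_unitary hB; set V := dia B in hV.
pose d := e / n.+1%:R.
have d0 : 0 < d by rewrite divr_gt0 ?ltr0n.
pose b i := \sum_k V i k * A (wid k) ord_max.
pose b' i : K := if b i == 0 then d%:K else b i.
have b'0 i : b' i != 0.
  rewrite /b'; case: ifP => [_|/negbT //].
  by rewrite -(rmorph0 (ofR K)) (inj_eq (@inj_ofR R K)) gt_eqF.
pose c i := \sum_k Num.conj (V k i) * b' k.
have hc i : \sum_k V i k * c k = b' i.
  transitivity (\sum_m (\sum_k V i k * Num.conj (V m k)) * b' m).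
    rewrite (eq_bigr (fun k => \sum_m V i k * Num.conj (V m k) * b' m)) => [|k _].
      by rewrite exchange_big; apply: eq_bigr => m _; rewrite mulr_suml.
    by rewrite /c mulr_sumr; apply: eq_bigr => m _; rewrite mulrA.
  have hr m : \sum_k V i k * Num.conj (V m k) = (i == m)%:R.
    have /matrixP /(_ i m) := unitary_mulV hV; rewrite !mxE => <-.
    by apply: eq_bigr => k _; rewrite adjE.
  rewrite (bigD1 i) //= hr eqxx mul1r big1 ?addr0 // => m mi.
  by rewrite hr eq_sym (negbTE mi) mul0r.
have hA' i : A (wid i) ord_max = \sum_k Num.conj (V k i) * b k.
  transitivity (\sum_m (\sum_k Num.conj (V k i) * V k m) * A (wid m) ord_max).
    have hr m : \sum_k Num.conj (V k i) * V k m = (i == m)%:R.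
      have /matrixP /(_ i m) := unitary_mulVl hV; rewrite !mxE => <-.
      by apply: eq_bigr => k _; rewrite adjE.
    rewrite (bigD1 i) //= hr eqxx mul1r big1 ?addr0 // => m mi.
    by rewrite hr eq_sym (negbTE mi) mul0r.
  rewrite (eq_bigr (fun m => \sum_k Num.conj (V k i) * V k m * A (wid m) ord_max)) => [|m _].
    rewrite exchange_big; apply: eq_bigr => k _; rewrite /b mulr_sumr.
    by apply: eq_bigr => m _; rewrite mulrA.
  by rewrite mulr_suml.
pose X := join B c (A ord_max ord_max).
have hX : X^t* = X by apply: join_herm => //; exact: herm_entry.
have [j1 j2 j3 j4] := joinE B c (A ord_max ord_max).
have cX i : cxmod (A (wid i) ord_max - c i) <= e.
  rewrite hA' /c -sumrB; apply: le_trans (cxmod_sum _ _ _) _.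
  have -> : e = \sum_(k < n.+1) d.
    by rewrite sumr_const card_ord -[RHS]mulr_natr /d divfK // pnatr_eq0.
  rewrite big_ord_recr /=; apply: ler_wpDr; first exact: ltW.
  apply: ler_sum => k _.
  rewrite -mulrBr cxmodM cxmod_conj -[leRHS]mul1r.
  rewrite ler_pM ?cxmod_ge0 ?unitary_cxmod // /b'.
  case: ifP => [/eqP ->|_]; last by rewrite subrr cxmod0 ltW.
  by rewrite sub0r cxmodN cxmod_ofR ger0_norm // ltW.
exists X; split => //.
  split; last by rewrite cor_join.
  apply: interlaced_border => //.
    by rewrite cor_join; exact: generic_eig_inj.
  move=> i; rewrite /border /arrow conj_up_max cor_join.
  by under eq_bigr => k _ do rewrite j2; rewrite hc.
split; first exact: ltW.
apply: ord_wid_ind => [i|]; apply: ord_wid_ind => [j|]; rewrite ?j1 ?j2 ?j3 ?j4.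
- by rewrite -corE.
- exact: cX.
- by rewrite -(herm_entry _ _ hA) -rmorphB cxmod_conj.
- by rewrite subrr cxmod0 ltW.
Qed.

(** This extends the algebraic identities for [phi] from generic matrices to all
    Hermitian ones. *)
Lemma generic_closure n (F : 'M[K]_n -> K) (A : 'M[K]_n) : loc_lip F ->
  (forall B, B^t* = B -> generic B -> F B = 0) -> A^t* = A -> F A = 0.
Proof.
move=> hF h0 hA; have [M M0 bA] := bounded_ex A.
have [C [C0 _ hC]] := hF (M + 1).
apply: cxmod_eq0; apply/eqP; rewrite eq_le cxmod_ge0 andbT.
rewrite leNgt; apply/negP => pos.
pose e := Num.min 1 (cxmod (F A) / (C + 1) / 2).
have C1 : 0 < C + 1 by rewrite ltr_wpDl.
have e0 : 0 < e by rewrite /e lt_min ltr01 /= !divr_gt0.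
have [B [hB gB cAB]] := generic_dense hA e0.
have bA1 : herm_ball (M + 1) A.
  by split => // i j; apply: le_trans (bA i j) _; rewrite lerDl.
have bB : herm_ball (M + 1) B.
  split => // i j; have -> : B i j = A i j - (A i j - B i j) by ring.
  apply: le_trans (cxmodD _ _) _; rewrite cxmodN lerD //.
  by have [_ h] := cAB; apply: le_trans (h i j) _; rewrite /e ge_min lexx.
have := hC e A B bA1 bB cAB; rewrite (h0 B hB gB) subr0 => h.
have : cxmod (F A) <= (C + 1) * (cxmod (F A) / (C + 1) / 2).
  apply: le_trans h _; apply: ler_pM => //; first exact: ltW.
    by rewrite lerDl.
  by rewrite /e ge_min lexx orbT.
have -> : (C + 1) * (cxmod (F A) / (C + 1) / 2) = cxmod (F A) / 2.
  by field; rewrite gt_eqF.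
by move: pos; lra.
Qed.

Lemma loc_lip_mulmx n p (F G : 'M[K]_n -> 'M[K]_p) a b :
  (forall a b, loc_lip (fun A => F A a b)) ->
  (forall a b, loc_lip (fun A => G A a b)) ->
  loc_lip (fun A => (F A *m G A) a b).
Proof.
move=> hF hG M; apply: (lip_ext (F := fun A => \sum_c F A a c * G A c b)).
  by move=> A _; rewrite mxE.
by apply: lip_sum => [|c _]; [exact: close_ge0|apply: lip_mul; [exact: hF|exact: hG]].
Qed.

Lemma loc_lip_adj n p (F : 'M[K]_n -> 'M[K]_p) a b :
  (forall a b, loc_lip (fun A => F A a b)) -> loc_lip (fun A => (F A)^t* a b).
Proof.
move=> hF M; apply: (lip_ext (F := fun A => Num.conj (F A b a))).
  by move=> A _; rewrite adjE.
by apply: lip_conj; exact: hF.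
Qed.

Lemma loc_lip_sub n (F G : 'M[K]_n -> K) : loc_lip F -> loc_lip G ->
  loc_lip (fun A => F A - G A).
Proof.
move=> hF hG M; apply: (lip_ext (F := fun A => F A + (-1) * G A)).
  by move=> A _; rewrite mulN1r.
apply: lip_add; [exact: hF|apply: lip_mul; [|exact: hG]].
by apply: lip_cst; exact: close_ge0.
Qed.

Lemma loc_lip_cst n c : loc_lip (fun _ : 'M[K]_n => c).
Proof. by move=> M; apply: lip_cst; exact: close_ge0. Qed.

Lemma loc_lip_phi n a b : loc_lip (fun A : 'M[K]_n.+1 => phi A a b).
Proof. exact: (smoothM_lip (phi_smooth K 0 a b)). Qed.

Lemma loc_lip_expH n a b : loc_lip (fun A : 'M[K]_n => expH A a b).
Proof. exact: (smoothM_lip (expH_smooth K 0 a b)). Qed.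

Lemma phi_unitary n (A : 'M[K]_n.+1) : A^t* = A -> phi A \is unitarymx.
Proof.
move=> hA; apply/unitarymxP/matrixP => a b; apply/eqP; rewrite -subr_eq0; apply/eqP.
apply: (@generic_closure _ (fun A => (phi A *m (phi A)^t* ) a b - 1%:M a b)) => //.
  apply: loc_lip_sub; last exact: loc_lip_cst.
  by apply: loc_lip_mulmx => ? ?; [|apply: loc_lip_adj => ? ?]; exact: loc_lip_phi.
move=> B hB [iB _]; rewrite unitary_mulV ?subrr //.
exact: phi_unitary_interlaced.
Qed.

Lemma phi_corner n (A : 'M[K]_n.+1) : A^t* = A ->
  cor (phi A *m expH A *m (phi A)^t* ) = expH (cor A).
Proof.
move=> hA; apply/matrixP => a b; apply/eqP; rewrite -subr_eq0; apply/eqP.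
apply: (@generic_closure _ (fun A => cor (phi A *m expH A *m (phi A)^t* ) a b -
  expH (cor A) a b)) => //.
  apply: loc_lip_sub.
    move=> M; apply: (lip_ext (F := fun A => (phi A *m expH A *m (phi A)^t* ) (wid a) (wid b))).
      by move=> B _; rewrite corE.
    apply: (@loc_lip_mulmx _ _ (fun A => phi A *m expH A) (fun A => (phi A)^t* )) => c d.
      by apply: loc_lip_mulmx => ? ?; [exact: loc_lip_phi|exact: loc_lip_expH].
    by apply: loc_lip_adj => ? ?; exact: loc_lip_phi.
  exact: (smoothM_lip (smoothM_comp (@herm_linear_cor R K n) (expH_smooth K 0 a b))).
by move=> B hB [iB _]; rewrite phi_corner_interlaced // subrr.
Qed.

End Density.

Section Paths.
Variables (R : realType) (K : complexes R).

Definition unit_interval (s : R) : Prop := 0 <= s <= 1.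
Definition near_real (d s t : R) : Prop := `|s - t| <= d.

Lemma near_real_ge0 d s t : near_real d s t -> 0 <= d.
Proof. exact: le_trans (normr_ge0 _). Qed.

Definition path_lip (f : R -> K) := lip unit_interval near_real f.

Lemma path_lip_line n (F : 'M[K]_n -> K) (A : 'M[K]_n) : A^t* = A -> loc_lip F ->
  path_lip (fun s => F (s%:K *: A)).
Proof.
move=> hA hF; have [M M0 bA] := bounded_ex A.
have [C [C0 h1 h2]] := hF M.
have hb s : unit_interval s -> herm_ball M (s%:K *: A).
  move=> /andP[s0 s1]; split; first by rewrite linearZ /= map_mxZ /= conjK hA.
  move=> i j; rewrite mxE cxmodM cxmod_ofR ger0_norm // -[leRHS]mul1r.
  by rewrite ler_pM ?cxmod_ge0.
exists (C * (M + 1)); split.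
- by rewrite mulr_ge0 ?addr_ge0.
- move=> s hs; apply: le_trans (h1 _ (hb s hs)) _.
  by rewrite -[leLHS]mulr1 ler_wpM2l // lerDr.
move=> d s t hs ht hst; have d0 := near_real_ge0 hst.
apply: le_trans (h2 (d * M) _ _ (hb s hs) (hb t ht) _) _.
  split; first exact: mulr_ge0.
  move=> i j; rewrite !mxE -mulrBl -rmorphB cxmodM cxmod_ofR.
  by rewrite ler_pM ?cxmod_ge0.
rewrite -mulrA ler_wpM2l // mulrC ler_wpM2r //.
by rewrite lerDl.
Qed.

(** On a subdivision finer than the inverse of the Lipschitz constant, the function
    cannot jump from 1 to -1. *)
Lemma path_discrete (f : R -> K) : path_lip f ->
  (forall s, unit_interval s -> f s = 1 \/ f s = -1) -> f 0 = 1 -> f 1 = 1.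
Proof.
move=> [C [C0 _ hC]] hf f0.
pose N := (Num.bound C).+1.
have CN : C < N%:R.
  by apply: lt_le_trans (archi_boundP C0) _; rewrite ler_nat leqnSn.
have N0 : 0 < N%:R :> R by rewrite ltr0n.
have hI k : (k <= N)%N -> unit_interval (k%:R / N%:R).
  by move=> kN; rewrite /unit_interval divr_ge0 //= ler_pdivrMr // mul1r ler_nat.
suff H k : (k <= N)%N -> f (k%:R / N%:R) = 1.
  by have := H N (leqnn N); rewrite mulfV // gt_eqF.
elim: k => [|k IH] hk; first by rewrite mul0r.
have [//|e] := hf _ (hI _ hk).
have := hC (N%:R)^-1 _ _ (hI _ hk) (hI _ (ltnW hk)).
rewrite (IH (ltnW hk)) e.
have hn : near_real (N%:R)^-1 (k.+1%:R / N%:R) (k%:R / N%:R).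
  by rewrite /near_real -mulrBl -natrB // subSnn mul1r ger0_norm ?invr_ge0.
move=> /(_ hn); rewrite -opprD cxmodN.
have -> : (1 + 1 : K) = (2 : R)%:K by rewrite rmorphD rmorph1.
rewrite cxmod_ofR ger0_norm // => h.
have : C / N%:R < 1 by rewrite ltr_pdivrMr // mul1r.
by move=> /(le_lt_trans h); rewrite ltrn1.
Qed.

End Paths.

(** * The determinant of the one-step conjugation *)

Section PhiDet.
Variables (R : realType) (K : complexes R).

Lemma det_conj n (A : 'M[K]_n) : \det (map_mx Num.conj A) = Num.conj (\det A).
Proof. by rewrite det_map_mx. Qed.

Lemma det_adj n (A : 'M[K]_n) : \det (A^t* ) = Num.conj (\det A).
Proof. by rewrite det_map_mx det_tr. Qed.

Lemma det_unitary n (U : 'M[K]_n) : U \is unitarymx -> \det U * Num.conj (\det U) = 1.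
Proof. by move=> hU; rewrite -det_adj -det_mulmx unitary_mulV // det1. Qed.

Definition phase (z : K) : K := if z == 0 then 1 else z / (cxmod z)%:K.

Lemma phase_unit z : phase z * Num.conj (phase z) = 1.
Proof.
rewrite /phase; case: eqP => [_|/eqP z0]; first by rewrite rmorph1 mulr1.
rewrite rmorphM fmorphV /= conjK mulrACA -cxmod_sqr -invfM -rmorphM -expr2.
rewrite mulfV // -(rmorph0 (ofR K)) (inj_eq (@inj_ofR R K)).
by apply: contra z0; rewrite expf_eq0 /= => /eqP /cxmod_eq0 ->.
Qed.

Lemma phase_mod z : z = phase z * (cxmod z)%:K.
Proof.
rewrite /phase; case: eqP => [->|/eqP z0]; first by rewrite cxmod0 rmorph0 mulr0.
rewrite divfK // -(rmorph0 (ofR K)) (inj_eq (@inj_ofR R K)).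
by apply: contra z0 => /eqP /cxmod_eq0 ->.
Qed.

Lemma phase_real z : Num.conj (phase z) * z = (cxmod z)%:K.
Proof. by rewrite {2}(phase_mod z) mulrA [X in X * _]mulrC phase_unit mul1r. Qed.

Lemma diag_unitary n (f : 'I_n -> K) : (forall i, f i * Num.conj (f i) = 1) ->
  diag_mx (\row_i f i) \is unitarymx.
Proof.
move=> hf; apply/unitarymxP/matrixP => i j; rewrite mul_diag_mx !mxE eq_sym.
by case: eqP => [->|_]; rewrite ?mulr1n ?mulr0n ?hf // rmorph0 mulr0.
Qed.

(** Diagonalize the corner, then make the border real by phases. *)
Lemma border_realify n (A : 'M[K]_n.+1) : A^t* = A ->
  exists2 W : 'M[K]_n, W \is unitarymx &
  map_mx Num.conj (up 1 W *m A *m (up 1 W)^t* ) = up 1 W *m A *m (up 1 W)^t*.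
Proof.
move=> hA; have hB := herm_cor hA; have hV := dia_unitary hB.
pose p i := phase (border A i).
have hp i : p i * Num.conj (p i) = 1 by exact: phase_unit.
pose D := diag_mx (\row_i Num.conj (p i)).
have hD : D \is unitarymx.
  by apply: diag_unitary => i; rewrite conjCK mulrC.
have hW : D *m dia (cor A) \is unitarymx by exact: unitaryM.
exists (D *m dia (cor A)) => //.
have -> : up 1 (D *m dia (cor A)) *m A *m (up 1 (D *m dia (cor A)))^t* =
  up 1 D *m arrow A *m (up 1 D)^t*.
  rewrite /arrow -[up 1 (D *m _)](_ : up 1 D *m up 1 (dia (cor A)) = _); last first.
    by rewrite upM mulr1.
  by rewrite adjM !mulmxA.
set T := arrow A.
have hT : T^t* = T by exact: arrow_herm.
have e : (up 1 D *m T *m (up 1 D)^t* )^t* = up 1 D *m T *m (up 1 D)^t*.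
  by rewrite adjM adjM trmxCK hT mulmxA.
have real_wm i : Num.conj ((up 1 D *m T *m (up 1 D)^t* ) (wid i) ord_max) =
   (up 1 D *m T *m (up 1 D)^t* ) (wid i) ord_max.
  rewrite conj_up_max (bigD1 i) //= big1 ?addr0 => [|k ki]; last first.
    by rewrite [D i k]mxE eq_sym (negbTE ki) mulr0n mul0r.
  have -> : D i i = Num.conj (p i) by rewrite !mxE eqxx mulr1n.
  by rewrite -[T (wid i) ord_max]/(border A i) phase_real conjK.
apply: eq_up => [i j|i|i|]; rewrite [LHS]mxE.
- have eD : D^t* = diag_mx (\row_i p i).
    apply/matrixP => a b; rewrite adjE !mxE eq_sym.
    by case: eqP => [->|_]; rewrite ?mulr1n ?mulr0n ?rmorph0 ?conjCK.
  rewrite -corE up_adj cor_upr cor_upl arrow_cor // eD !diag_rowM !mxE.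
  case: (i == j); rewrite ?mulr1n ?mulr0n ?rmorph0 //.
  by rewrite mulrAC -[_ * p i]mulrC hp mul1r conjK.
- exact: real_wm.
- by rewrite (herm_entry _ _ e) -real_wm (herm_entry _ _ e).
- exact: herm_entry.
Qed.

(** By equivariance the matrix [A] can be replaced by a real one. *)
Lemma det_phi_real n (A : 'M[K]_n.+1) : A^t* = A ->
  Num.conj (\det (phi A)) = \det (phi A).
Proof.
move=> hA; have [W hW rW] := border_realify hA.
set B := up 1 W *m A *m (up 1 W)^t* in rW.
have hB : B^t* = B by rewrite /B !adjM trmxCK hA mulmxA.
have h11 : 1 * Num.conj 1 = 1 :> K by rewrite rmorph1 mulr1.
have hW1 := up_unitary hW h11.
have e : \det (phi B) = \det (phi A).
  rewrite /B phi_equiv // !det_mulmx mulrAC -det_mulmx unitary_mulV // det1.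
  by rewrite mul1r.
by rewrite -e -det_conj phi_conj // rW.
Qed.

Lemma phi0 n : phi (0 : 'M[K]_n.+1) = 1%:M.
Proof.
have -> : (0 : 'M[K]_n.+1) = up 0 0.
  by apply: eq_up => [i j|i|i|]; rewrite !upE !mxE.
by rewrite phi_up // linear0 map_mx0.
Qed.

Lemma loc_lip_det n p (F : 'M[K]_n -> 'M[K]_p) :
  (forall a b, loc_lip (fun A => F A a b)) -> loc_lip (fun A => \det (F A)).
Proof.
move=> hF M; apply: lip_sum => [|s _]; first exact: close_ge0.
apply: lip_mul; first by apply: lip_cst; exact: close_ge0.
apply: lip_prod => [|i _]; first exact: close_ge0.
exact: hF.
Qed.

(** The determinant is real of modulus 1, and continuous along the segment from the
    zero matrix, where it is 1. *)
Lemma det_phi n (A : 'M[K]_n.+1) : A^t* = A -> \det (phi A) = 1.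
Proof.
move=> hA; have hs s : (s%:K *: A)^t* = s%:K *: A.
  by rewrite linearZ /= map_mxZ /= conjK hA.
suff : \det (phi (1%:K *: A)) = 1 by rewrite rmorph1 scale1r.
apply: (@path_discrete R K (fun s => \det (phi (s%:K *: A)))).
- apply: (path_lip_line (F := fun A => \det (phi A)) hA).
  by apply: loc_lip_det => a b; exact: loc_lip_phi.
- move=> s _; have := det_unitary (phi_unitary (hs s)).
  rewrite det_phi_real // -expr2 => /eqP; rewrite sqrf_eq1.
  by case/orP => /eqP ->; [left|right].
- by rewrite rmorph0 scale0r phi0 det1.
Qed.

End PhiDet.

(** * The maps psi and gamma *)

Section Psi.
Variables (R : realType) (K : complexes R).

(** Conjugation by [phi A] turns the corner of [exp A] into [exp] of the corner of [A]; the
    factor [psi (cor A)] then treats the smaller corners, see [cor_gam]. *)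
Fixpoint psi n : 'M[K]_n -> 'M[K]_n :=
  match n return 'M[K]_n -> 'M[K]_n with
  | 0 => fun=> 1%:M
  | _.+1 => fun A => up 1 (psi (cor A)) *m phi A
  end.

(** This will be identified with the given map [gamma] and with [exp_conj (psi A) A]. *)
Definition gam n (A : 'M[K]_n) := psi A *m expH A *m (psi A)^t*.

Lemma psiS n (A : 'M[K]_n.+1) : psi A = up 1 (psi (cor A)) *m phi A.
Proof. by []. Qed.

Lemma conj11 : 1 * Num.conj 1 = 1 :> K. Proof. by rewrite rmorph1 mulr1. Qed.

Lemma psi_unitary n (A : 'M[K]_n) : A^t* = A -> psi A \is unitarymx.
Proof.
elim: n A => [|n IH] A hA; first exact: unitary1.
rewrite psiS; apply: unitaryM; last exact: phi_unitary.
by apply: up_unitary conj11; apply: IH; exact: herm_cor.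
Qed.

Lemma det_psi n (A : 'M[K]_n) : A^t* = A -> \det (psi A) = 1.
Proof.
elim: n A => [|n IH] A hA; first by rewrite det1.
by rewrite psiS det_mulmx det_up det_phi // IH ?mulr1 //; exact: herm_cor.
Qed.

Lemma psi_smooth n m a b : smoothM m (fun A : 'M[K]_n => psi A a b).
Proof.
elim: n a b => [|n IH] a b; first exact: smoothM_cst.
apply: (@smoothM_mulmx _ _ _ m _ (fun A : 'M[K]_n.+1 => up 1 (psi (cor A))) (fun A => phi A)).
  move=> {}a {}b.
  move: a b; apply: ord_wid_ind => [i|]; apply: ord_wid_ind => [j|].
  - apply: (smoothM_ext (F := fun A : 'M[K]_n.+1 => psi (cor A) i j)).
      by move=> A _; rewrite upE.
    by apply: (smoothM_comp (F := fun A => psi A i j)); [exact: herm_linear_cor|exact: IH].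
  - by apply: (smoothM_ext (F := fun=> 0)); [move=> A _; rewrite upE|exact: smoothM_cst].
  - by apply: (smoothM_ext (F := fun=> 0)); [move=> A _; rewrite upE|exact: smoothM_cst].
  - by apply: (smoothM_ext (F := fun=> 1)); [move=> A _; rewrite upE|exact: smoothM_cst].
by move=> c d; exact: phi_smooth.
Qed.

Lemma loc_lip_psi n a b : loc_lip (fun A : 'M[K]_n => psi A a b).
Proof. exact: (smoothM_lip (psi_smooth 0 a b)). Qed.

Lemma psi_conj n (A : 'M[K]_n) : A^t* = A ->
  map_mx Num.conj (psi A) = psi (map_mx Num.conj A).
Proof.
elim: n A => [|n IH] A hA; first by rewrite /= map_mx1.
rewrite !psiS conjmxM up_conj rmorph1 phi_conj // IH; last exact: herm_cor.
by rewrite cor_conj.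
Qed.

Lemma psi0 n : psi (0 : 'M[K]_n) = 1%:M.
Proof.
elim: n => [|n IH] //; rewrite psiS phi0 mulmx1.
by have -> : cor (0 : 'M[K]_n.+1) = 0; [apply/matrixP => i j; rewrite corE !mxE|rewrite IH up1].
Qed.

Lemma psi_up n (B : 'M[K]_n) : B^t* = B -> psi (up 0 B) = up 1 (psi B).
Proof. by move=> hB; rewrite psiS cor_up phi_up // mulmx1. Qed.

Lemma diag_up n (t : 'M[K]_n.+1) : is_diag_mx t -> t = up (t ord_max ord_max) (cor t).
Proof.
move=> /is_diag_mxP ht; apply: eq_up => [i j|i|i|]; rewrite upE ?corE //.
- by apply: ht; rewrite /= neq_ltn ltn_ord.
- by apply: ht; rewrite /= neq_ltn ltn_ord orbT.
Qed.

(** Equivariance of [phi] under [U(n) x U(1)], used in each step. *)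
Lemma psi_diag n (t A : 'M[K]_n) : is_diag_mx t -> t \is unitarymx -> A^t* = A ->
  psi (t *m A *m t^t* ) = t *m psi A *m t^t*.
Proof.
elim: n t A => [|n IH] t A dt ut hA.
  by rewrite /= mulmx1 unitary_mulV.
have et := diag_up dt; set c := t ord_max ord_max in et.
have hc : c * Num.conj c = 1.
  have : up c (cor t) *m (up c (cor t))^t* = 1%:M by rewrite -et unitary_mulV.
  by rewrite up_adj upM => /matrixP /(_ ord_max ord_max); rewrite upE mxE eqxx.
have tt : up 1 (cor t *m (cor t)^t* ) = 1%:M.
  have : up c (cor t) *m (up c (cor t))^t* = 1%:M by rewrite -et unitary_mulV.
  by rewrite up_adj upM hc.
have uc : cor t \is unitarymx.
  apply/unitarymxP; have := congr1 (fun M => cor M) tt.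
  by rewrite cor_up -(up1 K n) cor_up.
have dc : is_diag_mx (cor t).
  apply/is_diag_mxP => i j ij; rewrite corE; have /is_diag_mxP := dt; apply.
  exact: ij.
rewrite !psiS.
have -> : cor (t *m A *m t^t* ) = cor t *m cor A *m (cor t)^t*.
  by rewrite [in LHS]et up_adj cor_upr cor_upl.
rewrite IH //; last exact: herm_cor.
have := phi_equiv hA uc hc; rewrite -et => ->.
have -> : up 1 (cor t *m psi (cor A) *m (cor t)^t* ) =
  t *m up 1 (psi (cor A)) *m t^t*.
  by rewrite [in RHS]et up_adj !upM mulr1 hc.
by rewrite !mulmxA -(mulmxA _ (t^t* ) t) unitary_mulVl // mulmx1.
Qed.

(** The defining property of [phi], conjugated by [psi (cor A)]. *)
Lemma cor_gam n (A : 'M[K]_n.+1) : A^t* = A -> cor (gam A) = gam (cor A).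
Proof.
move=> hA; rewrite /gam psiS adjM.
have -> : up 1 (psi (cor A)) *m phi A *m expH A *m ((phi A)^t* *m (up 1 (psi (cor A)))^t* ) =
  up 1 (psi (cor A)) *m (phi A *m expH A *m (phi A)^t* ) *m (up 1 (psi (cor A)))^t*.
  by rewrite !mulmxA.
by rewrite up_adj cor_upr cor_upl phi_corner.
Qed.

Lemma gam_spm n (A : 'M[K]_n) : A^t* = A ->
  gam A = spm (dia A *m (psi A)^t* ) (fun i => (expR (eig A i))%:K).
Proof. by move=> hA; rewrite spm_mulr trmxCK. Qed.

Lemma gam_frame n (A : 'M[K]_n) : A^t* = A -> dia A *m (psi A)^t* \is unitarymx.
Proof.
move=> hA; apply: unitaryM; first exact: dia_unitary.
by apply: unitaryV; exact: psi_unitary.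
Qed.

Lemma herm_spm_real n (U : 'M[K]_n) (f : 'I_n -> R) :
  (spm U (fun i => (f i)%:K))^t* = spm U (fun i => (f i)%:K).
Proof. by rewrite spm_adj; apply: eq_spm => i; exact: conjK. Qed.

Lemma gam_herm n (A : 'M[K]_n) : A^t* = A -> (gam A)^t* = gam A.
Proof. by move=> hA; rewrite gam_spm // herm_spm_real. Qed.

Lemma eig_gam n (A : 'M[K]_n) : A^t* = A -> eig (gam A) =1 fun i => expR (eig A i).
Proof.
move=> hA; rewrite gam_spm //; apply: eig_spm; first exact: gam_frame.
by move=> i j ij; rewrite ler_expR; exact: eig_homo.
Qed.

Lemma generic_gam n (A : 'M[K]_n) : A^t* = A -> generic A -> generic (gam A).
Proof.
elim: n A => [|n IH] A hA //= [iA gA]; rewrite cor_gam //; split.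
  move=> i; rewrite cor_gam // !eig_gam //; last exact: herm_cor.
  by have /andP[h1 h2] := iA i; rewrite !ltr_expR h1.
by apply: IH => //; exact: herm_cor.
Qed.

Lemma expH_conj n (A W : 'M[K]_n) : A^t* = A -> W \is unitarymx ->
  expH (W *m A *m W^t* ) = W *m expH A *m W^t*.
Proof.
move=> hA hW; have hU := dia_unitary hA.
have hB : (W *m A *m W^t* )^t* = W *m A *m W^t* by rewrite !adjM trmxCK hA mulmxA.
rewrite {2}/expH (spm_eigen_mul hU hW (erefl _)) /expH.
apply: (spm_calc (x := fun i => (eig (W *m A *m W^t* ) i)%:K) (y := fun i => (eig A i)%:K)).
- exact: dia_unitary.
- by apply: unitaryM => //; exact: unitaryV.
- by rewrite dia_eq // -(spm_eigen_mul hU hW (erefl _)) dia_eq.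
- by move=> i j /inj_ofR ->.
Qed.

End Psi.

(** * The torus action *)

Section TorusAction.
Variables (R : realType) (K : complexes R).

(** The abstract counterparts of [torus_elt], [torus_act], [tori_act], [chi]. *)
Definition rot n (t B : 'M[K]_n) : 'M[K]_n := invmx (dia B) *m t *m dia B.

Definition rot_in n k (hk : (k <= n)%N) (t : 'M[K]_k) (A : 'M[K]_n) : 'M[K]_n :=
  extend 1 hk (rot t (corner hk A)).

Definition rot_act n k (hk : (k <= n)%N) (t : 'M[K]_k) (A : 'M[K]_n) : 'M[K]_n :=
  rot_in hk t A *m A *m invmx (rot_in hk t A).

Definition rots_act n (t : forall k : 'I_n, 'M[K]_k) (A : 'M[K]_n) : 'M[K]_n :=
  foldl (fun B (k : 'I_n) => rot_act (ltnW (ltn_ord k)) (t k) B) A (enum 'I_n).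

Definition rots n (t : forall k : 'I_n, 'M[K]_k) (A : 'M[K]_n) : 'M[K]_n :=
  \prod_(k < n) rot_in (ltnW (ltn_ord k)) (t k) A.

Definition diag_unitaries n (t : forall k : 'I_n, 'M[K]_k) :=
  forall k, is_diag_mx (t k) /\ t k \is unitarymx.

Definition restrict n (t : forall k : 'I_n.+1, 'M[K]_k) : forall k : 'I_n, 'M[K]_k :=
  fun k => t (wid k).

Lemma rot_unitary n (t B : 'M[K]_n) : B^t* = B -> t \is unitarymx ->
  rot t B \is unitarymx.
Proof.
move=> hB ht; have hU := dia_unitary hB; rewrite /rot invmx_unitary //.
by apply: unitaryM => //; apply: unitaryM => //; exact: unitaryV.
Qed.

Lemma diag_spm n (t U : 'M[K]_n) : is_diag_mx t -> U \is unitarymx ->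
  invmx U *m t *m U = spm U (fun i => t i i).
Proof.
move=> /is_diag_mxP ht hU; rewrite invmx_unitary // /spm.
congr (_ *m _ *m _); apply/matrixP => i j; rewrite !mxE.
by case: eqP => [->|/eqP ij]; rewrite ?mulr1n ?mulr0n // ht.
Qed.

(** Two diagonalizations of a matrix with simple spectrum differ by a diagonal matrix,
    which commutes with [t]. *)
Lemma rot_spm n (t B U : 'M[K]_n) (x : 'I_n -> R) : is_diag_mx t -> B^t* = B ->
  injective (eig B) -> U \is unitarymx -> B = spm U (fun i => (x i)%:K) ->
  eig B =1 x -> rot t B = spm U (fun i => t i i).
Proof.
move=> dt hB inj_B hU eB ex; have hV := dia_unitary hB.
rewrite /rot (diag_spm dt hV).
apply: (spm_calc (x := fun i => (eig B i)%:K) (y := fun i => (x i)%:K)) => //.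
  by rewrite dia_eq.
by move=> i j /inj_ofR; rewrite -ex => /inj_B ->.
Qed.

Lemma rot_comm n (t B : 'M[K]_n) : is_diag_mx t -> B^t* = B ->
  rot t B *m B = B *m rot t B.
Proof.
move=> dt hB; have hV := dia_unitary hB; rewrite /rot (diag_spm dt hV).
rewrite -{2 3}(dia_eq hB) !spmM //.
by apply: eq_spm => i; rewrite mulrC.
Qed.

Lemma eig_conj n (A W : 'M[K]_n) : A^t* = A -> W \is unitarymx ->
  eig (W *m A *m W^t* ) =1 eig A.
Proof.
move=> hA hW; have hU := dia_unitary hA.
rewrite (spm_eigen_mul hU hW (esym (dia_eq hA))); apply: eig_spm.
  by apply: unitaryM => //; exact: unitaryV.
exact: eig_homo.
Qed.

Lemma conj_herm n (A W : 'M[K]_n) : A^t* = A -> (W *m A *m W^t* )^t* = W *m A *m W^t*.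
Proof. by move=> hA; rewrite adjM adjM trmxCK hA mulmxA. Qed.

Lemma rot_conj n (t B W : 'M[K]_n) : is_diag_mx t -> B^t* = B ->
  injective (eig B) -> W \is unitarymx ->
  rot t (W *m B *m W^t* ) = W *m rot t B *m W^t*.
Proof.
move=> dt hB iB hW; have hV := dia_unitary hB.
have hVW : dia B *m W^t* \is unitarymx by apply: unitaryM => //; exact: unitaryV.
rewrite (@rot_spm _ t _ (dia B *m W^t* ) (eig B) dt) //.
- by rewrite spm_mulr trmxCK /rot (diag_spm dt hV).
- exact: conj_herm.
- by move=> i j; rewrite !eig_conj //; exact: iB.
- by rewrite (spm_eigen_mul hV hW (esym (dia_eq hB))).
- exact: eig_conj.
Qed.

Lemma rot_in_up n k (hk : (k <= n)%N) (hk' : (k <= n.+1)%N) (t : 'M[K]_k) (A : 'M[K]_n.+1) :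
  rot_in hk' t A = up 1 (rot_in hk t (cor A)).
Proof. by rewrite /rot_in (extend_up 1 hk) (corner_corner hk). Qed.

Lemma rot_in_max n (hn : (n <= n.+1)%N) (t : 'M[K]_n) (A : 'M[K]_n.+1) :
  rot_in hn t A = up 1 (rot t (cor A)).
Proof.
by rewrite /rot_in /up /cor (bool_irrelevance hn (leqnSn n)).
Qed.

Lemma rotsS n (t : forall k : 'I_n.+1, 'M[K]_k) (A : 'M[K]_n.+1) :
  rots t A = up 1 (rots (restrict t) (cor A) *m rot (t ord_max) (cor A)).
Proof.
rewrite /rots big_ord_recr -[LHS]/(_ *m _) (rot_in_max _ (t ord_max)).
rewrite -[in RHS](mulr1 1) -upM; congr (_ *m _).
have H (r : seq 'I_n) : \prod_(k <- r) rot_in (ltnW (ltn_ord (wid k))) (t (wid k)) A =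
  up 1 (\prod_(k <- r) rot_in (ltnW (ltn_ord k)) (restrict t k) (cor A)).
  elim: r => [|k r IH]; first by rewrite !big_nil; exact: esym (up1 K n).
  rewrite !big_cons IH; rewrite (rot_in_up (ltnW (ltn_ord k))).
  by rewrite -[LHS]/(up 1 _ *m up 1 _) upM mulr1.
exact: H.
Qed.

Lemma rots_unitary n (t : forall k : 'I_n, 'M[K]_k) (A : 'M[K]_n) :
  A^t* = A -> diag_unitaries t -> rots t A \is unitarymx.
Proof.
elim: n t A => [|n IH] t A hA ht.
  by rewrite /rots big_ord0; exact: unitary1.
rewrite rotsS; apply: up_unitary (conj11 K); have hB := herm_cor hA.
apply: unitaryM; last by apply: rot_unitary => //; have [] := ht ord_max.
by apply: IH => // k; exact: (ht (wid k)).
Qed.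

(** The product of the matrices by which the successive factors conjugate. Each factor
    is evaluated at the matrix that its predecessors have produced, whereas [rots]
    evaluates all factors at [A]. *)
Fixpoint rots_acc n (t : forall k : 'I_n, 'M[K]_k) (A : 'M[K]_n) (r : seq 'I_n) : 'M[K]_n :=
  if r is k :: r' then
    rots_acc t (rot_act (ltnW (ltn_ord k)) (t k) A) r' *m rot_in (ltnW (ltn_ord k)) (t k) A
  else 1%:M.

Lemma corner_herm n k (hk : (k <= n)%N) (A : 'M[K]_n) : A^t* = A ->
  (corner hk A)^t* = corner hk A.
Proof.
move=> hA; apply/matrixP => i j; rewrite adjE !mxE -{2}hA adjE //.
Qed.

Lemma extend_unitary n k (hk : (k <= n)%N) (W : 'M[K]_k) : W \is unitarymx ->
  extend 1 hk W \is unitarymx.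
Proof.
move=> hW; elim: n hk => [|n IH] hk.
  have e : k = 0%N by have := hk; rewrite leqn0 => /eqP.
  by subst k; rewrite extend_full.
case: (ltngtP k n.+1) => [kn|kn|e].
- by rewrite (extend_up 1 (kn : (k <= n)%N)); apply: up_unitary (conj11 K).
- by exfalso; have := hk; rewrite leqNgt kn.
- by subst k; rewrite extend_full.
Qed.

Lemma rot_in_unitary n k (hk : (k <= n)%N) (t : 'M[K]_k) (A : 'M[K]_n) :
  A^t* = A -> t \is unitarymx -> rot_in hk t A \is unitarymx.
Proof.
by move=> hA ht; apply: extend_unitary; apply: rot_unitary => //; exact: corner_herm.
Qed.

Lemma rot_act_herm n k (hk : (k <= n)%N) (t : 'M[K]_k) (A : 'M[K]_n) :
  A^t* = A -> t \is unitarymx -> (rot_act hk t A)^t* = rot_act hk t A.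
Proof.
move=> hA ht; rewrite /rot_act invmx_unitary; last exact: rot_in_unitary.
exact: conj_herm.
Qed.

Lemma foldl_acc n (t : forall k : 'I_n, 'M[K]_k) (A : 'M[K]_n) r :
  A^t* = A -> diag_unitaries t ->
  foldl (fun B (k : 'I_n) => rot_act (ltnW (ltn_ord k)) (t k) B) A r =
  rots_acc t A r *m A *m (rots_acc t A r)^t*.
Proof.
move=> hA ht; elim: r A hA => [|k r IH] A hA /=.
  by rewrite adj1 mul1mx mulmx1.
have [_ uk] := ht k.
rewrite IH; last exact: rot_act_herm.
rewrite adjM {2}/rot_act invmx_unitary; last exact: rot_in_unitary.
by rewrite !mulmxA.
Qed.

Lemma rots_acc_rcons n (t : forall k : 'I_n, 'M[K]_k) (A : 'M[K]_n) r k :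
  rots_acc t A (rcons r k) =
  rot_in (ltnW (ltn_ord k)) (t k)
    (foldl (fun B (k : 'I_n) => rot_act (ltnW (ltn_ord k)) (t k) B) A r) *m
  rots_acc t A r.
Proof.
elim: r A => [|j r IH] A /=; first by rewrite mul1mx mulmx1.
by rewrite IH mulmxA.
Qed.

Lemma rots_acc_wid n (t : forall k : 'I_n.+1, 'M[K]_k) (A : 'M[K]_n.+1) (r : seq 'I_n) :
  A^t* = A -> diag_unitaries t ->
  rots_acc t A (map (@wid n) r) = up 1 (rots_acc (restrict t) (cor A) r).
Proof.
move=> hA ht; elim: r A hA => [|k r IH] A hA /=; first by rewrite up1.
have hk : (k <= n)%N by exact: ltnW.
have [_ uk] := ht (wid k).
rewrite IH; last exact: rot_act_herm.
rewrite (rot_in_up (ltnW (ltn_ord k))) upM mulr1; congr (up 1 (_ *m _)).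
congr (rots_acc _ _ _).
rewrite /rot_act invmx_unitary; last exact: rot_in_unitary.
rewrite (rot_in_up (ltnW (ltn_ord k))) up_adj cor_upr cor_upl.
by rewrite invmx_unitary //; apply: rot_in_unitary => //; exact: herm_cor.
Qed.

(** If the smaller tori have conjugated by [X], then the next factor is the conjugate by
    [X] of its value at [A], so the accumulated
    product is [X] times that value. *)
Lemma rots_accE n (t : forall k : 'I_n, 'M[K]_k) (A : 'M[K]_n) :
  A^t* = A -> generic A -> diag_unitaries t ->
  rots_acc t A (enum 'I_n) = rots t A.
Proof.
elim: n t A => [|n IH] t A hA gA ht.
  by rewrite (size0nil (size_enum_ord 0)) /rots big_ord0.
have hB := herm_cor hA; have [iA gB] := gA.
have ht' : diag_unitaries (restrict t) by move=> k; exact: (ht (wid k)).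
rewrite enum_ordSr rots_acc_rcons foldl_acc // -/(map (@wid n) _) rots_acc_wid //.
rewrite IH // (rot_in_max _ (t ord_max)) up_adj cor_upr cor_upl.
have uX := rots_unitary hB ht'.
have [dn un] := ht ord_max.
rewrite rot_conj //; last exact: eig_cor_inj.
rewrite upM mulr1 -[in LHS](mulmxA _ (_^t* )) unitary_mulVl // mulmx1.
by rewrite rotsS.
Qed.

Lemma rots_actE n (t : forall k : 'I_n, 'M[K]_k) (A : 'M[K]_n) :
  A^t* = A -> generic A -> diag_unitaries t ->
  rots_act t A = rots t A *m A *m (rots t A)^t*.
Proof. by move=> hA gA ht; rewrite /rots_act foldl_acc // rots_accE. Qed.

Lemma rot_gam n (t B : 'M[K]_n) : is_diag_mx t -> B^t* = B -> injective (eig B) ->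
  rot t (gam B) = psi B *m rot t B *m (psi B)^t*.
Proof.
move=> dt hB iB; have hV := dia_unitary hB.
rewrite (@rot_spm _ t _ (dia B *m (psi B)^t* ) (fun i => expR (eig B i)) dt).
- by rewrite spm_mulr trmxCK /rot (diag_spm dt hV).
- exact: gam_herm.
- by move=> i j; rewrite !eig_gam // => /expR_inj /iB.
- exact: gam_frame.
- exact: gam_spm.
- exact: eig_gam.
Qed.

(** The recursions for [psi] and for [rots] match: [phi] is equivariant under the
    conjugation by the factors of [rots], and the factor of largest size commutes with
    the corner of [A]. *)
Lemma psi_rots n (t : forall k : 'I_n, 'M[K]_k) (A : 'M[K]_n) :
  A^t* = A -> generic A -> diag_unitaries t ->
  psi (rots t A *m A *m (rots t A)^t* ) = rots t (gam A) *m psi A *m (rots t A)^t*.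
Proof.
elim: n t A => [|n IH] t A hA gA ht.
  by rewrite /rots !big_ord0 /= mulmx1 mul1mx adj1.
have hB := herm_cor hA; have [iA gB] := gA.
have iB := eig_cor_inj hA iA.
have ht' : diag_unitaries (restrict t) by move=> k; exact: (ht (wid k)).
have [dn un] := ht ord_max.
rewrite !rotsS cor_gam // rot_gam //.
set X := rots (restrict t) (cor A); set rho := rot _ (cor A).
set Y := rots (restrict t) (gam _).
have uX : X \is unitarymx by exact: rots_unitary.
have ur : rho \is unitarymx by exact: rot_unitary.
have uXr : X *m rho \is unitarymx by exact: unitaryM.
have up_ := psi_unitary hB.
rewrite !psiS phi_equiv //; last exact: conj11.
have -> : cor (up 1 (X *m rho) *m A *m (up 1 (X *m rho))^t* ) = X *m cor A *m X^t*.
  have rc : rho *m cor A = cor A *m rho by exact: rot_comm.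
  rewrite up_adj cor_upr cor_upl adjM mulmxA -(mulmxA X rho) rc (mulmxA X).
  by rewrite -(mulmxA (X *m cor A)) unitary_mulV // mulmx1.
rewrite IH // -/Y -/X !mulmxA; congr (_ *m _); congr (_ *m _).
rewrite !upM !mulr1; congr (up 1 _).
rewrite -!mulmxA (mulmxA (X^t* )) unitary_mulVl // mul1mx.
by rewrite unitary_mulVl // mulmx1.
Qed.

Lemma cancel_frame n (X Y P E : 'M[K]_n) : X \is unitarymx ->
  Y *m P *m X^t* *m (X *m E *m X^t* ) *m (Y *m P *m X^t* )^t* =
  Y *m (P *m E *m P^t* ) *m Y^t*.
Proof.
move=> uX; rewrite adjM trmxCK adjM.
rewrite !mulmxA -(mulmxA (Y *m P)) unitary_mulVl // mulmx1.
by rewrite -(mulmxA (Y *m P *m E)) unitary_mulVl // mulmx1.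
Qed.

Lemma gam_rots n (t : forall k : 'I_n, 'M[K]_k) (A : 'M[K]_n) :
  A^t* = A -> generic A -> diag_unitaries t ->
  gam (rots t A *m A *m (rots t A)^t* ) = rots_act t (gam A).
Proof.
move=> hA gA ht; have uX := rots_unitary hA ht.
rewrite rots_actE //; [|exact: gam_herm|exact: generic_gam].
have hp := psi_rots hA gA ht; have he := expH_conj hA uX.
move: (rots t (gam A)) hp => Y hp; rewrite /gam hp he.
exact: cancel_frame.
Qed.

Lemma ord_last n (k : 'I_n.+1) : {(k < n)%N} + {n = k :> nat}.
Proof.
case: (ltnP k n) => h; [by left|right].
by apply/eqP; rewrite eqn_leq h -ltnS ltn_ord.
Qed.

Definition append n (t : forall k : 'I_n, 'M[K]_k) (D : 'M[K]_n) (k : 'I_n.+1) : 'M[K]_k :=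
  match ord_last k with
  | left h => t (Ordinal h)
  | right e => castmx (e, e) D
  end.

Lemma append_wid n (t : forall k : 'I_n, 'M[K]_k) D k : append t D (wid k) = t k.
Proof.
case: k => m hm; rewrite /append; case: ord_last => [h|e].
  by rewrite (bool_irrelevance h hm).
by exfalso; have := hm; rewrite [X in (_ < X)%N]e ltnn.
Qed.

Lemma append_max n (t : forall k : 'I_n, 'M[K]_k) D : append t D ord_max = D.
Proof.
rewrite /append; case: ord_last => [h|e]; first by exfalso; move: h; rewrite /= ltnn.
by rewrite (eq_axiomK e) castmx_id.
Qed.

Lemma adj_diag n (e : 'I_n -> K) :
  (diag_mx (\row_i e i))^t* = diag_mx (\row_i Num.conj (e i)).
Proof.
apply/matrixP => i j; rewrite adjE !mxE eq_sym.
by case: eqP => [->|_]; rewrite ?mulr1n ?mulr0n ?rmorph0.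
Qed.

(** The spectral projections of a real matrix are real, so each eigenvector becomes
    real after multiplication by a phase. *)
Lemma real_frame n (S : 'M[K]_n) : S^t* = S -> map_mx Num.conj S = S ->
  injective (eig S) ->
  exists e : 'I_n -> K, (forall i, e i * Num.conj (e i) = 1) /\
    map_mx Num.conj (diag_mx (\row_i e i) *m dia S) = diag_mx (\row_i e i) *m dia S.
Proof.
move=> hS rS iS; have hV := dia_unitary hS; set V := dia S in hV *.
have proj_real i a b : Num.conj (Num.conj (V i a) * V i b) = Num.conj (V i a) * V i b.
  have hVc : map_mx Num.conj V \is unitarymx by rewrite conjC_unitary.
  pose f (j : 'I_n) : K := (j == i)%:R.
  have sE (U : 'M[K]_n) c d : spm U f c d = Num.conj (U i c) * U i d.
    rewrite spmE (bigD1 i) //= /f eqxx mulr1 big1 ?addr0 // => j ji.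
    by rewrite (negbTE ji) mulr0.
  have : spm (map_mx Num.conj V) f = spm V f.
    apply: (spm_calc (x := fun i => (eig S i)%:K) (y := fun i => (eig S i)%:K)) => //.
      rewrite dia_eq // -{2}rS -{2}(dia_eq hS) spm_conj.
      by apply: eq_spm => j; rewrite conjK.
    by move=> j k /inj_ofR /iS ->.
  move=> /matrixP /(_ a b); rewrite !sE !mxE => h.
  by rewrite rmorphM /= conjCK -h conjCK.
have nz i : exists a, V i a != 0.
  apply/not_existsP => h; have := unitary_mulV hV => /matrixP /(_ i i).
  rewrite !mxE eqxx big1 => [/eqP|a _]; first by rewrite eq_sym oner_eq0.
  by have /negP := h a; rewrite negbK => /eqP ->; rewrite mul0r.
have [a ha] := choice nz.
exists (fun i => Num.conj (phase (V i (a i)))); split.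
  by move=> i; rewrite conjCK mulrC phase_unit.
apply/matrixP => i b; rewrite mul_diag_mx !mxE.
rewrite /phase (negbTE (ha i)) !rmorphM !fmorphV /= !conjK conjCK.
have h := proj_real i (a i) b; rewrite rmorphM /= conjCK in h.
by rewrite mulrAC h mulrAC.
Qed.

(** By induction the corner can be made real. The next torus then multiplies the
    coordinates of the last column in a real eigenbasis of the corner by arbitrary
    phases, so it can make the last column real as well. *)
Lemma generic_orbit n (A : 'M[K]_n) : A^t* = A -> generic A ->
  exists (t : forall k : 'I_n, 'M[K]_k) (S : 'M[K]_n), diag_unitaries t /\
  [/\ S^t* = S, map_mx Num.conj S = S, generic S & rots_act t S = A].
Proof.
suff H m (B : 'M[K]_m) : B^t* = B -> generic B ->
  exists (t : forall k : 'I_m, 'M[K]_k) (S : 'M[K]_m), diag_unitaries t /\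
  [/\ S^t* = S, map_mx Num.conj S = S, generic S & rots t S *m S *m (rots t S)^t* = B].
  move=> hA gA; have [t [S [ht [h1 h2 h3 h4]]]] := H n A hA gA.
  by exists t, S; split => //; split => //; rewrite rots_actE.
elim: m B => [|m IH] B hB gB.
  exists (fun k => 1%:M), B; split; first by case.
  by split => //; [apply/matrixP; case|apply/matrixP; case].
have hC := herm_cor hB; have [iB gC] := gB.
have [t' [S' [ht' [hS' rS' gS' eS']]]] := IH (cor B) hC gC.
have iS' : injective (eig S') by exact: generic_eig_inj.
have [e [he rO]] := real_frame hS' rS' iS'.
have hV := dia_unitary hS'; set V := dia S' in hV rO.
set O := diag_mx (\row_i e i) *m V in rO.
have uO : O \is unitarymx by apply: unitaryM => //; exact: diag_unitary.
set X := rots t' S' in eS'.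
have uX : X \is unitarymx by exact: rots_unitary.
pose c := \col_i B (wid i) ord_max.
pose b := O *m X^t* *m c.
pose tau i := phase (b i 0).
have htau i : tau i * Num.conj (tau i) = 1 by exact: phase_unit.
pose D := diag_mx (\row_i tau i).
have uD : D \is unitarymx by exact: diag_unitary.
have dD : is_diag_mx D by exact: diag_mx_is_diag.
have eSO : S' = spm O (fun i => (eig S' i)%:K).
  rewrite -{1}(dia_eq hS') -/V.
  have -> : spm O (fun i => (eig S' i)%:K) = V^t* *m ((diag_mx (\row_i e i))^t* *m
      diag_mx (\row_i (eig S' i)%:K) *m diag_mx (\row_i e i)) *m V.
    by rewrite /spm /O adjM !mulmxA.
  rewrite adj_diag.
  rewrite !diag_rowM /spm; congr (_ *m diag_mx _ *m _).
  apply/rowP => i; rewrite !mxE -[LHS]mul1r -(he i).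
  by ring.
have erho : rot D S' = O^t* *m D *m O.
  rewrite (rot_spm dD hS' iS' uO eSO (fun=> erefl)) /spm; congr (_ *m _ *m _).
  by apply/matrixP => i j; rewrite !mxE eqxx mulr1n.
set rho := rot D S' in erho.
have ur : rho \is unitarymx by exact: rot_unitary.
pose W := X *m rho.
have uW : W \is unitarymx by exact: unitaryM.
pose S := (up 1 W)^t* *m B *m up 1 W.
have hS : S^t* = S by rewrite /S !adjM trmxCK hB mulmxA.
have uup : up 1 W \is unitarymx by exact: up_unitary uW (conj11 K).
have cS : cor S = S'.
  rewrite /S up_adj cor_upr cor_upl -eS' /W.
  have rc : rho *m S' = S' *m rho by exact: rot_comm.
  move: rho ur rc {W uW S hS uup erho} => r ur rc; rewrite adjM.
  rewrite !mulmxA -(mulmxA _ (X^t* ) X) unitary_mulVl // mulmx1.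
  rewrite -(mulmxA _ (X^t* ) X) unitary_mulVl // mulmx1.
  by rewrite -mulmxA -rc mulmxA unitary_mulVl // mul1mx.
have eB : B = up 1 W *m S *m (up 1 W)^t*.
  rewrite /S !mulmxA unitary_mulV // mul1mx -mulmxA unitary_mulV //.
  by rewrite mulmx1.
have colS i : Num.conj (S (wid i) ord_max) = S (wid i) ord_max.
  have e1 : \col_i S (wid i) ord_max = W^t* *m c.
    apply/matrixP => k l; rewrite mxE /S up_adj mul_up_max mulr1 up_mul_wid mxE.
    by apply: eq_bigr => q _; congr (_ * _); rewrite mxE.
  have e2 : W^t* *m c = O^t* *m (D^t* *m b).
    have h (o r d : 'M[K]_m) (v : 'cV[K]_m) : r = o^t* *m d *m o ->
        (X *m r)^t* *m v = o^t* *m (d^t* *m (o *m X^t* *m v)).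
      by move=> ->; rewrite !adjM trmxCK !mulmxA.
    exact: h.
  have e3 : D^t* *m b = \col_i (cxmod (b i 0))%:K.
    rewrite /D adj_diag mul_diag_mx; apply/matrixP => k l.
    by rewrite [LHS]mxE [X in X * _]mxE [RHS]mxE (ord1 l) phase_real.
  have e4 : map_mx Num.conj (\col_i S (wid i) ord_max) = \col_i S (wid i) ord_max.
    rewrite e1 e2 e3 conjmxM -adj_conj rO; congr (_ *m _).
    by apply/matrixP => k l; rewrite !mxE conjK.
  by have /matrixP /(_ i 0) := e4; rewrite !mxE.
exists (append t' D), S; split.
  move=> k; rewrite /append; case: ord_last => [h|ek]; first exact: (ht' (Ordinal h)).
  by case: _ / ek; rewrite castmx_id.
have et : restrict (append t' D) = t'.
  by apply: functional_extensionality_dep => k; rewrite /restrict append_wid.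
have erots : rots (append t' D) S = up 1 W.
  by rewrite rotsS et append_max cS.
split => //.
- apply: eq_up => [i j|i|i|]; rewrite [LHS]mxE.
  + by rewrite -corE cS -{2}rS' mxE.
  + exact: colS.
  + by rewrite (herm_entry _ _ hS) -(herm_entry _ _ hS) -(herm_entry _ _ hS) !colS.
  + exact: herm_entry.
- split; last by rewrite cS.
  move=> i; have := iB i; rewrite {1 3}eB eB.
  have -> : cor (up 1 W *m S *m (up 1 W)^t* ) = W *m cor S *m W^t*.
    by rewrite up_adj cor_upr cor_upl.
  by rewrite !eig_conj //; exact: herm_cor.
- by rewrite erots -eB.
Qed.

End TorusAction.

(** * Gelfand-Zeitlin patterns and a path from A to gamma(A) *)

Section GelfandZeitlin.
Variables (R : realType) (K : complexes R).

(** The condition in [Herm0], with all corners at once. *)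
Definition strictly_interlaced n (A : 'M[K]_n) : Prop :=
  forall k (hk : (k < n)%N) (i : 'I_k),
    eig (corner hk A) (wid i) < eig (corner (ltnW hk) A) i
      < eig (corner hk A) (lift ord0 i).

Lemma strictly_interlacedP n (A : 'M[K]_n) : strictly_interlaced A <-> generic A.
Proof.
elim: n A => [|n IH] A; first by split=> // _ k hk; exfalso; have := hk.
split=> [h|[iA /IH hC]].
  split=> [i|].
    have := h n (ltnSn n) i; rewrite corner_full /cor.
    by rewrite (bool_irrelevance (ltnW (ltnSn n)) (leqnSn n)).
  apply/IH => k hk i; have hk' : (k < n.+1)%N by exact: ltnW.
  have := h k hk' i.
  by rewrite (corner_corner hk) (corner_corner (ltnW hk)).
move=> k hk; case: (ltngtP k n) => [kn|kn|e] i.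
- by rewrite (corner_corner (kn : (k < n)%N)) (corner_corner (ltnW kn)); exact: hC.
- by exfalso; have := hk; rewrite ltnS leqNgt kn.
- subst k; rewrite corner_full (bool_irrelevance (ltnW hk) (leqnSn n)).
  exact: iA.
Qed.

Lemma eig_corner_gam n k (hk : (k <= n)%N) (A : 'M[K]_n) : A^t* = A ->
  eig (corner hk (gam A)) =1 fun i => expR (eig (corner hk A) i).
Proof.
elim: n hk A => [|n IH] hk A hA.
  have e : k = 0%N by have := hk; rewrite leqn0 => /eqP.
  by subst k; case.
case: (ltngtP k n.+1) => [kn|kn|e].
- rewrite !(corner_corner (kn : (k <= n)%N)) cor_gam //.
  by apply: IH; exact: herm_cor.
- by exfalso; have := hk; rewrite leqNgt kn.
- by subst k; rewrite !corner_full; exact: eig_gam.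
Qed.

Lemma extend0_herm n k (hk : (k <= n)%N) (A : 'M[K]_k) : A^t* = A ->
  (extend 0 hk A)^t* = extend 0 hk A.
Proof.
move=> hA; elim: n hk => [|n IH] hk.
  have e : k = 0%N by have := hk; rewrite leqn0 => /eqP.
  by subst k; rewrite extend_full.
case: (ltngtP k n.+1) => [kn|kn|e].
- by rewrite (extend_up 0 (kn : (k <= n)%N)) up_adj rmorph0 IH.
- by exfalso; have := hk; rewrite leqNgt kn.
- by subst k; rewrite extend_full.
Qed.

Lemma psi_extend n k (hk : (k <= n)%N) (A : 'M[K]_k) : A^t* = A ->
  psi (extend 0 hk A) = extend 1 hk (psi A).
Proof.
move=> hA; elim: n hk => [|n IH] hk.
  have e : k = 0%N by have := hk; rewrite leqn0 => /eqP.
  by subst k; rewrite !extend_full.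
case: (ltngtP k n.+1) => [kn|kn|e].
- rewrite (extend_up 0 (kn : (k <= n)%N)) (extend_up 1 (kn : (k <= n)%N)).
  by rewrite psi_up ?IH //; exact: extend0_herm.
- by exfalso; have := hk; rewrite leqNgt kn.
- by subst k; rewrite !extend_full.
Qed.

Lemma expH_real n (A : 'M[K]_n) : A^t* = A ->
  map_mx Num.conj (expH A) = expH (map_mx Num.conj A).
Proof.
move=> hA.
have hA' : (map_mx Num.conj A)^t* = map_mx Num.conj A by rewrite adj_conj hA.
rewrite /expH spm_conj.
rewrite (eq_spm _ (g := fun i => (expR (eig A i))%:K)); last by move=> i; rewrite conjK.
apply: (spm_calc (x := fun i => (eig A i)%:K)
  (y := fun i => (eig (map_mx Num.conj A) i)%:K)).
- by rewrite conjC_unitary dia_unitary.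
- exact: dia_unitary.
- rewrite dia_eq // -[in RHS](dia_eq hA) spm_conj.
  by apply: eq_spm => i; rewrite conjK.
- by move=> i j /inj_ofR ->.
Qed.

Lemma gam_conj n (A : 'M[K]_n) : A^t* = A ->
  map_mx Num.conj (gam A) = gam (map_mx Num.conj A).
Proof.
move=> hA; rewrite /gam (conjmxM (psi A *m expH A)) (conjmxM (psi A)).
by rewrite -adj_conj psi_conj // expH_real.
Qed.

Lemma herm_affine n (A : 'M[K]_n) (c d : R) : A^t* = A ->
  (c%:K *: A + d%:K%:M)^t* = c%:K *: A + d%:K%:M.
Proof.
move=> hA; rewrite adjD; congr (_ + _); first by rewrite linearZ /= map_mxZ /= conjK hA.
by rewrite tr_scalar_mx map_scalar_mx /= conjK.
Qed.

Lemma spm_affine n (U : 'M[K]_n) (f : 'I_n -> R) (c d : R) : U \is unitarymx ->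
  spm U (fun i => (c * f i + d)%:K) = c%:K *: spm U (fun i => (f i)%:K) + d%:K%:M.
Proof.
move=> hU; rewrite -spm_scale.
have -> : d%:K%:M = spm U (fun=> d%:K).
  rewrite (eq_spm _ (g := fun=> d%:K * 1)); last by move=> ?; rewrite mulr1.
  by rewrite spm_scale spm1 // scalemx1.
apply/matrixP => i j; rewrite [RHS]mxE !spmE -big_split; apply: eq_bigr => k _ /=.
by rewrite rmorphD rmorphM /= [LHS]mulrDr.
Qed.

Lemma eig_affine n (A : 'M[K]_n) (c d : R) : A^t* = A -> 0 <= c ->
  eig (c%:K *: A + d%:K%:M) =1 fun i => c * eig A i + d.
Proof.
move=> hA c0; have hU := dia_unitary hA.
have -> : c%:K *: A + d%:K%:M = spm (dia A) (fun i => (c * eig A i + d)%:K).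
  rewrite spm_affine //.
  by rewrite dia_eq.
apply: eig_spm => // i j ij; rewrite lerD2r ler_wpM2l //.
exact: eig_homo.
Qed.

Lemma generic_affine n (A : 'M[K]_n) (c d : R) : A^t* = A -> 0 < c ->
  generic A -> generic (c%:K *: A + d%:K%:M).
Proof.
move=> + c0; elim: n A => [|n IH] A hA //= [iA gA].
have hC := herm_cor hA.
have e : cor (c%:K *: A + d%:K%:M) = c%:K *: cor A + d%:K%:M.
  by apply/matrixP => i j; rewrite !mxE (inj_eq (@wid_inj n)).
split; last by rewrite e; exact: IH.
move=> i; rewrite e !eig_affine ?ltW //.
by have /andP[h1 h2] := iA i; rewrite !ltrD2r !ltr_pM2l // h1.
Qed.

Lemma lip_expdd0 (l : R) : path_lip (fun s => ofR K (l * expdd [:: s * l; 0] + s)).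
Proof.
have bd s : unit_interval s -> `|s * l| <= `|l|.
  by move=> /andP[s0 s1]; rewrite normrM ger0_norm // ler_piMl.
pose e := expR `|l|; have e0 : 0 <= e by exact: expR_ge0.
exists (`|l| * e + `|l| * `|l| * e + 1); split.
- by rewrite !addr_ge0 ?mulr_ge0.
- move=> s hs; rewrite cxmod_ofR; apply: le_trans (ler_normD _ _) _.
  rewrite lerD //; last by have /andP[s0 s1] := hs; rewrite ger0_norm.
  rewrite normrM -[leLHS]addr0 lerD ?mulr_ge0 // ler_wpM2l //.
  apply: expdd_bound => // x; rewrite !inE => /orP[|] /eqP ->; first exact: bd.
  by rewrite normr0.
- move=> d s t hs ht hst; have d0 := near_real_ge0 hst.
  rewrite -rmorphB cxmod_ofR.
  have -> : l * expdd [:: s * l; 0] + s - (l * expdd [:: t * l; 0] + t) =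
      l * (expdd [:: s * l; 0] - expdd [:: t * l; 0]) + (s - t) by ring.
  rewrite expdd_diff.
  have -> : l * ((s * l - t * l) * expdd [:: s * l, t * l & [:: 0]]) =
    (l * l * expdd [:: s * l, t * l & [:: 0]]) * (s - t) by ring.
  apply: le_trans (ler_normD _ _) _; rewrite mulrDl mul1r lerD //.
  rewrite normrM ler_pM // !normrM -[leLHS]add0r lerD ?mulr_ge0 //.
  rewrite ler_wpM2l ?mulr_ge0 //.
  apply: expdd_bound => // x; rewrite !inE => /or3P[] /eqP ->; [exact: bd|exact: bd|].
  by rewrite normr0.
Qed.

Lemma herm_scale n (B : 'M[K]_n) (s : R) : B^t* = B -> (s%:K *: B)^t* = s%:K *: B.
Proof. by move=> hB; rewrite linearZ /= map_mxZ /= conjK hB. Qed.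

(** A path from [B] to [gam B]: the matrices [(gam (s B) - 1) / s] converge to [B] for
    [s] going to [0], and adding [s] brings the end point back to [gam B]. The formula
    writes this without the quotient, so that it covers [s = 0]. *)
Definition scaling_path n (B : 'M[K]_n) (s : R) : 'M[K]_n :=
  psi (s%:K *: B) *m
  spm (dia B) (fun i => (eig B i * expdd [:: s * eig B i; 0] + s)%:K) *m
  (psi (s%:K *: B))^t*.

Lemma scaling_path0 n (B : 'M[K]_n) : B^t* = B -> scaling_path B 0 = B.
Proof.
move=> hB; rewrite /scaling_path rmorph0 scale0r psi0 adj1 mul1mx mulmx1.
rewrite -[RHS](dia_eq hB); apply: eq_spm => i.
by rewrite mul0r expddxx expR0 mulr1 addr0.
Qed.

Lemma scaling_pathE n (B : 'M[K]_n) (s : R) : B^t* = B -> 0 < s ->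
  scaling_path B s = (s^-1)%:K *: gam (s%:K *: B) + (s - s^-1)%:K%:M.
Proof.
move=> hB s0; have hsB := herm_scale s hB.
have up := psi_unitary hsB; have hU := dia_unitary hB.
have e1 : expH (s%:K *: B) = spm (dia B) (fun i => (expR (s * eig B i))%:K).
  apply: (spm_calc (x := fun i => (eig (s%:K *: B) i)%:K)
                   (y := fun i => (s * eig B i)%:K)) => //.
  - exact: dia_unitary.
  - rewrite dia_eq // -{1}(dia_eq hB) -spm_scale.
    by apply: eq_spm => i; rewrite rmorphM.
  - by move=> i j /inj_ofR ->.
rewrite /scaling_path.
have -> : spm (dia B) (fun i => (eig B i * expdd [:: s * eig B i; 0] + s)%:K) =
  (s^-1)%:K *: expH (s%:K *: B) + (s - s^-1)%:K%:M.
  rewrite e1 -spm_affine //; apply: eq_spm => k; congr (_%:K).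
  have := expdd2_diff (s * eig B k) 0; rewrite subr0 expR0 => h.
  have -> : expR (s * eig B k) = s * eig B k * expdd [:: s * eig B k; 0] + 1.
    by rewrite h subrK.
  by field; rewrite gt_eqF.
rewrite mulmxDr mulmxDl -scalemxAr -scalemxAl; congr (_ + _).
by rewrite mul_mx_scalar -scalemxAl unitary_mulV // scalemx1.
Qed.

Lemma scaling_path1 n (B : 'M[K]_n) : B^t* = B -> scaling_path B 1 = gam B.
Proof.
move=> hB; rewrite scaling_pathE // invr1 subrr rmorph1 rmorph0 !scale1r.
by rewrite -scalemx1 scale0r addr0.
Qed.

(** For positive [s] the pattern is an increasing affine image of that of [gam (s B)]. *)
Lemma scaling_path_in n (B : 'M[K]_n) (s : R) : B^t* = B ->
  map_mx Num.conj B = B -> generic B -> 0 <= s ->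
  [/\ (scaling_path B s)^t* = scaling_path B s,
      map_mx Num.conj (scaling_path B s) = scaling_path B s
    & generic (scaling_path B s)].
Proof.
move=> hB rB gB; rewrite le_eqVlt => /orP[/eqP <-|s0].
  by rewrite scaling_path0.
have hsB := herm_scale s hB; rewrite scaling_pathE //.
have hg := gam_herm hsB.
have gsB : generic (s%:K *: B).
  have := generic_affine 0 hB s0 gB.
  by rewrite rmorph0 -scalemx1 scale0r addr0.
split; first exact: herm_affine.
- rewrite map_mxD map_mxZ /= conjK gam_conj // map_mxZ /= conjK rB.
  by rewrite map_scalar_mx /= conjK.
- by apply: generic_affine => //; [rewrite invr_gt0|exact: generic_gam].
Qed.

Lemma scaling_path_lip n (B : 'M[K]_n) i j : B^t* = B ->
  path_lip (fun s => scaling_path B s i j).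
Proof.
move=> hB; have n0 := @near_real_ge0 R.
have lp a b : path_lip (fun s => psi (s%:K *: B) a b).
  by apply: (path_lip_line (F := fun A => psi A a b)) => //; exact: loc_lip_psi.
have lq a b : path_lip (fun s => (psi (s%:K *: B))^t* a b).
  apply: (lip_ext (F := fun s => Num.conj (psi (s%:K *: B) b a))).
    by move=> s _; rewrite adjE.
  exact: (lip_conj (lp b a)).
apply: (lip_ext (F := fun s => \sum_b (\sum_a psi (s%:K *: B) i a *
  spm (dia B) (fun i => (eig B i * expdd [:: s * eig B i; 0] + s)%:K) a b) *
  (psi (s%:K *: B))^t* b j)).
  by move=> s _; rewrite /scaling_path mxE; apply: eq_bigr => b _; congr (_ * _); rewrite mxE.
apply: (lip_sum n0) => b _; apply: lip_mul; last exact: lq.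
apply: (lip_sum n0) => a _; apply: lip_mul; first exact: lp.
apply: (lip_ext (F := fun s => \sum_k (Num.conj (dia B k a) * dia B k b) *
    (eig B k * expdd [:: s * eig B k; 0] + s)%:K)).
  by move=> s _; rewrite spmE.
apply: (lip_sum n0) => k _; apply: lip_mul; last exact: lip_expdd0.
exact: (lip_cst _ n0).
Qed.

End GelfandZeitlin.

(** * Real symmetric matrices and the instance R[i] *)

Section RealSymmetric.
Variable C : numClosedFieldType.

Lemma realmxP n (A : 'M[C]_n) : A \is a realmx <-> map_mx Num.conj A = A.
Proof.
split=> [h|h]; first exact: realmxC.
by apply/mxOverP => i j; rewrite CrealE -[in X in _ == X]h mxE.
Qed.

Lemma symmetricP n (A : 'M[C]_n) : A \is symmetricmx <-> A^T = A.
Proof.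
split; first by move/is_hermitianmxP; rewrite expr0 scale1r map_mx_id // => <-.
by move=> h; apply/is_hermitianmxP; rewrite expr0 scale1r map_mx_id.
Qed.

Lemma real_symmetricP n (A : 'M[C]_n) :
  A \is symmetricmx /\ A \is a realmx <->
  A \is hermsymmx /\ map_mx Num.conj A = A.
Proof.
split=> [[/symmetricP h1 /realmxP h2]|[/hermitianP h1 h2]].
  by split=> //; apply/hermitianP; rewrite h1.
have h3 : A^T = A by rewrite -[in LHS]h2 map_trmx.

by split; [apply/symmetricP|apply/realmxP].
Qed.

End RealSymmetric.

Section Instance.
Variable R : realType.

Lemma diag_eq (n : nat) (A : 'M[R[i]]_n) : A^t* = A ->
  A = spm (diagonalizer A) (fun i => (eigval A i)%:C).
Proof. by move/hermP => hA; exact: (diagonalizer_eq hA). Qed.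

Lemma diag_unit (n : nat) (A : 'M[R[i]]_n) : A^t* = A ->
  diagonalizer A \is unitarymx.
Proof. by move/hermP => hA; exact: (diagonalizer_unitary hA). Qed.

Lemma eigval_sort (n : nat) (A : 'M[R[i]]_n) : A^t* = A ->
  {homo @eigval R n A : i j / (i <= j)%N >-> i <= j}.
Proof. by move/hermP => hA; exact: (eigval_homo hA). Qed.

Lemma conj_realC (x : R) : Num.conj (real_complex R x) = real_complex R x.
Proof. exact: conj_real. Qed.

Lemma le_realC (x y : R) : (real_complex R x <= real_complex R y) = (x <= y).
Proof. exact: lecR. Qed.

Definition cx : complexes R :=
  @Complexes R R[i] (real_complex R) (@cmod R) (@eigval R) (@diagonalizer R)
    conj_realC le_realC (@cmodE R) diag_unit diag_eq
    eigval_sort (fun n U x hU hx => eigval_eq hU hx)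
    (fun n U x hU => eigval_perm x hU).

Lemma rots_act_tori n (t : forall k : 'I_n, 'M[R[i]]_k) (A : 'M[R[i]]_n) :
  tori_act t A = rots_act (K := cx) t A.
Proof. reflexivity. Qed.

Lemma Herm0P n (A : 'M[R[i]]_n) : Herm0 A <-> Herm A /\ generic (K := cx) A.
Proof.
split=> -[hA h]; split => //; first by apply/(strictly_interlacedP (K := cx)).
exact: (iffRL (strictly_interlacedP (K := cx) A) h).
Qed.

Lemma SymP n (A : 'M[R[i]]_n) : Sym A <-> Herm A /\ map_mx Num.conj A = A.
Proof. exact: real_symmetricP. Qed.

Lemma SOn_intro n (U : 'M[R[i]]_n) : U \is unitarymx -> \det U = 1 ->
  map_mx Num.conj U = U -> SOn U.
Proof.
move=> uU dU rU; split => //; first by apply/realmxP.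
by rewrite -(unitary_mulV uU) -map_trmx rU.
Qed.

End Instance.

(** * The topology of complex matrices *)

Section MatrixTopology.
Variable R : realType.
Local Notation C := R[i].

Definition near_mx n (e : R) (A B : 'M[C]_n) := forall i j, cmod (A i j - B i j) < e.

Lemma nbhs_mxP n (A : 'M[C]_n) (S : set 'M[C]_n) :
  nbhs A S <-> exists2 e : R, 0 < e & forall B, near_mx e A B -> S B.
Proof.
split=> [/nbhs_ballP [e /= e0 h]|[e e0 h]].
  have er : e = (complex.Re e)%:C by rewrite RRe_real // gtr0_real.
  rewrite er ltcR in e0.
  exists (complex.Re e) => // B hB; apply: h; split; first by rewrite er ltcR.
  by move=> i j; rewrite -ball_normE /= er -cmodE ltcR.
apply/nbhs_ballP; exists (e%:C) => /=; first by rewrite ltcR.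
move=> B [_ hB]; apply: h => i j.
by have := hB i j; rewrite -ball_normE /= -cmodE ltcR.
Qed.

Lemma mx_hausdorff n : hausdorff_space 'M[C]_n.
Proof.
move=> A B hAB; apply/matrixP => i j; apply/eqP; rewrite -subr_eq0; apply/eqP.
apply: (@cxmod_eq0 R (cx R)).
apply/eqP; rewrite eq_le; apply/andP; split; last exact: (@cxmod_ge0 R (cx R)).
apply/ler_addgt0Pr => e e0; rewrite add0r.
have e2 : 0 < e / 2 by rewrite divr_gt0.
have nA (D : 'M[C]_n) : nbhs D (near_mx (e / 2) D).
  by apply/nbhs_mxP; exists (e / 2).
have [D [h1 h2]] := hAB _ _ (nA A) (nA B).
have -> : A i j - B i j = (A i j - D i j) + (D i j - B i j) by rewrite addrA subrK.
apply: le_trans (@cxmodD R (cx R) _ _) _; rewrite [leRHS](splitr e) lerD //.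
  exact: ltW (h1 i j).
by rewrite (@cxmodB R (cx R)); exact: ltW (h2 i j).
Qed.

Lemma within_mxP n (D : set 'M[C]_n) (F : 'M[C]_n -> 'M[C]_n) :
  {within D, continuous F} <->
  forall A, D A -> forall e, 0 < e -> exists2 d, 0 < d &
    forall B, D B -> near_mx d A B -> near_mx e (F A) (F B).
Proof.
split=> [/subspace_continuousP h A DA e e0|h].
  have /(h A DA) : nbhs (F A) (near_mx e (F A)) by apply/nbhs_mxP; exists e.
  rewrite /= nbhs_simpl /= /within /= => /nbhs_mxP [d d0 hd].
  by exists d => // B DB hB; apply: hd.
apply/subspace_continuousP => A DA S /= /nbhs_mxP [e e0 he].
rewrite nbhs_simpl /= /within /=; apply/nbhs_mxP.
have [d d0 hd] := h A DA e e0.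
by exists d => // B hB DB; apply: he; exact: hd.
Qed.

Lemma loc_lip_near n (F : 'M[C]_n -> C) : loc_lip (K := cx R) F ->
  forall A, Herm A -> forall e, 0 < e -> exists2 d, 0 < d &
    forall B, Herm B -> near_mx d A B -> cmod (F A - F B) < e.
Proof.
move=> hF A /hermP hA e e0; have [M M0 bA] := @bounded_ex R (cx R) _ _ A.
have [K [K0 _ hK]] := hF (M + 1).
have K1 : 0 < K + 1 by exact: ltr_wpDl.
exists (Num.min 1 (e / (K + 1))).
  by rewrite lt_min ltr01 divr_gt0.
move=> B /hermP hB hAB.
have bA' : herm_ball (K := cx R) (M + 1) A.
  by split=> // i j; apply: le_trans (bA i j) _; rewrite lerDl.
have bB : herm_ball (K := cx R) (M + 1) B.
  split=> // i j; have -> : B i j = A i j + (B i j - A i j) by rewrite addrC subrK.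
  apply: le_trans (@cxmodD R (cx R) _ _) _; rewrite lerD //.
  rewrite (@cxmodB R (cx R)); apply: ltW; apply: lt_le_trans (hAB i j) _.
  by rewrite ge_min lexx.
have h : close_by (K := cx R) (e / (K + 1)) A B.
  split; first by rewrite divr_ge0 ?ltW.
  by move=> i j; apply: ltW; apply: lt_le_trans (hAB i j) _; rewrite ge_min lexx orbT.
apply: le_lt_trans (hK _ _ _ bA' bB h) _.
rewrite mulrCA -[ltRHS]mulr1 ltr_pM2l // ltr_pdivrMr // mul1r.
by rewrite ltrDl.
Qed.

(** A common radius for finitely many conditions. *)
Lemma ffin_min (I : finType) (P : I -> R -> Prop) :
  (forall i (d d' : R), 0 < d' -> d' <= d -> P i d -> P i d') ->
  (forall i, exists2 d, 0 < d & P i d) -> exists2 d, 0 < d & forall i, P i d.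
Proof.
move=> mono hP.
have /choice [f hf] : forall i, exists d, 0 < d /\ P i d.
  by move=> i; have [d d0 hd] := hP i; exists d.
have f0 : 0 < \big[Num.min/(1 : R)]_i f i.
  by apply: lt_bigmin => // i _; have [] := hf i.
exists (\big[Num.min/(1 : R)]_i f i) => //.
move=> i; have [fi hi] := hf i; apply: mono hi => //; exact: bigmin_le.
Qed.

Lemma within_lip n (F : 'M[C]_n -> 'M[C]_n) :
  (forall i j, loc_lip (K := cx R) (fun A => F A i j)) ->
  {within @Herm R n, continuous F}.
Proof.
move=> hF; apply/within_mxP => A hA e e0.
have [d d0 hd] := @ffin_min ('I_n * 'I_n)%type
  (fun p d => forall B, Herm B -> near_mx d A B -> cmod (F A p.1 p.2 - F B p.1 p.2) < e)
  (fun p d d' _ dd h B hB hAB => h B hB (fun i j => lt_le_trans (hAB i j) dd))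
  (fun p => loc_lip_near (hF p.1 p.2) hA e0).
by exists d => // B hB hAB i j; exact: (hd (i, j)).
Qed.

Lemma within_lip_real n (f : C -> R) (F : 'M[C]_n -> C) :
  (forall z w, `|f z - f w| <= cmod (z - w)) -> loc_lip (K := cx R) F ->
  {within @Herm R n, continuous (fun A => f (F A))}.
Proof.
move=> hf hF; apply/subspace_continuousP => A hA; apply/cvgrPdist_lt => e e0.
rewrite near_withinE; have [d d0 hd] := loc_lip_near hF hA e0.
apply/nbhs_mxP; exists d => // B hAB hB.
by apply: le_lt_trans (hf _ _) _; exact: hd.
Qed.

End MatrixTopology.

(** * Smoothness on Herm(n) and the matrix exponential *)

Section Smoothness.
Variable R : realType.
Local Notation C := R[i].

(** A quadratic error term is small after division by [t]. *)
Lemma is_derive_quadratic (f : R -> R) (g : R) (C : R) :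
  (forall t, `|t| <= 1 -> `|f t - f 0 - t * g| <= C * t ^+ 2) ->
  is_derive (0 : R) (1 : R) f g.
Proof.
move=> h.
have lim : (fun t : R => t^-1 *: (f (t *: 1 + 0) - f 0)) @ 0^' --> g.
  apply/cvgrPdist_le => e e0.
  have C1 : 0 < `|C| + 1 by exact: ltr_wpDl.
  rewrite near_withinE; apply/nbhs_ballP; exists (Num.min 1 (e / (`|C| + 1))) => /=.
    by rewrite lt_min ltr01 divr_gt0.
  move=> t; rewrite -ball_normE /= sub0r normrN lt_min => /andP[t1 t2] t0.
  have tn0 : 0 < `|t| by rewrite normr_gt0.
  have -> : g - t^-1 *: (f (t *: 1 + 0) - f 0) = - (t^-1 * (f t - f 0 - t * g)).
    rewrite addr0 /GRing.scale /= mulr1; field.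
    by [].
  rewrite normrN normrM normfV mulrC ler_pdivrMr //.
  apply: le_trans (h t (ltW t1)) _.
  rewrite -real_normK ?num_real // expr2 mulrA ler_wpM2r //.
  apply: le_trans (_ : (`|C| + 1) * `|t| <= _).
    by rewrite ler_wpM2r // (le_trans (ler_norm C)) // lerDl.
  by rewrite mulrC -ler_pdivlMr // ltW.
apply: DeriveDef; first by apply/cvg_ex; exists g.
exact: cvg_lim.
Qed.

Lemma smoothM_Cm n m (f : {additive C -> R}) (F : 'M[C]_n -> C) :
  (forall z, `|f z| <= cmod z) -> (forall (t : R) z, f (t%:C * z) = t * f z) ->
  smoothM (K := cx R) m F -> Cm_on_Herm m (fun A => f (F A)).
Proof.
move=> fle fZ; elim: m F => [|m IH] F [lF dF].
  split => //; apply: within_lip_real lF => z w; rewrite -raddfB; exact: fle.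
split.
  by apply: within_lip_real lF => z w; rewrite -raddfB; exact: fle.
move=> H /hermP hH; have [G [sG dG]] := dF H hH.
exists (fun A => f (G A)); split; first exact: IH.
move=> A /hermP hA; have [K hK] := dG A hA.
apply: (@is_derive_quadratic _ _ K) => t t1.
apply: le_trans (hK t t1).
rewrite scale0r addr0 -fZ -!raddfB; exact: fle.
Qed.

Lemma smooth_Herm n (F : 'M[C]_n -> 'M[C]_n) :
  (forall m i j, smoothM (K := cx R) m (fun A => F A i j)) -> smooth_on_Herm F.
Proof.
move=> hF m i j; split.
  apply: (@smoothM_Cm _ _ (@complex.Re R)) (hF m i j); first exact: Re_cmod.
  by move=> t [a b] /=; rewrite mul0r subr0.
apply: (@smoothM_Cm _ _ (@complex.Im R)) (hF m i j); first exact: Im_cmod.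
by move=> t [a b] /=; rewrite mul0r addr0.
Qed.

End Smoothness.

Lemma spmX (C : numClosedFieldType) n (U : 'M[C]_n) f k : U \is unitarymx ->
  spm U f ^+ k = spm U (fun i => f i ^+ k).
Proof.
move=> hU; elim: k => [|k IH]; first by rewrite expr0 spm1.
by rewrite exprS IH -[LHS]/(_ *m _) spmM //; apply: eq_spm => i; rewrite exprS.
Qed.

Lemma spectral_conj (R : realType) (K : complexes R) n (A U : 'M[K]_n) :
  A^t* = A -> U \is unitarymx -> exists W : 'M[K]_n,
  [/\ W \is unitarymx, U *m A *m U^t* = spm W (fun i => (eig A i)%:K)
    & U *m expH A *m U^t* = spm W (fun i => (expR (eig A i))%:K)].
Proof.
move=> hA hU; have hV := dia_unitary hA; exists (dia A *m U^t* ); split.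
- by apply: unitaryM => //; exact: unitaryV.
- exact: (spm_eigen_mul hV hU (esym (dia_eq hA))).
- exact: (spm_eigen_mul hV hU erefl).
Qed.

Lemma spm_dist (R : realType) (K : complexes R) n (U : 'M[K]_n) (f g : 'I_n -> R)
    (d : R) a b : U \is unitarymx -> (forall i, `|f i - g i| <= d) ->
  cxmod (spm U (fun i => (f i)%:K) a b - spm U (fun i => (g i)%:K) a b) <= n%:R * d.
Proof.
move=> hU h; rewrite !spmE -sumrB; apply: le_trans (cxmod_sum _ _ _) _.
apply: (@le_trans _ _ (\sum_(j < n) d)); last by rewrite sumr_const card_ord mulr_natl.
apply: ler_sum => j _; rewrite -mulrBr -rmorphB !cxmodM cxmod_conj cxmod_ofR.
rewrite -[leRHS]mul1r ler_pM ?mulr_ge0 ?cxmod_ge0 //.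
by rewrite mulr_ile1 ?cxmod_ge0 // unitary_cxmod.
Qed.

Section MatrixExponential.
Variable R : realType.
Local Notation C := R[i].

Lemma expmx_partial n (U : 'M[C]_n) (x : 'I_n -> R) N : U \is unitarymx ->
  series (fun m : nat => (m`!%:R : C)^-1 *: spmr U x ^+ m) N =
  spmr U (fun i => series (exp_coeff (x i)) N).
Proof.
move=> hU; rewrite /series /=; apply/matrixP => a b; rewrite summxE /spmr spmE.
under [RHS]eq_bigr do rewrite rmorph_sum mulr_sumr.
rewrite exchange_big /=; apply: eq_bigr => m _.
rewrite mxE spmX // spmE mulr_sumr; apply: eq_bigr => j _.
rewrite /exp_coeff /= rmorphM rmorphXn fmorphV rmorph_nat /=.
by rewrite mulrCA (mulrC (_ ^-1)).
Qed.

(** The partial sums are obtained by functional calculus, and [spm_dist] reduces their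
    convergence to that of the exponential series at the eigenvalues. *)
Lemma expmx_spmr n (U : 'M[C]_n) (x : 'I_n -> R) : U \is unitarymx ->
  expmx (spmr U x) = spmr U (fun i => expR (x i)).
Proof.
move=> hU; rewrite /expmx; apply: cvg_lim; first exact: mx_hausdorff.
move=> S /nbhs_mxP [e e0 he].
have n1 : 0 < n.+1%:R :> R by [].
have en : 0 < e / n.+1%:R by rewrite divr_gt0.
have h i : \forall N \near \oo, `|expR (x i) - series (exp_coeff (x i)) N| < e / n.+1%:R.
  have : series (exp_coeff (x i)) @ \oo --> expR (x i).
    exact: (is_cvg_series_exp_coeff (x i)).
  by move/cvgrPdist_lt/(_ _ en).
have : \forall N \near \oo, forall i,
    `|expR (x i) - series (exp_coeff (x i)) N| < e / n.+1%:R.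
  exact: filter_forall.
rewrite nbhs_simpl /=; apply: filterS => N hN /=.
suff hS : S (spmr U (fun i => series (exp_coeff (x i)) N)).
  by move: hS; rewrite -(expmx_partial x N hU).
apply: he => a b.
apply: le_lt_trans (spm_dist (K := cx R) a b hU (fun j => ltW (hN j))) _.
rewrite mulrCA -[ltRHS]mulr1 ltr_pM2l // ltr_pdivrMr // mul1r.
by rewrite ltr_nat.
Qed.

Lemma exp_conj_unitary n (U A : 'M[C]_n) : U \is unitarymx -> Herm A ->
  exp_conj U A = U *m expH (K := cx R) A *m U^t*.
Proof.
move=> hU hA; rewrite /exp_conj invmx_unitary //.
have hA' : A^t* = A by exact/hermP.
have [W [hW eA eE]] := spectral_conj (K := cx R) hA' hU.
rewrite [U *m A *m _]eA [RHS]eE; exact: expmx_spmr.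
Qed.

End MatrixExponential.

(** * Identification of psi and gamma *)

Section Positive.
Variables (R : realType) (K : complexes R).

Lemma ofR_gt0 (x : R) : 0 < x -> 0 < ofR K x.
Proof.
move=> x0; rewrite lt_neqAle -(rmorph0 (ofR K)) leK (ltW x0) andbT.
by apply/eqP => /inj_ofR h; move: x0; rewrite -h ltxx.
Qed.

Lemma spm_pos n (U : 'M[K]_n) (f : 'I_n -> R) (x : 'cV[K]_n) : U \is unitarymx ->
  (forall i, 0 < f i) -> x != 0 ->
  0 < (x^t* *m spm U (fun i => (f i)%:K) *m x) ord0 ord0.
Proof.
move=> hU f0 x0; pose y := U *m x.
have y0 : y != 0.
  apply: contraNneq x0 => e.
  by rewrite -[x]mul1mx -(unitary_mulVl hU) -mulmxA -/y e mulmx0.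
have -> : x^t* *m spm U (fun i => (f i)%:K) *m x =
  y^t* *m (diag_mx (\row_i (f i)%:K) *m y).
  by rewrite /y /spm adjM !mulmxA.
have -> : (y^t* *m (diag_mx (\row_i (f i)%:K) *m y)) ord0 ord0 =
  \sum_j (f j * (cxmod (y j ord0)) ^+ 2)%:K.
  rewrite mxE; apply: eq_bigr => j _.
  rewrite adjE mul_diag_mx [X in _ * X]mxE [X in _ * (X * _)]mxE.
  by rewrite mulrCA rmorphM /= cxmod_sqr [X in _ * X]mulrC.
rewrite -rmorph_sum; apply: ofR_gt0.
have [j yj] : exists j, y j ord0 != 0.
  apply/existsP; apply: contraNT y0; rewrite negb_exists => /forallP h.
  by apply/eqP/matrixP => j k; rewrite (ord1 k) [RHS]mxE; apply/eqP; have := h j; rewrite negbK.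
rewrite (bigD1 j) //= ltr_pwDl //.
  rewrite mulr_gt0 // exprn_gt0 // lt_neqAle cxmod_ge0 andbT eq_sym.
  by apply: contraNneq yj => /cxmod_eq0 ->.
by apply: sumr_ge0 => k _; rewrite mulr_ge0 ?sqr_ge0 // ltW.
Qed.

Lemma gam_pos n (A : 'M[K]_n) (x : 'cV[K]_n) : A^t* = A -> x != 0 ->
  0 < (x^t* *m gam A *m x) ord0 ord0.
Proof.
move=> hA x0; rewrite gam_spm //; apply: spm_pos => //; first exact: gam_frame.
by move=> i; exact: expR_gt0.
Qed.

Lemma loc_lip_gam n a b : loc_lip (fun A : 'M[K]_n => gam A a b).
Proof.
apply: (@loc_lip_mulmx _ _ _ _ (fun A => psi A *m expH A) (fun A => (psi A)^t* )) => c d.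
  apply: (@loc_lip_mulmx _ _ _ _ (fun A => psi A) (fun A => expH A)) => a' b'.
    exact: loc_lip_psi.
  exact: loc_lip_expH.
apply: (@loc_lip_adj _ _ _ _ (fun A => psi A)) => a' b'; exact: loc_lip_psi.
Qed.

End Positive.

Lemma path_near (R : realType) (K : complexes R) (f : R -> K) : path_lip f ->
  forall s, unit_interval s -> forall e, 0 < e -> exists2 d, 0 < d &
  forall t, unit_interval t -> `|s - t| < d -> cxmod (f s - f t) < e.
Proof.
move=> [C [C0 _ h]] s hs e e0; have C1 : 0 < C + 1 by exact: ltr_wpDl.
exists (e / (C + 1)); first by rewrite divr_gt0.
move=> t ht st; apply: le_lt_trans (h _ s t hs ht (ltW st)) _.
by rewrite mulrCA -[ltRHS]mulr1 ltr_pM2l // ltr_pdivrMr // mul1r ltrDl.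
Qed.

Section Characterization.
Variable R : realType.
Local Notation C := R[i].
Local Notation psiC n := (@psi R (cx R) n).
Local Notation gamC n := (@gam R (cx R) n).

Lemma Sym_Herm n : @Defs.Sym R n `<=` @Herm R n.
Proof. by move=> A /SymP []. Qed.

Lemma exp_conj_psi n (A : 'M[C]_n) : Herm A -> exp_conj (psiC n A) A = gamC n A.
Proof.
move=> hA; have hA' : A^t* = A by exact/hermP.
rewrite exp_conj_unitary //; exact: (@psi_unitary R (cx R) n A hA').
Qed.

Lemma mu_gam n (A : 'M[C]_n) k (hk : (k <= n)%N) : Herm A ->
  mu hk (gamC n A) =1 lambda hk A.
Proof.
move=> /hermP hA i; rewrite /mu.
by rewrite [lambda _ _ _](@eig_corner_gam R (cx R) n k hk A hA i) expRK.
Qed.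

Lemma psi_continuous n : {within @Herm R n, continuous (psiC n)}.
Proof. by apply: within_lip => i j; exact: loc_lip_psi. Qed.

Lemma psi_sym n : is_psi_sym (psiC n).
Proof.
split.
- exact: continuous_subspaceW (@Sym_Herm n) (@psi_continuous n).
- move=> A /SymP [/hermP hA rA]; apply: SOn_intro.
  + exact: (@psi_unitary R (cx R)).
  + exact: (@det_psi R (cx R)).
  + by rewrite (@psi_conj R (cx R) n A hA) rA.
- exact: (@psi0 R (cx R)).
- move=> A /Sym_Herm hA k hk; rewrite exp_conj_psi //; exact: mu_gam.
Qed.

(** The [scaling_path] connects [B] with [gam B] inside [Sym0]. *)
Lemma gam_component n (A B : 'M[C]_n) : connected_component (@Sym0 R n) A B ->
  connected_component (@Sym0 R n) A (gamC n B).
Proof.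
move=> hAB; have [/Herm0P [/hermP hB gB] /SymP [_ rB]] := connected_component_sub hAB.
apply: connected_component_trans hAB _.
pose p : R -> 'M[C]_n := @scaling_path R (cx R) n B.
have I01 (s : R) : `[0, 1]%classic s -> unit_interval s by rewrite /= in_itv.
have cp : connected (p @` `[0, 1]).
  apply: connected_continuous_connected; first exact: segment_connected.
  apply/subspace_continuousP => s s01 S /= /nbhs_mxP [e e0 he].
  rewrite nbhs_simpl /= /within /=.
  have [d d0 hd] := @ffin_min R ('I_n * 'I_n)%type
    (fun q d => forall t : R, unit_interval t -> `|s - t| < d ->
       cmod (p s q.1 q.2 - p t q.1 q.2) < e)
    (fun q d d' _ dd h t t01 st => h t t01 (lt_le_trans st dd))
    (fun q => path_near (@scaling_path_lip R (cx R) n B q.1 q.2 hB) (I01 s s01) e0).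
  apply/nbhs_ballP; exists d => // t; rewrite -ball_normE /= => st t01.
  by apply: he => i j; exact: (hd (i, j) t (I01 t t01)).
exists (p @` `[0, 1]).
  split => //.
  - exists 0; first by rewrite /= in_itv /= lexx ler01.
    exact: (@scaling_path0 R (cx R)).
  - move=> _ [s s01 <-]; have /andP[s0 _] := I01 s s01.
    have [h1 h2 h3] := @scaling_path_in R (cx R) n B s hB rB gB s0.
    split; last by apply/SymP; split=> //; exact/hermP.
    by apply/Herm0P; split=> //; exact/hermP.
exists 1; first by rewrite /= in_itv /= lexx ler01.
exact: (@scaling_path1 R (cx R)).
Qed.

Lemma gam_gamma n : is_gamma (gamC n).
Proof.
split.
- by apply: within_lip => i j; exact: loc_lip_gam.
- move=> A /hermP hA; split; first by apply/hermP; exact: (@gam_herm R (cx R)).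
  by move=> x x0; exact: (@gam_pos R (cx R)).
- by move=> A hA k hk; exact: mu_gam.
- move=> A t /Herm0P [/hermP hA gA] ht; rewrite !rots_act_tori.
  rewrite (@rots_actE R (cx R) n t A hA gA ht).
  exact: (@gam_rots R (cx R)).
- by move=> A _ _ [B hB <-]; exact: gam_component.
Qed.

End Characterization.

(** * Uniqueness and the theorem *)

Section Uniqueness.
Variable R : realType.
Local Notation C := R[i].
Local Notation psiC n := (@psi R (cx R) n).
Local Notation gamC n := (@gam R (cx R) n).

Lemma within_agree n (F G : 'M[C]_n -> 'M[C]_n) :
  {within @Herm R n, continuous F} -> {within @Herm R n, continuous G} ->
  (forall A, Herm0 A -> F A = G A) -> forall A, Herm A -> F A = G A.
Proof.
move=> /within_mxP cF /within_mxP cG FG A hA; have /hermP hA' := hA.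
apply/matrixP => i j; apply/eqP; rewrite -subr_eq0; apply/eqP.
apply: (@cxmod_eq0 R (cx R)); apply/eqP; rewrite eq_le; apply/andP; split;
  last exact: (@cxmod_ge0 R (cx R)).
apply/ler_addgt0Pr => e e0; rewrite add0r.
have e2 : 0 < e / 2 by rewrite divr_gt0.
have [d d0 hd] := cF A hA _ e2; have [d' d0' hd'] := cG A hA _ e2.
pose m := Num.min d d' / 2.
have m0 : 0 < m by rewrite divr_gt0 // lt_min d0.
have md : m < Num.min d d' by rewrite ltr_pdivrMr // mulr_natr mulr2n ltrDl lt_min d0.
have [B [hB gB [_ cl]]] := @generic_dense R (cx R) n A m hA' m0.
have hB' : Herm B by exact/hermP.
have nd : near_mx d A B.
  by move=> a b; apply: le_lt_trans (cl a b) _; apply: lt_le_trans md _; rewrite ge_min lexx.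
have nd' : near_mx d' A B.
  by move=> a b; apply: le_lt_trans (cl a b) _; apply: lt_le_trans md _; rewrite ge_min lexx orbT.
have FGB : F B = G B by apply: FG; apply/Herm0P.
have -> : F A i j - G A i j = (F A i j - F B i j) + (G B i j - G A i j).
  by rewrite FGB addrA subrK.
apply: le_trans (@cxmodD R (cx R) _ _) _; rewrite [leRHS](splitr e) lerD //.
  exact: ltW (hd B hB' nd i j).
by rewrite (@cxmodB R (cx R)); exact: ltW (hd' B hB' nd' i j).
Qed.

Lemma chi_unitary n (A : 'M[C]_n) t : Herm A -> tori t -> chi t A \is unitarymx.
Proof. by move=> /hermP hA ht; exact: (@rots_unitary R (cx R)). Qed.

Lemma psi_tori n (A : 'M[C]_n) t : Herm0 A -> tori t ->
  psiC n (tori_act t A) = chi t (gamC n A) *m psiC n A *m invmx (chi t A).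
Proof.
move=> /Herm0P [hA gA] ht; have uX := chi_unitary hA ht.
move/hermP: hA => hA; rewrite rots_act_tori (@rots_actE R (cx R) n t A hA gA ht).
rewrite invmx_unitary //; exact: (@psi_rots R (cx R)).
Qed.

(** Equivariance determines the map on torus orbits of real matrices, which sweep out
    the dense set [Herm0]. *)
Lemma psi_unique n (psi0 gamma g : 'M[C]_n -> 'M[C]_n) :
  (forall A, Sym A -> psiC n A = psi0 A) ->
  is_psi_ext psi0 gamma (psiC n) -> is_psi_ext psi0 gamma g ->
  forall A, Herm A -> g A = psiC n A.
Proof.
move=> hS [cp _ sp ep] [cg _ sg eg]; apply: within_agree => // A /Herm0P [/hermP hA gA].
have [t [S [ht [hS' rS gS eS]]]] := @generic_orbit R (cx R) n A hA gA.
have S0 : Herm0 S by apply/Herm0P; split=> //; exact/hermP.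
have SS : Sym S by apply/SymP; split=> //; exact/hermP.
have eA : tori_act t S = A by exact: eS.
by rewrite -eA eg // ep // sg // sp.
Qed.

End Uniqueness.

Theorem theorem1p3 (R : realType)
    (psi0 gamma : forall n : nat, 'M[R[i]]_n -> 'M[R[i]]_n)
    (hpsi0 : forall n : nat, (0 < n)%N ->
       unique_on (@Sym R n) (@is_psi_sym R n) (psi0 n))
    (hgamma : forall n : nat, (0 < n)%N ->
       unique_on (@Herm R n) (@is_gamma R n) (gamma n)) :
  exists psi : forall n : nat, 'M[R[i]]_n -> 'M[R[i]]_n,
  forall n : nat, (0 < n)%N ->
  [/\ unique_on (@Herm R n) (is_psi_ext (psi0 n) (gamma n)) (psi n),
      smooth_on_Herm (psi n)
    & forall A : 'M[R[i]]_n, Herm A -> gamma n A = exp_conj (psi n A) A] /\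
  [/\ forall t A : 'M[R[i]]_n, torus t -> Herm A ->
        psi n (t *m A *m invmx t) = t *m psi n A *m invmx t,
      forall A : 'M[R[i]]_n, Herm A ->
        map_mx Num.conj (psi n A) = psi n (map_mx Num.conj A)
    & forall (k : nat) (hk : (k <= n)%N), (0 < k)%N ->
        forall A : 'M[R[i]]_k, Herm A ->
          psi n (extend 0 hk A) = extend 1 hk (psi k A)].
Proof.
exists (@psi R (cx R)) => n n0.
have [_ uS] := hpsi0 n n0; have [_ uH] := hgamma n n0.
have eS A : Sym A -> @psi R (cx R) n A = psi0 n A by apply: uS; exact: psi_sym.
have eH A : Herm A -> @gam R (cx R) n A = gamma n A by apply: uH; exact: gam_gamma.
have ext : is_psi_ext (psi0 n) (gamma n) (@psi R (cx R) n).
  split => //; first exact: psi_continuous.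
    move=> A /hermP hA; split; first exact: (@psi_unitary R (cx R)).
    exact: (@det_psi R (cx R)).
  move=> A t hA ht; have [hH _] := hA.
  rewrite -(eH A hH); exact: psi_tori.
split; split.
- by split=> // g hg; exact: psi_unique eS ext hg.
- apply: smooth_Herm => m i j; exact: psi_smooth.
- by move=> A hA; rewrite exp_conj_psi // eH.
- move=> t A [dt ut] /hermP hA; rewrite invmx_unitary //.
  exact: (@psi_diag R (cx R)).
- by move=> A /hermP hA; exact: (@psi_conj R (cx R)).
- by move=> k hk _ A /hermP hA; exact: (@psi_extend R (cx R)).
Qed.
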